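(* Assume that $k$ is a translational invariant kernel with finite smoothness $\tau>d/2$, and let $\Omega\subset\mathbb{R}^d$ be a compact set which satisfies an interior cone condition and has a Lipschitz boundary. Then there exists a constant $c>0$ with the following property: any $\gamma$-stabilized algorithm ($0<\gamma\le1$) applied to a function in $\mathcal{H}_k(\Omega)$ gives a sequence of point sets $X_N\subset\Omega$ such that for all $N\in\mathbb{N}$ $$h_N\le c\cdot\gamma^{-2/(\tau-d/2)}\cdot N^{-1/d} .$$
   Context: Kernels. A kernel on $\Omega\subset\mathbb{R}^d$ is a symmetric function $k:\Omega\times\Omega\to\mathbb{R}$; it is strictly positive definite if for all finite sets of pairwise distinct points $X_N=\{x_1,\dots,x_N\}\subset\Omega$ the matrix $(k(x_i,x_j))_{i,j}$ is positive definite. Its native space $\mathcal{H}_k(\Omega)$ is the unique reproducing kernel Hilbert space of functions on $\Omega$ with reproducing kernel $k$. For a finite set $X_N=\{x_1,\dots,x_N\}\subset\Omega$ of pairwise distinct points, $V(X_N)=\mathrm{span}\{k(\cdot,x_i):x_i\in X_N\}$ and $\Pi_{V(X_N)}$ is the orthogonal projection of $\mathcal{H}_k(\Omega)$ onto $V(X_N)$. The Power function is $P_{X_N}(x)=\|k(\cdot,x)-\Pi_{V(X_N)}(k(\cdot,x))\|_{\mathcal{H}_k(\Omega)}$, with $P_{\emptyset}(x)=\|k(\cdot,x)\|_{\mathcal{H}_k(\Omega)}$. The fill distance is $h_N=\sup_{x\in\Omega}\min_{x_i\in X_N}\|x-x_i\|_2$. Finite smoothness. $k$ is translational invariant if $k(x,y)=\Phi(x-y)$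 for some $\Phi:\mathbb{R}^d\to\mathbb{R}$. It is a kernel of finite smoothness $\tau>d/2$ if its native space is norm equivalent to the Sobolev space $W_2^\tau$; for translational invariant kernels this is the situation in which $c_\Phi(1+\|\omega\|_2^2)^{-\tau}\le\hat\Phi(\omega)\le C_\Phi(1+\|\omega\|_2^2)^{-\tau}$ for all $\omega\in\mathbb{R}^d$ with constants $c_\Phi,C_\Phi>0$, so that $\mathcal{H}_k(\mathbb{R}^d)$ is norm equivalent to $W_2^\tau(\mathbb{R}^d)$, and it is assumed throughout that the boundary of $\Omega$ is regular enough that also $\mathcal{H}_k(\Omega)$ is norm equivalent to $W_2^\tau(\Omega)$. $\gamma$-stabilized algorithm. Let $0<\gamma\le1$ and $X_0=\emptyset$. For $N\ge0$ set $\Omega_\gamma^{(N)}=\{x\in\Omega: P_{X_N}(x)\ge\gamma\|P_{X_N}\|_{L^\infty(\Omega)}\}$. Given selection criteria $\eta^{(N)}:\Omega\to\mathbb{R}_{\ge0}$ (arbitrary, possibly depending on the target function and $X_N$), the algorithm selects $x_{N+1}\in\arg\max_{x\in\Omega_\gamma^{(N)}}\eta^{(N)}(x)$ (any maximizer) and sets $X_{N+1}=X_N\cup\{x_{N+1}\}$. ''Any $\gamma$-stabilized algorithm'' means that the choice of $\eta^{(N)}$ is arbitrary. *)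

(* Defs.v *)
From HB Require Import structures.
From mathcomp Require Import all_boot all_order all_algebra.
From mathcomp Require Import all_classical all_reals all_analysis.

Set Implicit Arguments.
Unset Strict Implicit.
Unset Printing Implicit Defensive.

Import Order.TTheory GRing.Theory Num.Theory.
Import numFieldNormedType.Exports.

Local Open Scope classical_set_scope.
Local Open Scope ring_scope.

(* Lebesgue measure on R^n, realised as 'rV[R]_n with the Borel sigma-algebra
   (generated by the coordinate maps). *)

Definition rV_display : measure_display. Proof. exact: default_measure_display. Qed.

Section rV_measurable.
Context {R : realType} (n : nat).

Let coors : 'I_n -> 'rV[R]_n -> measurableTypeR R := fun i v => v ord0 i.

Let rV_set0 : g_sigma_preimage coors set0.
Proof. exact: sigma_algebra0. Qed.

Let rV_setC A : g_sigma_preimage coors A -> g_sigma_preimage coors (~` A).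
Proof. exact: sigma_algebraC. Qed.

Let rV_bigcup (F : (set 'rV[R]_n)^nat) :
  (forall i, g_sigma_preimage coors (F i)) ->
  g_sigma_preimage coors (\bigcup_i (F i)).
Proof. exact: sigma_algebra_bigcup. Qed.

HB.instance Definition _ := @isMeasurable.Build rV_display
  'rV[R]_n (g_sigma_preimage coors) rV_set0 rV_setC rV_bigcup.

Lemma measurable_coor (i : 'I_n) :
  measurable_fun setT (fun v : 'rV[R]_n => v ord0 i : measurableTypeR R).
Proof.
move=> _ Y mY; rewrite setTI; apply: sub_sigma_algebra => /=.
rewrite -bigcup_seq/=; exists i => /=; first by rewrite mem_index_enum.
by exists Y => //; rewrite setTI.
Qed.

Lemma measurable_fun_rV d (T : measurableType d) (f : T -> 'rV[R]_n) :
  (forall i, measurable_fun setT (fun x => f x ord0 i : measurableTypeR R)) ->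
  measurable_fun setT f.
Proof.
move=> mf; have sub : g_sigma_preimage (fun i => coors i \o f) `<=` measurable.
  apply: smallest_sub; first exact: sigma_algebra_measurable.
  by move=> A; rewrite -bigcup_seq => -[i _ [B mB <-]]; exact: mf.
move=> _ A mA; apply: sub.
by rewrite g_sigma_preimage_comp; exists A.
Qed.

End rV_measurable.

Section rV_cons.
Context {R : realType} (n : nat).

Definition rV_cons (p : measurableTypeR R * 'rV[R]_n) : 'rV[R]_n.+1 :=
  row_mx (const_mx (p.1 : R) : 'rV_1) p.2.

Let rV_uncons (v : 'rV[R]_n.+1) : measurableTypeR R * 'rV[R]_n :=
  (v ord0 ord0, rsubmx (v : 'rV_(1 + n))).

Let rV_consK : cancel rV_cons rV_uncons.
Proof.
move=> [x v]; rewrite /rV_uncons /rV_cons row_mxKr; congr (_, _).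
by rewrite mxE; case: splitP => // j _; rewrite mxE.
Qed.

Lemma measurable_rV_cons : measurable_fun setT rV_cons.
Proof.
apply: measurable_fun_rV => i.
pose g (p : measurableTypeR R * 'rV[R]_n) : measurableTypeR R :=
  if @fintype.split 1 n i is inr j then p.2 ord0 j else p.1.
rewrite (_ : (fun x => _) = g); last first.
  by rewrite /g; apply/funext => p; rewrite mxE; case: fintype.split => // j; rewrite mxE.
rewrite /g; case: fintype.split => [_|j]; first exact: measurable_fst.
exact: (measurableT_comp (measurable_coor j) measurable_snd).
Qed.

Let measurable_rV_uncons : measurable_fun setT rV_uncons.
Proof.
apply/measurable_fun_pairP; split; first exact: measurable_coor.
apply: measurable_fun_rV => i.
rewrite (_ : (fun x => _) =
    fun v : 'rV[R]_n.+1 => v ord0 (rshift 1 i) : measurableTypeR R).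
  exact: measurable_coor.
by apply/funext => v /=; rewrite mxE.
Qed.

Variable mu : {sigma_finite_measure set 'rV[R]_n -> \bar R}.

Definition lebesgue_cons : set 'rV[R]_n.+1 -> \bar R :=
  pushforward (lebesgue_measure \x mu)%E rV_cons.

Let mpre A : measurable A -> measurable (rV_cons @^-1` A).
Proof. by move=> mA; rewrite -[X in measurable X]setTI; exact: measurable_rV_cons. Qed.

Let lebesgue_cons0 : lebesgue_cons set0 = 0%E.
Proof. by rewrite /lebesgue_cons /pushforward preimage_set0 measure0. Qed.

Let lebesgue_cons_ge0 A : (0 <= lebesgue_cons A)%E.
Proof. by rewrite /lebesgue_cons /pushforward; apply: measure_ge0. Qed.

Let lebesgue_cons_sigma_additive : semi_sigma_additive lebesgue_cons.
Proof.
move=> F mF tF mUF; rewrite /lebesgue_cons /pushforward preimage_bigcup.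
apply: measure_semi_sigma_additive.
- by move=> i; exact: mpre.
- apply/trivIsetP => /= i j _ _ ij; rewrite -preimage_setI.
  by move/trivIsetP : tF => /(_ _ _ _ _ ij) ->//; rewrite preimage_set0.
- by rewrite -preimage_bigcup; exact: mpre.
Qed.

HB.instance Definition _ := isMeasure.Build _ _ _ lebesgue_cons
  lebesgue_cons0 lebesgue_cons_ge0 lebesgue_cons_sigma_additive.

Let lebesgue_cons_sigma_finite : sigma_finite setT lebesgue_cons.
Proof.
have /sigma_finiteP[F [TF ndF mF]] := sigma_finiteT (@lebesgue_measure R).
have /sigma_finiteP[G [TG ndG mG]] := sigma_finiteT mu.
exists (fun i => rV_uncons @^-1` (F i `*` G i)).
  rewrite -preimage_bigcup; apply/esym/seteqP; split => // v _.
  have : (\bigcup_i F i) (rV_uncons v).1 by rewrite -TF.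
  have : (\bigcup_i G i) (rV_uncons v).2 by rewrite -TG.
  move=> [l _ Gl] [m _ Fm]; exists (maxn l m) => //; split.
    by move: Fm; exact/subsetPset/ndF/leq_maxr.
  by move: Gl; exact/subsetPset/ndG/leq_maxl.
move=> i; have [mFi Fi] := mF i; have [mGi Gi] := mG i; split.
  rewrite -[X in measurable X]setTI.
  by apply: measurable_rV_uncons => //; exact: measurableX.
rewrite /lebesgue_cons /pushforward -comp_preimage.
rewrite (_ : _ \o _ = id); last by apply/funext => p; exact: rV_consK.
by rewrite preimage_id product_measure1E// lte_mul_pinfty// ge0_fin_numE.
Qed.

HB.instance Definition _ := Measure_isSigmaFinite.Build _ _ _
  lebesgue_cons lebesgue_cons_sigma_finite.

End rV_cons.

Fixpoint lebesgue_rV {R : realType} (n : nat) :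
    {sigma_finite_measure set 'rV[R]_n -> \bar R} :=
  match n with
  | 0 => \d_(0 : 'rV[R]_0)
  | m.+1 => lebesgue_cons (lebesgue_rV m)
  end.

Section Euclidean.
Context {R : realType} {d : nat}.
Implicit Types (x y : 'rV[R]_d) (Om : set 'rV[R]_d).

Definition dotp x y : R := \sum_(i < d) x ord0 i * y ord0 i.

(* The library norm `|x| on 'rV[R]_d is the maximum norm. *)
Definition norm2 x : R := Num.sqrt (dotp x x).

Definition cone x xi (theta r : R) : set 'rV[R]_d :=
  [set z | exists (y : 'rV[R]_d) (l : R), [/\ norm2 y = 1,
     cos theta <= dotp y xi, 0 <= l <= r & z = x + l *: y]].

Definition interior_cone_condition Om :=
  exists theta r : R, [/\ 0 < theta < pi / 2, 0 < r &
    forall x, Om x -> exists2 xi, norm2 xi = 1 & cone x xi theta r `<=` Om].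

(* Near each boundary point, Om is the closed subgraph of a Lipschitz function
   of the d - 1 coordinates orthogonal to some unit vector e; phi is only
   evaluated on the hyperplane e^\perp. *)
Definition lipschitz_boundary Om :=
  forall x, (closure Om `\` Om°) x ->
  exists (e : 'rV[R]_d) (r L : R) (phi : 'rV[R]_d -> R),
    [/\ norm2 e = 1, 0 < r,
        forall u v, `|phi u - phi v| <= L * norm2 (u - v) &
        forall y, norm2 (y - x) < r ->
          (Om y <-> dotp y e <= phi (y - dotp y e *: e))].

End Euclidean.

Section Smooth.
Context {R : realType} {d : nat}.
Implicit Types (g phi : 'rV[R]_d -> R) (a : 'I_d -> nat).

Definition partial (i : 'I_d) g : 'rV[R]_d -> R :=
  fun x => 'D_(delta_mx ord0 i) g x.

Definition smooth phi := forall s : seq 'I_d,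
  let g := foldr partial phi s in
  continuous g /\ forall i x, derivable g x (delta_mx ord0 i).

Definition mindex_order a : nat := (\sum_(i < d) a i)%N.

Definition mpartial a g : 'rV[R]_d -> R :=
  foldr (fun i => iter (a i) (partial i)) g (enum 'I_d).

Definition test_function (U : set 'rV[R]_d) phi :=
  smooth phi /\
  exists K : set 'rV[R]_d,
    [/\ compact K, K `<=` U & forall x, ~ K x -> phi x = 0].

Definition schwartz phi :=
  smooth phi /\ forall (s : seq 'I_d) (n : nat), exists M : R,
    forall x, (1 + norm2 x) ^+ n * `|foldr partial phi s x| <= M.

End Smooth.

Section Fourier.
Context {R : realType} {d : nat}.
Local Notation mu := (lebesgue_rV d).
Implicit Types (phi Phi g : 'rV[R]_d -> R) (w x : 'rV[R]_d).

(* Real and imaginary part of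
   (2 pi)^(-d/2) \int phi(x) exp(- i <x, w>) dx for a real-valued phi. *)
Definition fourier_re phi w : R :=
  (2 * pi) `^ (- (d%:R / 2)) * \int[mu]_x (phi x * cos (dotp x w)).

Definition fourier_im phi w : R :=
  - ((2 * pi) `^ (- (d%:R / 2)) * \int[mu]_x (phi x * sin (dotp x w))).

(* The real function g is the Fourier transform of Phi in the sense of tempered
   distributions, <g, phi> = <Phi, \hat phi> for every Schwartz function phi,
   so that Phi need not be integrable.  Real-valued phi suffice by linearity. *)
Definition is_fourier_transform Phi g :=
  forall phi, schwartz phi ->
    \int[mu]_x (Phi x * fourier_re phi x) = \int[mu]_w (g w * phi w) /\
    \int[mu]_x (Phi x * fourier_im phi x) = 0.

(* A Phi for which Phi (x - y) is the kernel of a native space on R^d equivalent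
   to W_2^tau(R^d), tau > d/2, is always bounded and continuous; boundedness
   makes Phi a tempered distribution. *)
Definition fourier_decay Phi (tau : R) :=
  continuous Phi /\ (exists M : R, forall x, `|Phi x| <= M) /\
  exists g : 'rV[R]_d -> R,
    [/\ measurable_fun setT g, is_fourier_transform Phi g &
      exists c C : R, [/\ 0 < c, 0 < C &
        forall w, c * (1 + norm2 w ^+ 2) `^ (- tau) <= g w
                  <= C * (1 + norm2 w ^+ 2) `^ (- tau)]].

End Fourier.

Section Sobolev.
Context {R : realType} {d : nat}.
Local Notation mu := (lebesgue_rV d).
Implicit Types (U : set 'rV[R]_d) (F G : 'rV[R]_d -> R) (tau : R).

Definition mem_L2 U F :=
  measurable_fun U F /\ (\int[mu]_(x in U) ((F x) ^+ 2)%:E < +oo)%E.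

Definition weak_derivative U (a : 'I_d -> nat) F G :=
  forall phi, test_function U phi ->
    \int[mu]_(x in U) (F x * mpartial a phi x) =
    (-1) ^+ mindex_order a * \int[mu]_(x in U) (G x * phi x).

(* Multi-indices of order at most m are functions 'I_d -> {0, ..., m}. *)
Definition mindex m (a : {ffun 'I_d -> 'I_m.+1}) : 'I_d -> nat := fun i => a i.

Definition weak_derivatives U (m : nat) F
    (D : {ffun 'I_d -> 'I_m.+1} -> 'rV[R]_d -> R) :=
  mem_L2 U F /\ forall a, (mindex_order (mindex a) <= m)%N ->
    mem_L2 U (D a) /\ weak_derivative U (mindex a) F (D a).

Definition slobodeckij_sq U (s : R) G : \bar R :=
  (\int[mu]_(x in U) \int[mu]_(y in U)
    ((G x - G y) ^+ 2 / norm2 (x - y) `^ (d%:R + 2 * s))%:E)%E.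

(* Square of the norm of W_2^tau(U), U open, tau = m + s with 0 <= s < 1, and
   +oo when F is not in W_2^tau(U).  The infimum ranges over the
   representatives, all giving the same value, of the weak derivatives of F. *)
Definition sobolev_sqnorm U tau F : \bar R :=
  let m := Num.truncn tau in
  let s := tau - m%:R in
  ereal_inf [set
    (\sum_(a : {ffun 'I_d -> 'I_m.+1} | (mindex_order (mindex a) <= m)%N)
       \int[mu]_(x in U) ((D a x) ^+ 2)%:E +
     (if s == 0%R then 0 else
       \sum_(a : {ffun 'I_d -> 'I_m.+1} | mindex_order (mindex a) == m)
         slobodeckij_sq U s (D a)))%E
    | D in weak_derivatives U F].

End Sobolev.

Section NativeSpace.
Context {R : realType} {T : Type}.

(* The Hilbert space of functions on T with reproducing kernel k; ns_dot is
   only meaningful on members.  k determines ns_set and ns_dot on ns_set. *)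
Record native_space (k : T -> T -> R) := NativeSpace {
  ns_set : set (T -> R);
  ns_dot : (T -> R) -> (T -> R) -> R;
  ns_set0 : ns_set (cst 0);
  ns_setP : forall (a : R) f g, ns_set f -> ns_set g ->
    ns_set (fun x => a * f x + g x);
  ns_dotC : forall f g, ns_set f -> ns_set g -> ns_dot f g = ns_dot g f;
  ns_dotP : forall (a : R) f g h, ns_set f -> ns_set g -> ns_set h ->
    ns_dot (fun x => a * f x + g x) h = a * ns_dot f h + ns_dot g h;
  ns_dot_gt0 : forall f, ns_set f -> f <> cst 0 -> 0 < ns_dot f f;
  ns_complete : forall u : nat -> T -> R, (forall n, ns_set (u n)) ->
    (forall e : R, 0 < e -> exists N, forall m n, (N <= m)%N -> (N <= n)%N ->
       ns_dot (u m \- u n) (u m \- u n) < e) ->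
    exists2 f, ns_set f & (fun n => ns_dot (u n \- f) (u n \- f)) @ \oo --> 0;
  ns_kernel : forall x, ns_set (k ^~ x);
  ns_reproducing : forall f x, ns_set f -> ns_dot f (k ^~ x) = f x
}.

Variables (k : T -> T -> R) (H : native_space k).
Implicit Types (X : seq T) (x : T) (f : T -> R) (gamma : R).

Definition ns_norm f : R := Num.sqrt (ns_dot H f f).

Definition kernel_span X : set (T -> R) :=
  [set f | exists a : T -> R, f = fun y => \sum_(x <- X) a x * k y x].

Definition ns_proj X f : T -> R :=
  xget (cst 0) [set p | kernel_span X p /\
    forall v, kernel_span X v -> ns_dot H (f \- p) v = 0].

Definition power_function X x : R := ns_norm (k ^~ x \- ns_proj X (k ^~ x)).

(* The supremum norm is taken pointwise: the power function is continuous. *)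
Definition stabilized_set gamma X : set T :=
  [set x | (gamma%:E * ereal_sup (range (fun y => (power_function X y)%:E))
            <= (power_function X x)%:E)%E].

(* mkseq x N = [:: x 0; ...; x N.-1] is the point set X_N, and eta X_N the
   selection criterion of the step that selects x N. *)
Definition gamma_stabilized gamma (eta : seq T -> T -> R) (x : nat -> T) :=
  forall N, let XN := mkseq x N in
    stabilized_set gamma XN (x N) /\
    forall y, stabilized_set gamma XN y -> eta XN y <= eta XN (x N).

End NativeSpace.

Section Domain.
Context {R : realType} {d : nat} {Om : set 'rV[R]_d}.

Definition translation_invariant (k : Om -> Om -> R) (Phi : 'rV[R]_d -> R) :=
  forall x y, k x y = Phi (val x - val y).

Definition equiv_sobolev (k : Om -> Om -> R) (H : native_space k) (tau : R) :=
  let ext : (Om -> R) -> 'rV[R]_d -> R := valL_ 0 in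
  exists c C : R, [/\ 0 < c, 0 < C,
    forall f, ns_set H f ->
      ((c * ns_norm H f ^+ 2)%:E <= sobolev_sqnorm Om° tau (ext f)
        <= (C * ns_norm H f ^+ 2)%:E)%E &
    forall F, (sobolev_sqnorm Om° tau F < +oo)%E ->
      exists2 f, ns_set H f & ae_eq (lebesgue_rV d) Om° F (ext f)].

Definition fill_distance (X : seq Om) : \bar R :=
  ereal_sup (range (fun x : Om =>
    \big[Order.min/+oo%E]_(y <- X) (norm2 (val x - val y))%:E)).

End Domain.

(* Main.v *)
(** Regularising by Gaussians and inverting the Fourier transform turns the
quadratic form [\sum a_i a_j Phi (x_i - x_j)] into an integral of the Fourier
transform of [Phi] against [|\sum a_i e^(i w x_i)|^2], which the decay
condition bounds from both sides.  Write [b = tau - d/2].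

Lower bound on the power function: if [x] is at distance [h] from the nodes,
then [(1 + |w|^2)^(-tau)] dominates a multiple of a function whose Fourier
transform is concentrated in the ball of radius [h], so that only the diagonal
coefficient of [x] survives and the power function at [x] is at least
[c h^b].

Upper bound: by the cone condition every point of [Om] has nearby nodes in
[Om], at scale [s], on which polynomials are reproduced with bounded weights;
the moments of the resulting functional vanish, and the power function with
respect to these nodes is of order [s^b].  The kernel translates at points of
one cell of mesh [s] are thus [s^b]-close to a space of bounded dimension [n].
When the residuals of the selected points stay well above this scale, each new
point of the cell multiplies a determinant of size [n] by 2, whereas the
determinants are bounded; hence a cell receives boundedly many points.
Counting over the cells, with a dyadic induction on the number of points, gives
[P <= A gamma^(-2) N^(-b/d)]: one factor [gamma^(-1)] comes from the
stabilisation and the other absorbs the logarithm of [gamma^(-1)] in the number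
of doublings, and comparison with the lower bound for
[h = h_N] gives the rate. *)

Require Import Defs.
From HB Require Import structures.
From mathcomp Require Import all_boot all_order all_algebra.
From mathcomp Require Import all_classical all_reals all_analysis.
From mathcomp Require Import perm measurable_realfun ring lra.
Set Implicit Arguments.
Unset Strict Implicit.
Unset Printing Implicit Defensive.
Import Order.TTheory GRing.Theory Num.Theory.
Import numFieldNormedType.Exports.
Local Open Scope classical_set_scope.
Local Open Scope ring_scope.

(** * Gaussian integrals *)

(** Since [Phi] need not be integrable, its Fourier identity is available only against Schwartz
    functions. It is tested on Gaussians modulated by cosines, and the quadratic form is estimated
    under a Gaussian regularisation that is removed last, with constants that survive the limit. The
    lower bound needs a function with small spectrum and prescribed decay. Finite products of
    cosines serve instead of a bump function: their spectrum is explicit, and the Gaussian repairs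
    their lack of decay at very high frequencies. One near neighbour bounds the power function only
    to first order in the distance, so separation of the selected points cannot yield a large
    exponent [b]. The points of a cell are therefore compared with a space spanned by auxiliary
    nodes, which are not selected points. The determinant starts from the residuals of these nodes
    after [N] steps and is followed up to step [2 N]; doubling keeps the ratio of the two scales of
    order [gamma^-1], independently of [N], and the logarithm of this ratio bounds the number of
    points per cell. *)

Section gaussian1.
Context {R : realType}.
Local Notation mu := (@lebesgue_measure R).
Implicit Types e u v m c : R.

(** The factor [e / 2] makes the Fourier transform exchange [e] and [e^-1]; up to a constant this is
    the normal density of variance [e^-1]. *)
Definition gauss1 e u : R := expR (- (e / 2) * u ^+ 2).

Lemma gauss1_gt0 e u : 0 < gauss1 e u. Proof. exact: expR_gt0. Qed.

Lemma gauss1_ge0 e u : 0 <= gauss1 e u. Proof. exact/ltW/gauss1_gt0. Qed.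

Let normal_pdf_gauss1 e m u : 0 < e ->
  normal_pdf m (Num.sqrt e^-1) u = (Num.sqrt (2 * pi / e))^-1 * gauss1 e (u - m).
Proof.
move=> e0; have s0 : Num.sqrt e^-1 != 0 by rewrite gt_eqF// sqrtr_gt0 invr_gt0.
rewrite normal_pdfE// /normal_peak /normal_fun /gauss1 sqr_sqrtr ?invr_ge0 ?ltW//.
congr (_ * expR _); last by rewrite -mulr_natr; field; rewrite gt_eqF.
by congr (Num.sqrt _ )^-1; rewrite -mulr_natr; field; rewrite gt_eqF.
Qed.

Let mass_gt0 e : 0 < e -> 0 < Num.sqrt (2 * pi / e) :> R.
Proof. by move=> e0; rewrite sqrtr_gt0 divr_gt0// mulr_gt0 ?pi_gt0. Qed.

Lemma integrable_gauss1 e m : 0 < e ->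
  mu.-integrable setT (EFin \o (fun u => gauss1 e (u - m))).
Proof.
move=> e0; have := integrable_normal_pdf m (Num.sqrt e^-1).
move=> /(integrableZl measurableT (Num.sqrt (2 * pi / e))).
apply: eq_integrable => // u _.
by rewrite normal_pdf_gauss1//= -EFinM mulVKf// gt_eqF// mass_gt0.
Qed.

Lemma Rintegral_gauss1 e m : 0 < e ->
  \int[mu]_u gauss1 e (u - m) = Num.sqrt (2 * pi / e).
Proof.
move=> e0; have := integral_normal_pdf m (Num.sqrt e^-1).
under eq_integral do rewrite normal_pdf_gauss1// EFinM.
rewrite integralZl//; last exact: integrable_gauss1.
have /fineK <- := integrable_fin_num measurableT (integrable_gauss1 m e0).
rewrite -EFinM => -[] h; rewrite /Rintegral.
by rewrite -[LHS](mulVKf (lt0r_neq0 (mass_gt0 e0))) h mulr1.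
Qed.

(** Half of the exponent absorbs the quadratic factor, through [1 + x <= expR x] at
    [x = e / 4 * u ^+ 2]. This supplies the majorants for integrating by parts and for
    differentiating under the integral. *)
Lemma le_sqr_gauss1 e u : 0 < e -> (1 + u ^+ 2) * gauss1 e u <=
  (1 + 4 / e) * gauss1 (e / 2) u.
Proof.
move=> e0.
have -> : gauss1 e u = gauss1 (e / 2) u * (expR (e / 4 * u ^+ 2))^-1.
  by rewrite -expRN -expRD; congr expR; field.
rewrite mulrCA [leRHS]mulrC ler_pM2l ?gauss1_gt0//.
rewrite ler_pdivrMr ?expR_gt0//.
have h : 1 + e / 4 * u ^+ 2 <= expR (e / 4 * u ^+ 2).
  by apply: expR_ge1Dx.
have e40 : 0 < 4 / e by rewrite divr_gt0.
apply: le_trans (ler_wpM2l _ h); last by rewrite addr_ge0// ltW.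
have u0 := sqr_ge0 u.
rewrite mulrDr mulr1 lerD//; first by rewrite lerDl ltW.
have -> : (1 + 4 / e) * (e / 4 * u ^+ 2) = e / 4 * u ^+ 2 + u ^+ 2.
  by field; rewrite gt_eqF.
by rewrite lerDr mulr_ge0// divr_ge0// ltW.
Qed.

Lemma gauss1_le1 e u : 0 <= e -> gauss1 e u <= 1.
Proof.
by move=> e0; rewrite -[leRHS]expR0 ler_expR mulNr oppr_le0 mulr_ge0 ?divr_ge0 ?sqr_ge0.
Qed.

Lemma integrable_le_gauss1 e (C : R) (f : R -> R) : 0 < e ->
  measurable_fun setT f -> (forall u, `|f u| <= C * gauss1 e u) ->
  mu.-integrable setT (EFin \o f).
Proof.
move=> e0 mf fC.
have := integrableZl measurableT C (integrable_gauss1 0 e0).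
apply: le_integrable => //; first exact/measurable_EFinP.
by move=> u _ /=; rewrite subr0 lee_fin (le_trans (fC _))// ler_norm.
Qed.

Lemma is_derive_gauss1 e u : is_derive u 1 (gauss1 e) (- (e * u) * gauss1 e u).
Proof.
by rewrite /gauss1; apply: is_derive_eq; rewrite /GRing.scale /=; field.
Qed.

Lemma continuous_gauss1 e : continuous (gauss1 e).
Proof.
move=> u; apply: (@differentiable_continuous _ R^o R^o); apply/derivable1_diffP.
by have [] := is_derive_gauss1 e u.
Qed.

(** The fundamental theorem of calculus on [[- n.+1, n.+1]] leaves boundary terms of size
    [C / n.+1], and dominated convergence passes to the whole line. *)
Lemma Rintegral_derive_gauss1 e C (h h' : R -> R) : 0 < e ->
  (forall u, is_derive u 1 h (h' u)) -> continuous h' ->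
  (forall u, `|h' u| <= C * gauss1 e u) ->
  (forall u, (1 + u ^+ 2) * `|h u| <= C) ->
  \int[mu]_u h' u = 0.
Proof.
move=> e0 dh ch' bh' bh.
have mh' : measurable_fun setT h' by exact: continuous_measurable_fun.
have ih' := integrable_le_gauss1 e0 mh' bh'.
pose f_ (n : nat) : R -> \bar R := EFin \o (h' \_ `[- n.+1%:R, n.+1%:R]).
have hn n : (\int[mu]_u f_ n u)%E = (h n.+1%:R - h (- n.+1%:R))%:E.
  rewrite /f_ (_ : EFin \o _ = ((EFin \o h') \_ `[- n.+1%:R, n.+1%:R])); last first.
    by rewrite restrict_EFin.
  rewrite -integral_mkcond (@continuous_FTC2 _ h' h)//.
  - by rewrite (@lt_trans _ _ 0)// oppr_lt0.
  - exact: continuous_subspaceT.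
  - have ch : continuous h.
      move=> u; apply: (@differentiable_continuous _ R^o R^o); apply/derivable1_diffP.
      by have [] := dh u.
    split.
    + by move=> u _; have [] := dh u.
    + exact/cvg_at_right_filter/ch.
    + exact/cvg_at_left_filter/ch.
  - by move=> u _; rewrite derive1E derive_val.
have cvgf : (\int[mu]_u f_ n u)%E @[n --> \oo] --> (\int[mu]_u (h' u)%:E)%E.
  apply: (@dominated_cvg _ _ _ mu setT measurableT f_ (EFin \o h')
    (EFin \o (fun u => `|h' u|))) => //.
  - move=> n; apply/measurable_EFinP.
    by apply/(measurable_restrictT _ _).1 => //; exact: measurable_funTS.
  - move=> u _; apply: cvg_EFin; first exact: nearW.
    apply: cvg_near_cst; near=> n; rewrite /f_ /= patchE mem_set//= in_itv/=.
    rewrite -ler_norml; apply: (@le_trans _ _ n%:R); last by rewrite ler_nat.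
    by near: n; exact: nbhs_infty_ger.
  - exact: (integrable_norm ih').
  - move=> n u _; rewrite /f_ /= patchE lee_fin.
    by case: ifP => _; rewrite ?normr0.
have C0 : 0 <= C by apply: le_trans (bh 0); rewrite mulr_ge0// addr_ge0// sqr_ge0.
have : (\int[mu]_u f_ n u)%E @[n --> \oo] --> 0%:E.
  under eq_fun do rewrite hn.
  apply: cvg_EFin; first exact: nearW.
  apply: (@squeeze_cvgr _ _ _ _ (fun n => - (2 * C * n.+1%:R^-1)) (fun n => 2 * C * n.+1%:R^-1)).
  - near=> n; rewrite -ler_norml /=.
    have hb u : u ^+ 2 = n.+1%:R ^+ 2 -> `|h u| <= C * n.+1%:R^-1.
      move=> un; rewrite ler_pdivlMr// mulrC; apply: le_trans (bh u).
      by rewrite ler_wpM2r// un; have := sqr_ge0 (n.+1%:R - 1 : R); nra.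
    rewrite (le_trans (ler_normB _ _))// -mulrA mulrDl mul1r lerD// hb// sqrrN//.
  - rewrite -oppr0; apply: cvgN; rewrite -[X in _ --> X](mulr0 (2 * C)).
    by apply: cvgMr; exact: cvg_harmonic.
  - rewrite -[X in _ --> X](mulr0 (2 * C)).
    by apply: cvgMr; exact: cvg_harmonic.
by rewrite /Rintegral => /(cvg_unique _ cvgf) ->.
Unshelve. all: end_near. Qed.

Lemma integrable_cos_gauss1 e v c : 0 < e ->
  mu.-integrable setT (EFin \o (fun u => cos (u * v + c) * gauss1 e u)).
Proof.
move=> e0; apply: (@integrable_le_gauss1 e 1) => //.
  apply: continuous_measurable_fun => u.
  apply: cvgM; last exact: continuous_gauss1.
  apply: (cvg_comp _ cos); last exact: continuous_cos.
  by apply: cvgD; [apply: cvgMl; exact: cvg_id|exact: cvg_cst].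
move=> u; rewrite normrM (ger0_norm (gauss1_ge0 _ _)) ler_wpM2r ?gauss1_ge0//.
by rewrite ler_norml cos_geN1 cos_le1.
Qed.

Let dcos e v c u : is_derive v 1 (fun v => cos (u * v + c) * gauss1 e u)
  (- (u * sin (u * v + c) * gauss1 e u)).
Proof. by apply: is_derive_eq; rewrite /GRing.scale/=; ring. Qed.

Let le_abs1sqr u : `|u| <= 1 + u ^+ 2.
Proof.
have -> : u ^+ 2 = `|u| ^+ 2 by rewrite real_normK ?num_real.
by have := sqr_ge0 (`|u| - 1); nra.
Qed.

Let integrable_usin_gauss1 e v c : 0 < e ->
  mu.-integrable setT (EFin \o (fun u => u * sin (u * v + c) * gauss1 e u)).
Proof.
move=> e0; apply: (@integrable_le_gauss1 (e / 2) (1 + 4 / e)); rewrite ?divr_gt0//.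
  apply: continuous_measurable_fun => u.
  apply: cvgM; last exact: continuous_gauss1.
  apply: cvgM; first exact: cvg_id.
  apply: (cvg_comp _ sin); last exact: continuous_sin.
  by apply: cvgD; [apply: cvgMl; exact: cvg_id|exact: cvg_cst].
move=> u; apply: le_trans (le_sqr_gauss1 _ e0).
rewrite normrM (ger0_norm (gauss1_ge0 _ _)) ler_wpM2r ?gauss1_ge0// normrM.
rewrite (le_trans _ (le_abs1sqr u))// ler_piMr//.
by rewrite ler_norml sin_geN1 sin_le1.
Qed.

(** Integration by parts: the derivative of [sin (u * v + c) * gauss1 e u] has integral zero. *)
Let Rintegral_usin_gauss1 e v c : 0 < e ->
  e * \int[mu]_u (u * sin (u * v + c) * gauss1 e u) =
  v * \int[mu]_u (cos (u * v + c) * gauss1 e u).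
Proof.
move=> e0; rewrite -!RintegralZl//; [|exact: integrable_cos_gauss1|exact: integrable_usin_gauss1].
apply/esym/eqP; rewrite -subr_eq0 -RintegralB//; last 2 first.
- have := integrableZl measurableT v (integrable_cos_gauss1 v c e0).
  by apply: eq_integrable => // u _ /=; rewrite EFinM.
- have := integrableZl measurableT e (integrable_usin_gauss1 v c e0).
  by apply: eq_integrable => // u _ /=; rewrite EFinM.
apply/eqP; apply: (@Rintegral_derive_gauss1 (e / 2) ((1 + 4 / e) * (1 + `|v| + e))
  (fun u => sin (u * v + c) * gauss1 e u)); rewrite ?divr_gt0//.
- move=> u; have ? := is_derive_gauss1 e u.
  by apply: is_derive_eq; rewrite /GRing.scale/=; ring.
- move=> u; apply: cvgB.
    apply: cvgMr; apply: cvgM; last exact: continuous_gauss1.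
    apply: (cvg_comp _ cos); last exact: continuous_cos.
    by apply: cvgD; [apply: cvgMl; exact: cvg_id|exact: cvg_cst].
  apply: cvgMr; apply: cvgM; last exact: continuous_gauss1.
  apply: cvgM; first exact: cvg_id.
  apply: (cvg_comp _ sin); last exact: continuous_sin.
  by apply: cvgD; [apply: cvgMl; exact: cvg_id|exact: cvg_cst].
- move=> u; have K0 : 0 <= 1 + `|v| + e by rewrite !addr_ge0// ltW.
  rewrite [leRHS]mulrAC; apply: le_trans (ler_wpM2r K0 (le_sqr_gauss1 u e0)).
  rewrite !mulrA -mulrBl normrM (ger0_norm (gauss1_ge0 _ _)).
  rewrite [leRHS]mulrAC ler_wpM2r ?gauss1_ge0// (le_trans (ler_normB _ _))//.
  rewrite !normrM (ger0_norm (ltW e0)).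
  have c1 : `|cos (u * v + c)| <= 1 by rewrite ler_norml cos_geN1 cos_le1.
  have s1 : `|sin (u * v + c)| <= 1 by rewrite ler_norml sin_geN1 sin_le1.
  have u2 := sqr_ge0 u; have v0 := normr_ge0 v; have u1 := le_abs1sqr u.
  have h1 : `|v| * `|cos (u * v + c)| <= `|v| by rewrite ler_piMr.
  have h2 : `|u| * `|sin (u * v + c)| <= 1 + u ^+ 2.
    by rewrite (le_trans _ u1)// ler_piMr.
  have {}h2 : e * `|u| * `|sin (u * v + c)| <= e * (1 + u ^+ 2).
    by rewrite -mulrA ler_pM2l.
  have h3 : 0 <= u ^+ 2 * `|v| by rewrite mulr_ge0.
  by nra.
- move=> u; rewrite normrM (ger0_norm (gauss1_ge0 _ _)) mulrCA.
  have s1 : `|sin (u * v + c)| <= 1 by rewrite ler_norml sin_geN1 sin_le1.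
  have v1 : 1 <= 1 + `|v| + e by rewrite -addrA lerDl addr_ge0// ltW.
  have e4 : 0 <= 1 + 4 / e by rewrite addr_ge0// divr_ge0// ltW.
  apply: (@le_trans _ _ (1 * ((1 + 4 / e) * 1))).
    apply: ler_pM => //; first by rewrite mulr_ge0 ?gauss1_ge0 ?addr_ge0 ?sqr_ge0.
    rewrite (le_trans (le_sqr_gauss1 _ _))// ler_wpM2l//.
    by rewrite gauss1_le1// divr_ge0// ltW.
  by rewrite mul1r ler_wpM2l.
Qed.

(** As a function of [v] the integral solves [F' = - (v / e) F], so that its product with
    [gauss1 (- e^-1)] is constant. *)
Lemma Rintegral_cos_gauss1 e v c : 0 < e ->
  \int[mu]_u (cos (u * v + c) * gauss1 e u) = cos c * Num.sqrt (2 * pi / e) * gauss1 e^-1 v.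
Proof.
move=> e0; pose F v := \int[mu]_u (cos (u * v + c) * gauss1 e u).
have dF (w : R) : is_derive w 1 (F : R -> R) (- (w / e) * F w).
  pose G u := `|u| * gauss1 e u.
  have iG : mu.-integrable setT (EFin \o G).
    apply: (@integrable_le_gauss1 (e / 2) (1 + 4 / e)); rewrite ?divr_gt0//.
      apply: continuous_measurable_fun => u.
      apply: cvgM; last exact: continuous_gauss1.
      by apply: cvg_norm; exact: cvg_id.
    move=> u; apply: le_trans (le_sqr_gauss1 _ e0).
    rewrite normrM normr_id (ger0_norm (gauss1_ge0 _ _)) ler_wpM2r ?gauss1_ge0//.
  have wI : `]w - 1, w + 1[%classic w by rewrite /= in_itv/= ltrBlDr ltrDl ltr01.
  have h1 x : `]w - 1, w + 1[%classic x -> mu.-integrable setT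
      (EFin \o (fun u => cos (u * x + c) * gauss1 e u)).
    by move=> _; exact: integrable_cos_gauss1.
  have h2 x y : `]w - 1, w + 1[%classic x -> setT y ->
      derivable ((fun x u => cos (u * x + c) * gauss1 e u)^~ y) x 1.
    by move=> _ _; have [] := dcos e x c y.
  have h3 u : 0 <= G u by rewrite mulr_ge0 ?gauss1_ge0.
  have h4 x y : `]w - 1, w + 1[%classic x -> setT y ->
      `|partial1of2 (fun x u => cos (u * x + c) * gauss1 e u) x y| <= G y.
    move=> _ _; rewrite partial1of2E; have dc := dcos e x c y.
    rewrite derive_val normrN mulrAC normrM (normrM y) (ger0_norm (gauss1_ge0 _ _)).
    by rewrite /G ler_piMr ?mulr_ge0 ?gauss1_ge0// ler_norml sin_geN1 sin_le1.
  apply: DeriveDef; first exact: (derivable_under_integral measurableT wI h1 h2 h3 iG h4).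
  rewrite -derive1E (differentiation_under_integral measurableT wI h1 h2 h3 iG h4).
  transitivity (\int[mu]_u ((-1) * (u * sin (u * w + c) * gauss1 e u))).
    apply: eq_Rintegral => u _; rewrite partial1of2E; have dc := dcos e w c u.
    by rewrite derive_val mulN1r.
  rewrite RintegralZl//; last exact: integrable_usin_gauss1.
  apply: (mulfI (lt0r_neq0 e0)); rewrite mulrCA Rintegral_usin_gauss1// -/(F w).
  by field; rewrite gt_eqF.
have dH (w : R) : is_derive w 1 (fun w => F w * gauss1 (- e^-1) w) 0.
  have := dF w; have ? := is_derive_gauss1 (- e^-1) w => ?.
  by apply: is_derive_eq; rewrite /GRing.scale/=; field; rewrite gt_eqF.
have := @is_derive_0_is_cst _ _ v 0 dH.
have -> : F 0 = cos c * Num.sqrt (2 * pi / e).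
  rewrite -(Rintegral_gauss1 0 e0) -RintegralZl//; last exact: integrable_gauss1.
  by apply: eq_Rintegral => u _; rewrite mulr0 add0r subr0.
rewrite {2}/gauss1 expr0n mulr0 expR0 mulr1 => <-.
rewrite -mulrA /gauss1 -expRD.
by rewrite [X in expR X](_ : _ = 0) ?expR0 ?mulr1//; ring.
Qed.

End gaussian1.

(** * Measurability of continuous functions on R^d *)

Section measurable_rV.
Context {R : realType}.

(** The sigma-algebra is generated by the coordinates, so open sets are not measurable by
    definition. Rounding the argument to the grid of mesh [1 / n.+1] gives measurable functions with
    countably many values, which converge pointwise to [f] by continuity. *)
Lemma continuous_measurable_rV d (f : 'rV[R]_d -> R) :
  continuous f -> measurable_fun setT f.
Proof.
move=> cf.
pose q n (x : 'rV[R]_d) : {ffun 'I_d -> int} :=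
  [ffun i => Num.floor (n.+1%:R * x ord0 i)].
pose y n (z : {ffun 'I_d -> int}) : 'rV[R]_d := \row_i ((z i)%:~R / n.+1%:R).
have qE n x i z : (q n x i == z) = (z%:~R / n.+1%:R <= x ord0 i < (z + 1)%:~R / n.+1%:R).
  by rewrite ffunE floor_eq ler_pdivrMr// ltr_pdivlMr// mulrC.
have mq n z : measurable (q n @^-1` [set z]).
  rewrite (_ : _ @^-1` _ = \bigcap_(i in [set` enum 'I_d])
     ((fun x : 'rV[R]_d => x ord0 i) @^-1`
      `[(z i)%:~R / n.+1%:R, (z i + 1)%:~R / n.+1%:R[)); last first.
    apply/seteqP; split => [x /= qz i _ /=|x /= h].
      by rewrite in_itv/= -qE qz.
    apply/ffunP => i; apply/eqP; rewrite qE.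
    by have := h i; rewrite /= mem_enum in_itv/=; apply.
  rewrite bigcap_seq; apply: bigsetI_measurable => i _.
  by rewrite -[X in measurable X]setTI; apply: measurable_coor.
pose f_ n x := f (y n (q n x)).
have mf_ n : measurable_fun setT (f_ n).
  move=> _ B mB; rewrite setTI.
  rewrite (_ : _ @^-1` _ =
    \bigcup_z (if `[< B (f (y n z)) >] then q n @^-1` [set z] else set0)); last first.
    apply/seteqP; split => [x /= Bx|x [z _ /=]].
      by exists (q n x) => //; rewrite asboolT.
    case: asboolP => [Bz /= qz|_ []].
    by rewrite /f_ qz.
  apply: countable_bigcupT_measurable => [|z]; first exact: countableP.
  by case: asboolP => _; [exact: mq|exact: measurable0].
apply: (measurable_fun_cvg mf_) => x _.
apply: (cvg_comp (fun n => y n (q n x)) f); last exact: cf.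
apply/cvg_ballP => e e0; near=> n; split => // i j; rewrite !ord1.
have /andP[h1 h2] : ((q n x j)%:~R / n.+1%:R <= x ord0 j < (q n x j + 1)%:~R / n.+1%:R).
  by rewrite -qE.
rewrite /ball /= mxE ger0_norm ?subr_ge0//.
apply: (@lt_trans _ _ n.+1%:R^-1).
  by move: h2; rewrite rmorphD /= mulrDl mul1r ltrBlDl.
near: n; exact: near_infty_natSinv_lt (PosNum e0).
Unshelve. all: end_near. Qed.

End measurable_rV.

(** * Euclidean inner product and norm *)

Section dotp.
Context {R : realType} {d : nat}.
Implicit Types (x y z w : 'rV[R]_d) (a : R).

Lemma dotpC x y : dotp x y = dotp y x.
Proof. by apply: eq_bigr => i _; rewrite mulrC. Qed.

Lemma dotpDl x y z : dotp (x + y) z = dotp x z + dotp y z.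
Proof. by rewrite -big_split; apply: eq_bigr => i _; rewrite mxE mulrDl. Qed.

Lemma dotpZl a x y : dotp (a *: x) y = a * dotp x y.
Proof. by rewrite mulr_sumr; apply: eq_bigr => i _; rewrite mxE mulrA. Qed.

Lemma dotpNl x y : dotp (- x) y = - dotp x y.
Proof. by rewrite -scaleN1r dotpZl mulN1r. Qed.

Lemma dotpDr x y z : dotp x (y + z) = dotp x y + dotp x z.
Proof. by rewrite !(dotpC x) dotpDl. Qed.

Lemma dotpZr a x y : dotp x (a *: y) = a * dotp x y.
Proof. by rewrite !(dotpC x) dotpZl. Qed.

Lemma dotpNr x y : dotp x (- y) = - dotp x y.
Proof. by rewrite !(dotpC x) dotpNl. Qed.

Lemma dotp0l x : dotp 0 x = 0.
Proof. by rewrite -(scale0r 0) dotpZl mul0r. Qed.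

Lemma dotp0r x : dotp x 0 = 0.
Proof. by rewrite dotpC dotp0l. Qed.

Lemma dotp_ge0 x : 0 <= dotp x x.
Proof. by apply: sumr_ge0 => i _; rewrite -expr2 sqr_ge0. Qed.

Lemma norm2_ge0 x : 0 <= norm2 x. Proof. exact: sqrtr_ge0. Qed.

Lemma sqr_norm2 x : norm2 x ^+ 2 = dotp x x.
Proof. by rewrite sqr_sqrtr// dotp_ge0. Qed.

Lemma norm2Z a x : norm2 (a *: x) = `|a| * norm2 x.
Proof.
by rewrite /norm2 dotpZl dotpZr mulrA -expr2 sqrtrM ?sqr_ge0// sqrtr_sqr.
Qed.

Lemma norm2N x : norm2 (- x) = norm2 x.
Proof. by rewrite -scaleN1r norm2Z normrN1 mul1r. Qed.

Lemma norm2_distC x y : norm2 (x - y) = norm2 (y - x).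
Proof. by rewrite -norm2N opprB. Qed.

Lemma dotp_le_norm2 x y : dotp x y <= norm2 x * norm2 y.
Proof.
have [/eqP x0|x0] := eqVneq (dotp x x) 0.
  have x00 : x = 0.
    apply/rowP => i; rewrite mxE; apply/eqP; rewrite -sqrf_eq0 expr2.
    move: x0; rewrite /dotp psumr_eq0 => [/allP/(_ i)|j _].
      by rewrite mem_index_enum; exact.
    by rewrite -expr2 sqr_ge0.
  by rewrite x00 dotp0l mulr_ge0 ?norm2_ge0.
have x1 : 0 < dotp x x by rewrite lt_neqAle eq_sym x0 dotp_ge0.
have [xy|xy] := leP (dotp x y) 0.
  by rewrite (le_trans xy)// mulr_ge0// norm2_ge0.
rewrite -(@ler_pXn2r _ 2)// ?nnegrE ?(ltW xy) ?mulr_ge0 ?norm2_ge0//.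
rewrite exprMn !sqr_norm2.
have := dotp_ge0 (dotp x x *: y - dotp x y *: x).
rewrite dotpDl !dotpDr !dotpZl !dotpNl !dotpNr !dotpZl !dotpZr (dotpC y x).
move=> h; rewrite -(ler_pM2l x1); nra.
Qed.

Lemma ler_norm2D x y : norm2 (x + y) <= norm2 x + norm2 y.
Proof.
rewrite -(@ler_pXn2r _ 2)// ?nnegrE ?addr_ge0 ?norm2_ge0// sqr_norm2.
rewrite sqrrD !sqr_norm2 dotpDl !dotpDr (dotpC y x).
by have := dotp_le_norm2 x y; nra.
Qed.

Lemma dotp_abs_le_norm2 x y : `|dotp x y| <= norm2 x * norm2 y.
Proof.
rewrite ler_norml dotp_le_norm2 andbT lerNl -dotpNl.
by rewrite (le_trans (dotp_le_norm2 _ _))// norm2N.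
Qed.

Lemma coord_le_norm2 x i : `|x ord0 i| <= norm2 x.
Proof.
rewrite -(@ler_pXn2r _ 2)// ?nnegrE ?norm2_ge0// sqr_norm2 real_normK ?num_real//.
rewrite /dotp (bigD1 i)//= -expr2 lerDl.
by apply: sumr_ge0 => j _; rewrite -expr2 sqr_ge0.
Qed.

End dotp.

(** * Gaussian integrals on R^d *)

Section gaussian.
Context {R : realType}.
Local Notation mu := (@lebesgue_rV R _).

Definition gauss {d} (e : R) (w : 'rV[R]_d) : R := expR (- (e / 2) * dotp w w).

Lemma gauss_gt0 d e (w : 'rV[R]_d) : 0 < gauss e w. Proof. exact: expR_gt0. Qed.

Lemma gauss_ge0 d e (w : 'rV[R]_d) : 0 <= gauss e w. Proof. exact: expR_ge0. Qed.

Lemma gauss_le1 d e (w : 'rV[R]_d) : 0 <= e -> gauss e w <= 1.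
Proof.
by move=> e0; rewrite -[leRHS]expR0 ler_expR mulNr oppr_le0 mulr_ge0 ?divr_ge0 ?dotp_ge0.
Qed.

Lemma gaussD d e e' (w : 'rV[R]_d) : gauss (e + e') w = gauss e w * gauss e' w.
Proof. by rewrite /gauss -expRD; congr expR; lra. Qed.

Lemma measurable_dotp d (v : 'rV[R]_d) : measurable_fun setT (fun w : 'rV[R]_d => dotp w v).
Proof.
apply: measurable_sum => i; apply: measurable_funM => //.
exact: measurable_coor.
Qed.

Lemma measurable_dotpp d : measurable_fun setT (fun w : 'rV[R]_d => dotp w w).
Proof.
by apply: measurable_sum => i; apply: measurable_funM; exact: measurable_coor.
Qed.

Lemma measurable_gauss d (e : R) (m : 'rV[R]_d) :
  measurable_fun setT (fun w : 'rV[R]_d => gauss e (w - m)).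
Proof.
rewrite /gauss; apply: measurableT_comp => //=; apply: measurable_funM => //=.
under eq_fun do rewrite dotpDl !dotpDr dotpNr !dotpNl dotpNr opprK.
apply: measurable_funD; apply: measurable_funD => //.
- exact: measurable_dotpp.
- apply: measurableT_comp => //; exact: measurable_dotp.
- apply: measurableT_comp => //.
  by rewrite (_ : dotp m = fun w => dotp w m); [exact: measurable_dotp|apply/funext => w; rewrite dotpC].
Qed.

Lemma measurable_gauss_center d e : measurable_fun setT (@gauss d e).
Proof.
rewrite (_ : gauss e = fun w => gauss e (w - 0)); first exact: measurable_gauss.
by apply/funext => w; rewrite subr0.
Qed.

Lemma measurable_cos_dotp d (v : 'rV[R]_d) (c : R) :
  measurable_fun setT (fun w : 'rV[R]_d => cos (dotp w v + c)).
Proof.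
apply: measurableT_comp.
  by apply: continuous_measurable_fun; exact: continuous_cos.
by apply: measurable_funD => //; exact: measurable_dotp.
Qed.

Definition rV_tail {d} (v : 'rV[R]_d.+1) : 'rV[R]_d := rsubmx (v : 'rV_(1 + d)).

Lemma dotp_cons d u (w : 'rV[R]_d) (v : 'rV[R]_d.+1) :
  dotp (rV_cons (u, w)) v = u * v ord0 ord0 + dotp w (rV_tail v).
Proof.
rewrite /dotp big_ord_recl; congr (_ * _ + _).
  by rewrite mxE; case: splitP => // j _; rewrite mxE.
apply: eq_bigr => i _; rewrite !mxE; case: splitP => [j|j /= ij].
  by rewrite ord1.
by congr (_ * v _ _); [congr (w _ _); apply: val_inj; case: ij|apply: val_inj].
Qed.

Lemma dotpp_cons d (v : 'rV[R]_d.+1) :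
  dotp v v = v ord0 ord0 ^+ 2 + dotp (rV_tail v) (rV_tail v).
Proof.
rewrite /dotp big_ord_recl expr2; congr (_ + _); apply: eq_bigr => i _.
by rewrite mxE; congr (v _ _ * v _ _); apply: val_inj.
Qed.

Lemma rV_consK0 d u (w : 'rV[R]_d) : rV_cons (u, w) ord0 ord0 = u.
Proof. by rewrite mxE; case: splitP => // j _; rewrite mxE. Qed.

Lemma rV_consK1 d u (w : 'rV[R]_d) : rV_tail (rV_cons (u, w)) = w.
Proof. exact: row_mxKr. Qed.

Lemma gauss_cons d e (v : 'rV[R]_d.+1) :
  gauss e v = gauss1 e (v ord0 ord0) * gauss e (rV_tail v).
Proof. by rewrite /gauss dotpp_cons mulrDr expRD. Qed.

Lemma ge0_integral_rV_cons d (f : 'rV[R]_d.+1 -> \bar R) :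
  measurable_fun setT f -> (forall v, 0 <= f v)%E ->
  (\int[lebesgue_rV d.+1]_v f v =
   \int[lebesgue_measure]_u \int[lebesgue_rV d]_w f (rV_cons (u, w)))%E.
Proof.
move=> mf f0.
have mc := @measurable_rV_cons R d.
rewrite [LHS](ge0_integral_pushforward mc (lebesgue_measure \x lebesgue_rV d)%E)//.
rewrite preimage_setT fubini_tonelli1//=; exact: measurableT_comp.
Qed.

Lemma gauss0 (e : R) (v : 'rV[R]_0) : gauss e v = 1.
Proof. by rewrite /gauss /dotp big_ord0 mulr0 expR0. Qed.

Lemma rV_tailB d (v m : 'rV[R]_d.+1) : rV_tail (v - m) = rV_tail v - rV_tail m.
Proof. by apply/rowP => i; rewrite !mxE. Qed.

Lemma integral_gauss d e (m : 'rV[R]_d) : 0 < e ->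
  (\int[mu]_w (gauss e (w - m))%:E = (Num.sqrt (2 * pi / e) ^+ d)%:E)%E.
Proof.
move=> e0; elim: d m => [|d IH] m.
  rewrite integral_dirac//; last by apply/measurable_EFinP; exact: measurable_gauss.
  by rewrite diracT mul1e gauss0 expr0.
rewrite ge0_integral_rV_cons//; last 2 first.
- by apply/measurable_EFinP; exact: measurable_gauss.
- by move=> v; rewrite lee_fin gauss_ge0.
under eq_integral => u _.
  under eq_integral => w _ do
    rewrite gauss_cons rV_tailB rV_consK1 mxE rV_consK0 mxE EFinM.
  rewrite ge0_integralZl//; last 3 first.
  - by apply/measurable_EFinP; exact: measurable_gauss.
  - by move=> v _; rewrite lee_fin gauss_ge0.
  - by rewrite lee_fin gauss1_ge0.
  rewrite IH -EFinM mulrC EFinM; over.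
rewrite integralZl//; last exact: integrable_gauss1.
have /fineK <- := integrable_fin_num measurableT (integrable_gauss1 (m ord0 ord0) e0).
by rewrite -EFinM exprS mulrC; congr ((_ * _)%:E); exact: Rintegral_gauss1.
Qed.

Lemma integrable_gauss d e (m : 'rV[R]_d) : 0 < e ->
  mu.-integrable setT (EFin \o (fun w => gauss e (w - m))).
Proof.
move=> e0; apply/integrableP; split.
  by apply/measurable_EFinP; exact: measurable_gauss.
under eq_integral do rewrite gee0_abs ?lee_fin ?gauss_ge0//.
by rewrite integral_gauss// ltry.
Qed.

Lemma Rintegral_gauss d e (m : 'rV[R]_d) : 0 < e ->
  \int[mu]_w gauss e (w - m) = Num.sqrt (2 * pi / e) ^+ d.
Proof. by move=> e0; rewrite /Rintegral integral_gauss. Qed.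

Lemma integrable_le_gauss d e C (m : 'rV[R]_d) (f : 'rV[R]_d -> R) : 0 < e ->
  measurable_fun setT f -> (forall w, `|f w| <= C * gauss e (w - m)) ->
  mu.-integrable setT (EFin \o f).
Proof.
move=> e0 mf fC.
have := integrableZl measurableT C (integrable_gauss m e0).
apply: le_integrable => //; first exact/measurable_EFinP.
by move=> u _ /=; rewrite lee_fin (le_trans (fC _))// ler_norm.
Qed.

Lemma measurable_cos_gauss d e (v : 'rV[R]_d) c :
  measurable_fun setT (fun w => cos (dotp w v + c) * gauss e w).
Proof.
apply: measurable_funM; first exact: measurable_cos_dotp.
exact: measurable_gauss_center.
Qed.

Lemma integrable_cos_gauss d e (v : 'rV[R]_d) c : 0 < e ->
  mu.-integrable setT (EFin \o (fun w => cos (dotp w v + c) * gauss e w)).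
Proof.
move=> e0; apply: (@integrable_le_gauss _ e 1 0) => //.
  exact: measurable_cos_gauss.
move=> u; rewrite subr0 normrM (ger0_norm (gauss_ge0 _ _)) ler_wpM2r ?gauss_ge0//.
by rewrite ler_norml cos_geN1 cos_le1.
Qed.

(** Induction on the dimension: the integral over the tail treats the first coordinate as part of
    the phase, which is why the statement has a phase [c]. *)
Lemma Rintegral_cos_gauss d e (v : 'rV[R]_d) c : 0 < e ->
  \int[mu]_w (cos (dotp w v + c) * gauss e w) =
  cos c * Num.sqrt (2 * pi / e) ^+ d * gauss e^-1 v.
Proof.
move=> e0; suff : (\int[mu]_w (cos (dotp w v + c) * gauss e w)%:E =
    (cos c * Num.sqrt (2 * pi / e) ^+ d * gauss e^-1 v)%:E)%E.
  by rewrite /Rintegral => ->.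
elim: d v c => [|d IH] v c.
  rewrite integral_dirac//; last by apply/measurable_EFinP; exact: measurable_cos_gauss.
  by rewrite diracT mul1e !gauss0 expr0 dotp0l add0r !mulr1.
have mc := @measurable_rV_cons R d.
set f := fun w : 'rV[R]_d.+1 => (cos (dotp w v + c) * gauss e w)%:E.
have mf : measurable_fun setT f by apply/measurable_EFinP; exact: measurable_cos_gauss.
have if1 : (lebesgue_measure \x lebesgue_rV d)%E.-integrable setT (f \o @rV_cons R d).
  apply/integrableP; split; first exact: measurableT_comp.
  have /integrableP[_] := integrable_cos_gauss v c e0.
  rewrite [X in (X < _)%E -> _](ge0_integral_pushforward mc
    (lebesgue_measure \x lebesgue_rV d)%E)//.
  exact: measurableT_comp.
rewrite [LHS](integral_pushforward mc)// preimage_setT -integral12_prod_meas1//.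
rewrite /fubini_F.
under eq_integral => u _.
  under eq_integral => w _ do
    rewrite /= /f gauss_cons rV_consK1 rV_consK0 dotp_cons mulrCA EFinM addrAC addrC.
  rewrite integralZl//; last exact: integrable_cos_gauss.
  rewrite IH -EFinM mulrC -mulrA mulrAC EFinM; over.
rewrite /= integralZr//; last exact: integrable_cos_gauss1.
have h := integrable_fin_num measurableT (integrable_cos_gauss1 (v ord0 ord0) c e0).
rewrite -(fineK h) -EFinM gauss_cons exprS; congr (_%:E).
rewrite [X in X * _](_ : _ = \int[lebesgue_measure]_u (cos (u * v ord0 ord0 + c) * gauss1 e u))//.
by rewrite Rintegral_cos_gauss1//; ring.
Qed.

End gaussian.

(** [expR x] is the [n]-th power of [expR (x / n)], which exceeds [x / n]. *)
Lemma expr_le_expR {R : realType} n (x : R) : 0 <= x -> x ^+ n <= n%:R ^+ n * expR x.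
Proof.
case: n => [|n] x0; first by rewrite !expr0 mul1r (le_trans _ (expR_ge1Dx _))// lerDl.
have -> : expR x = expR (x / n.+1%:R) ^+ n.+1.
  by rewrite -expRM_natl; congr expR; rewrite mulrC divfK// pnatr_eq0.
rewrite -exprMn lerXn2r ?nnegrE ?mulr_ge0 ?expR_ge0//.
rewrite -ler_pdivrMl// mulrC (le_trans _ (expR_ge1Dx _))// lerDr//.
Qed.

Lemma cvg_bigsum {T : Type} {F : set_system T} {FF : Filter F} {R : realType}
    (I : Type) (r : seq I) (P : pred I) (f : I -> T -> R) (l : I -> R) :
  (forall i, P i -> f i x @[x --> F] --> l i) ->
  \sum_(i <- r | P i) f i x @[x --> F] --> \sum_(i <- r | P i) l i.
Proof.
move=> fl; elim: r => [|i r IH].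
  by under eq_fun do rewrite big_nil; rewrite big_nil; exact: cvg_cst.
under eq_fun do rewrite big_cons; rewrite big_cons.
by case: ifP => // Pi; apply: cvgD => //; exact: fl.
Qed.

(** * Modulated Gaussians as Schwartz functions *)

Section schwartz.
Context {R : realType} {d : nat}.
Implicit Types (f g : 'rV[R]_d -> R) (e c : R) (v w x : 'rV[R]_d).

Lemma is_derive_line f x v (l : R) :
  is_derive (0 : R) 1 (fun h => f (h *: v + x)) l -> is_derive x v f l.
Proof.
move=> [h1 h2].
have E : (fun h => h^-1 *: (((fun h => f (h *: v + x)) \o shift 0) (h *: (1 : R)) -
    f ((0 : R) *: v + x))) = (fun h => h^-1 *: ((f \o shift x) (h *: v) - f x)).
  by apply/funext => h /=; rewrite scale0r add0r addr0 /GRing.scale/= mulr1.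
split; last by rewrite -h2 /derive E.
by move: h1; rewrite /derivable E.
Qed.

(** Stable under partial derivatives, so that the Schwartz bounds follow by induction. The phase
    makes a single generator sufficient: a sine is a cosine with phase [c - pi / 2]. *)
Inductive poly_gauss e : ('rV[R]_d -> R) -> Prop :=
| poly_gauss_cos v c : poly_gauss e (fun w => cos (dotp w v + c) * gauss e w)
| poly_gaussD f g : poly_gauss e f -> poly_gauss e g ->
    poly_gauss e (fun w => f w + g w)
| poly_gaussZ a f : poly_gauss e f -> poly_gauss e (fun w => a * f w)
| poly_gaussM i f : poly_gauss e f -> poly_gauss e (fun w => w ord0 i * f w).

Lemma dotp_delta x (i : 'I_d) : dotp (delta_mx ord0 i) x = x ord0 i.
Proof.
rewrite /dotp (bigD1 i)//= !mxE !eqxx mul1r big1 ?addr0// => j ji.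
by rewrite mxE (negbTE ji) andbF mul0r.
Qed.

Lemma poly_gauss_derive e f (i : 'I_d) : poly_gauss e f ->
  exists2 f', poly_gauss e f' & forall x, is_derive x (delta_mx ord0 i) f (f' x).
Proof.
elim=> {f} [v c|f g _ [f' pf df] _ [g' pg dg]|a f _ [f' pf df]|j f pjf [f' pf df]].
- exists (fun w => (- v ord0 i) * (cos (dotp w v + (c - pi / 2)) * gauss e w) +
    (- e) * (w ord0 i * (cos (dotp w v + c) * gauss e w))).
    apply: poly_gaussD; apply: poly_gaussZ; first exact: poly_gauss_cos.
    by apply: poly_gaussM; exact: poly_gauss_cos.
  move=> x; apply: is_derive_line.
  rewrite [X in is_derive _ _ X _](_ : _ = fun h : R =>
    cos (h * v ord0 i + (dotp x v + c)) *
    expR (- (e / 2) * (h * h + 2 * h * x ord0 i + dotp x x))); last first.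
    apply/funext => h; rewrite /gauss !dotpDl !dotpDr !dotpZl !dotpZr.
    rewrite (dotpC x (delta_mx _ _)) !dotp_delta mxE !eqxx.
    by rewrite /= mulr1; congr (cos _ * expR (_ * _)); ring.
  apply: is_derive_eq; rewrite /GRing.scale/= /gauss (addrA (dotp x v)) cosB cos_pihalf sin_pihalf.
  by rewrite !mul0r !mulr0 !add0r !mul0r add0r; field.
- exists (fun w => f' w + g' w); first exact: poly_gaussD.
  by move=> x; apply: is_deriveD.
- exists (fun w => a * f' w); first exact: poly_gaussZ.
  by move=> x; apply: is_deriveZ.
- exists (fun w => (j == i)%:R * f w + w ord0 j * f' w).
    by apply: poly_gaussD; [exact: poly_gaussZ|exact: poly_gaussM].
  move=> x.
  have dj : is_derive x (delta_mx ord0 i) (fun w => w ord0 j) (j == i)%:R.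
    apply: is_derive_line.
    rewrite [X in is_derive _ _ X _](_ : _ = fun h : R => h * (j == i)%:R + x ord0 j).
      by apply: is_derive_eq; rewrite /GRing.scale/=; ring.
    by apply/funext => h; rewrite !mxE eqxx.
  have -> : (j == i)%:R * f x + x ord0 j * f' x = x ord0 j *: f' x + f x *: (j == i)%:R.
    by rewrite /GRing.scale/=; ring.
  exact: is_deriveM.
Qed.

Lemma poly_gauss_partial e f i : poly_gauss e f -> poly_gauss e (partial i f).
Proof.
move=> /(poly_gauss_derive i)[f' pf df].
rewrite (_ : partial i f = f')//; apply/funext => x; rewrite /partial.
by have [_] := df x.
Qed.

Lemma continuous_dotp v : continuous (fun w => dotp w v).
Proof.
move=> w; rewrite /dotp; apply: (@cvg_bigsum _ (nbhs w)) => i _.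
by apply: cvgM; [exact: coord_continuous|exact: cvg_cst].
Qed.

Lemma continuous_gauss e : continuous (@gauss R d e).
Proof.
move=> w; apply: (cvg_comp _ expR); last exact: continuous_expR.
apply: (@cvgM _ _ (nbhs w)); first exact: cvg_cst.
rewrite /dotp; apply: (@cvg_bigsum _ (nbhs w)) => i _.
by apply: cvgM; exact: coord_continuous.
Qed.

Lemma poly_gauss_continuous e f : poly_gauss e f -> continuous f.
Proof.
elim=> {f} [v c|f g _ cf _ cg|a f _ cf|i f _ cf] w.
- apply: (@cvgM _ _ (nbhs w)); last exact: continuous_gauss.
  apply: (cvg_comp _ cos); last exact: continuous_cos.
  by apply: (@cvgD _ _ _ (nbhs w)); [exact: continuous_dotp|exact: cvg_cst].
- by apply: (@cvgD _ _ _ (nbhs w)); [exact: cf|exact: cg].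
- by apply: (@cvgM _ _ (nbhs w)); [exact: cvg_cst|exact: cf].
- by apply: (@cvgM _ _ (nbhs w)); [exact: coord_continuous|exact: cf].
Qed.

Lemma poly_gauss_bounded e f n : 0 < e -> poly_gauss e f ->
  exists M : R, forall x, (1 + norm2 x) ^+ n * `|f x| <= M.
Proof.
move=> e0 pf; elim: pf n => {f} [v c|f g _ bf _ bg|a f _ bf|i f _ bf] n.
- exists (n%:R ^+ n * expR (1 + (2 * e)^-1)) => x.
  have x0 := norm2_ge0 x.
  apply: (@le_trans _ _ ((1 + norm2 x) ^+ n * gauss e x)).
    rewrite ler_wpM2l ?exprn_ge0 ?addr_ge0// normrM (ger0_norm (gauss_ge0 _ _)).
    by rewrite ler_piMl ?gauss_ge0// ler_norml cos_geN1 cos_le1.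
  have h : (1 + norm2 x) ^+ n <= n%:R ^+ n * expR (1 + norm2 x).
    by apply: expr_le_expR; rewrite addr_ge0.
  apply: le_trans (ler_wpM2r (gauss_ge0 e x) h) _.
  rewrite -mulrA ler_wpM2l ?exprn_ge0// /gauss -expRD ler_expR -addrA lerD2l.
  rewrite -sqr_norm2 -(ler_pM2l (_ : 0 < 2 * e)) ?mulr_gt0// divff ?gt_eqF ?mulr_gt0//.
  by have := sqr_ge0 (e * norm2 x - 1); nra.
- have [[M1 h1] [M2 h2]] := (bf n, bg n); exists (M1 + M2) => x.
  apply: le_trans (lerD (h1 x) (h2 x)); rewrite -mulrDr.
  by rewrite ler_wpM2l ?exprn_ge0 ?addr_ge0 ?norm2_ge0// ler_normD.
- have [M h] := bf n; exists (`|a| * M) => x.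
  by rewrite normrM mulrCA ler_wpM2l.
- have [M h] := bf n.+1; exists M => x; apply: le_trans (h x).
  rewrite normrM mulrA ler_wpM2r// exprSr ler_wpM2l ?exprn_ge0 ?addr_ge0 ?norm2_ge0//.
  by rewrite (le_trans (coord_le_norm2 _ _))// lerDr.
Qed.

Lemma schwartz_cos_gauss e v c : 0 < e ->
  schwartz (fun w => cos (dotp w v + c) * gauss e w).
Proof.
move=> e0; have pg s : poly_gauss e
    (foldr partial (fun w => cos (dotp w v + c) * gauss e w) s).
  elim: s => [|i s IH] /=; first exact: poly_gauss_cos.
  exact: poly_gauss_partial.
split=> [s|s n]; last exact: poly_gauss_bounded n e0 (pg s).
split; first exact: poly_gauss_continuous (pg s).
by move=> i x; have [f' _ df] := poly_gauss_derive i (pg s); have [] := df x.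
Qed.

End schwartz.

Section gauss_mass.
Context {R : realType}.

Definition gauss_mass (e : R) : R := Num.sqrt (2 * pi / e).

Lemma gauss_mass_ge0 e : 0 <= gauss_mass e. Proof. exact: sqrtr_ge0. Qed.

Lemma gauss_mass_gt0 e : 0 < e -> 0 < gauss_mass e.
Proof. by move=> e0; rewrite sqrtr_gt0 divr_gt0// mulr_gt0 ?pi_gt0. Qed.

Lemma gauss_massV e : 0 < e -> gauss_mass e * gauss_mass e^-1 = 2 * pi.
Proof.
move=> e0; have p0 := pi_gt0 R.
rewrite /gauss_mass -sqrtrM ?divr_ge0 ?mulr_ge0 ?ltW//.
rewrite (_ : 2 * pi / e * _ = (2 * pi) ^+ 2) ?sqrtr_sqr ?ger0_norm ?mulr_ge0 ?ltW//.
by rewrite invrK; field; rewrite gt_eqF.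
Qed.

(** The tail estimate spends half of the Gaussian exponent; the mass of the remaining half must
    still be comparable to that of the whole. *)
Lemma gauss_massV2 e : 0 < e -> gauss_mass e * gauss_mass (e^-1 / 2) <= 4 * pi.
Proof.
move=> e0; have p0 := pi_gt0 R.
rewrite /gauss_mass -sqrtrM ?divr_ge0 ?mulr_ge0 ?(ltW p0) ?(ltW e0)//.
rewrite (_ : 2 * pi / e * _ = 2 * (2 * pi) ^+ 2); last by field; rewrite gt_eqF.
have -> : 4 * pi = Num.sqrt ((4 * pi) ^+ 2) :> R.
  by rewrite sqrtr_sqr ger0_norm// mulr_ge0 ?(ltW p0).
by apply: ler_wsqrtr; nra.
Qed.

End gauss_mass.

(** * Quadratic forms of the kernel on the Fourier side *)

Section approximate_identity.
Context {R : realType} {d : nat}.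
Local Notation mu := (@lebesgue_rV R d).
Variables (Phi : 'rV[R]_d -> R) (M : R).
Hypotheses (cPhi : continuous Phi) (PhiM : forall x, `|Phi x| <= M).

Let mPhi : measurable_fun setT Phi.
Proof. exact: continuous_measurable_rV. Qed.

Lemma integrable_bounded_gauss e v : 0 < e ->
  mu.-integrable setT (EFin \o (fun x => Phi x * gauss e (x - v))).
Proof.
move=> e0; apply: (@integrable_le_gauss _ _ e M v) => //.
  by apply: measurable_funM => //; exact: measurable_gauss.
by move=> w; rewrite normrM (ger0_norm (gauss_ge0 _ _)) ler_wpM2r ?gauss_ge0.
Qed.

(** Near [v] the oscillation of [Phi] is at most [eta]. At distance at least [r], half of the
    exponent becomes the small factor [expR (- (e / 4 * r ^+ 2))] and the other half stays
    integrable. *)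
Let dist_near e v r eta x : 0 < e -> 0 < r -> 0 <= eta ->
  (forall x, `|x - v| < r -> `|Phi x - Phi v| <= eta) ->
  `|(Phi x - Phi v) * gauss e (x - v)| <=
    eta * gauss e (x - v) +
    2 * M * expR (- (e / 4 * r ^+ 2)) * gauss (e / 2) (x - v).
Proof.
move=> e0 r0 eta0 h; rewrite normrM (ger0_norm (gauss_ge0 _ _)).
have M0 : 0 <= M by apply: le_trans (PhiM 0).
have [xr|xr] := ltP `|x - v| r.
  rewrite -[leLHS]addr0 lerD ?ler_wpM2r ?gauss_ge0 ?h//.
  by rewrite !mulr_ge0 ?expR_ge0.
rewrite -[leLHS]add0r lerD//; first by rewrite mulr_ge0 ?gauss_ge0.
have -> : gauss e (x - v) = gauss (e / 2) (x - v) * gauss (e / 2) (x - v).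
  by rewrite -gaussD -splitr.
rewrite mulrA ler_wpM2r ?gauss_ge0// ler_pM ?gauss_ge0//.
  by rewrite (le_trans (ler_normB _ _))// mulr2n mulrDl mul1r lerD.
rewrite ler_expR mulNr lerN2.
have h1 : r ^+ 2 <= dotp (x - v) (x - v).
  rewrite -sqr_norm2 lerXn2r ?nnegrE ?norm2_ge0 ?(ltW r0)//.
  apply: le_trans xr _; rewrite [`|_|]mx_normrE.
  apply/bigmax_leP; split; first exact: norm2_ge0.
  by move=> [i j] _ /=; rewrite ord1; exact: coord_le_norm2.
by rewrite (_ : e / 2 / 2 = e / 4) ?ler_pM2l ?divr_gt0//; lra.
Qed.

(** The Gaussians [gauss e^-1 (x - v)], divided by their mass, form an approximate identity at [v];
    the constant comes from [gauss_mass e * gauss_mass e^-1 = 2 * pi]. *)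
Lemma cvg_gauss_mollifier v :
  gauss_mass e ^+ d * \int[mu]_x (Phi x * gauss e^-1 (x - v))
    @[e --> 0^'+] --> (2 * pi) ^+ d * Phi v.
Proof.
apply/cvgrPdist_le => eta eta0.
have P0 : 0 < (2 * pi : R) ^+ d by rewrite exprn_gt0// mulr_gt0 ?pi_gt0.
have M0 : 0 <= M by apply: le_trans (PhiM 0).
pose eta1 := eta / 2 / (2 * pi) ^+ d.
have eta10 : 0 < eta1 by rewrite !divr_gt0.
have [r r0 hr] : exists2 r : R, 0 < r & forall x, `|x - v| < r -> `|Phi x - Phi v| <= eta1.
  have /cvgrPdist_le/(_ _ eta10)/nbhs_ballP[r /= r0 h] := cPhi (x := v).
  exists r => // x xr; rewrite distrC; apply: h.
  by rewrite -ball_normE /ball_ /= distrC.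
pose B := 2 * M * (4 * pi) ^+ d * (4 / r ^+ 2).
have B0 : 0 <= B.
  by rewrite !mulr_ge0 ?exprn_ge0 ?invr_ge0 ?exprn_ge0 ?mulr_ge0 ?pi_ge0// ltW.
near=> e.
have e0 : 0 < e by near: e; exact: nbhs_right_gt.
have E0 : 0 < e^-1 by rewrite invr_gt0.
have -> : (2 * pi) ^+ d * Phi v =
    gauss_mass e ^+ d * \int[mu]_x (Phi v * gauss e^-1 (x - v)).
  rewrite RintegralZl//; last exact: integrable_gauss.
  by rewrite Rintegral_gauss// -[Num.sqrt _]/(gauss_mass _) mulrCA -exprMn gauss_massV// mulrC.
have icst : mu.-integrable setT (EFin \o (fun x => Phi v * gauss e^-1 (x - v))).
  have := integrableZl measurableT (Phi v) (integrable_gauss v E0).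
  by apply: eq_integrable => // x _ /=; rewrite EFinM.
rewrite distrC -mulrBr -RintegralB//; last exact: integrable_bounded_gauss.
rewrite normrM (ger0_norm (exprn_ge0 _ (gauss_mass_ge0 _))).
under eq_Rintegral do rewrite -mulrBl.
have idif : mu.-integrable setT (EFin \o (fun x => (Phi x - Phi v) * gauss e^-1 (x - v))).
  have := integrableB measurableT (integrable_bounded_gauss v E0) icst.
  by apply: eq_integrable => // x _ /=; rewrite mulrBl EFinB.
set q := 2 * M * expR (- (e^-1 / 4 * r ^+ 2)).
have i1 : mu.-integrable setT (EFin \o (fun x => eta1 * gauss e^-1 (x - v))).
  have := integrableZl measurableT eta1 (integrable_gauss v E0).
  by apply: eq_integrable => // x _ /=; rewrite EFinM.
have E20 : 0 < e^-1 / 2 by rewrite divr_gt0.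
have i2 : mu.-integrable setT (EFin \o (fun x => q * gauss (e^-1 / 2) (x - v))).
  have := integrableZl measurableT q (integrable_gauss v E20).
  by apply: eq_integrable => // x _ /=; rewrite EFinM.
apply: (@le_trans _ _ (gauss_mass e ^+ d * \int[mu]_x
    (eta1 * gauss e^-1 (x - v) + q * gauss (e^-1 / 2) (x - v)))).
  rewrite ler_wpM2l ?exprn_ge0 ?gauss_mass_ge0//.
  apply: (le_trans (le_normr_Rintegral measurableT idif)).
  apply: le_Rintegral => //; first exact: (integrable_norm idif).
    have := integrableD measurableT i1 i2.
    by apply: eq_integrable => // x _ /=; rewrite EFinD.
  by move=> x _; apply: dist_near => //; exact: ltW.
rewrite RintegralD// !RintegralZl//; try exact: integrable_gauss.
rewrite !Rintegral_gauss// -!/(gauss_mass _) mulrDr mulrCA -exprMn gauss_massV//.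
rewrite mulrCA -exprMn [leRHS]splitr lerD//.
  by rewrite /eta1 divfK// gt_eqF.
apply: (@le_trans _ _ (B * e)).
  have h1 : expR (- (e^-1 / 4 * r ^+ 2)) <= 4 / r ^+ 2 * e.
    rewrite expRN -[leRHS]invrK lef_pV2 ?posrE ?expR_gt0 ?invr_gt0//; last first.
      by rewrite !mulr_gt0// invr_gt0 exprn_gt0.
    apply: (le_trans _ (expR_ge1Dx _)).
    rewrite (_ : _^-1 = e^-1 / 4 * r ^+ 2) ?lerDr//.
    by field; rewrite !gt_eqF.
  rewrite /q /B -!mulrA ler_wpM2l// ler_wpM2l// [leLHS]mulrC ler_pM ?expR_ge0//.
  - by rewrite exprn_ge0// mulr_ge0 ?gauss_mass_ge0.
  - apply: lerXn2r; rewrite ?nnegrE ?(mulr_ge0 _ (pi_ge0 R))//.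
      by rewrite mulr_ge0 ?gauss_mass_ge0.
    exact: gauss_massV2.
  - by move: h1; rewrite -!mulrA.
apply: (@le_trans _ _ ((B + 1) * e)); first by rewrite ler_pM2r ?lerDl.
rewrite mulrC -ler_pdivlMr ?ltr_wpDl//; near: e; apply: nbhs_right_le.
by rewrite !divr_gt0// ltr_wpDl.
Unshelve. all: end_near. Qed.

End approximate_identity.

Lemma Rintegral_bigsum d (T : measurableType d) (R : realType)
    (mu : {measure set T -> \bar R}) (I : Type) (r : seq I) (f : I -> T -> R) :
  (forall i, mu.-integrable setT (EFin \o f i)) ->
  mu.-integrable setT (EFin \o (fun x => \sum_(i <- r) f i x)) /\
  \int[mu]_x (\sum_(i <- r) f i x) = \sum_(i <- r) \int[mu]_x f i x.
Proof.
move=> intf; elim: r => [|i r [IH1 IH2]].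
  have E : (fun x => \sum_(j <- [::]) f j x) = cst 0.
    by apply/funext => x; rewrite big_nil.
  rewrite E big_nil; split; first exact: integrable0.
  by rewrite Rintegral_cst// mul0r.
have E : (fun x => \sum_(j <- i :: r) f j x) = (fun x => f i x + \sum_(j <- r) f j x).
  by apply/funext => x; rewrite big_cons.
rewrite E big_cons; split.
  by have := integrableD measurableT (intf i) IH1; apply: eq_integrable.
by rewrite RintegralD// IH2.
Qed.

(** Squared modulus of the exponential sum with coefficients [a i] and phases [dotp w (z i)], in
    real terms. *)
Definition trig_sqr {R : realType} {d : nat} {I : finType} (a : I -> R)
    (z : I -> 'rV[R]_d) (w : 'rV[R]_d) : R :=
  (\sum_i a i * cos (dotp w (z i))) ^+ 2 + (\sum_i a i * sin (dotp w (z i))) ^+ 2.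

Lemma trig_sqr_ge0 {R : realType} {d : nat} {I : finType} (a : I -> R)
    (z : I -> 'rV[R]_d) (w : 'rV[R]_d) : 0 <= trig_sqr a z w.
Proof. by rewrite addr_ge0// sqr_ge0. Qed.

Lemma trig_sqrE {R : realType} {d : nat} {I : finType} (a : I -> R)
    (z : I -> 'rV[R]_d) (w : 'rV[R]_d) :
  trig_sqr a z w = \sum_i \sum_j a i * a j * cos (dotp w (z i - z j)).
Proof.
rewrite /trig_sqr !expr2 !mulr_suml -big_split; apply: eq_bigr => i _ /=.
rewrite !mulr_sumr -big_split; apply: eq_bigr => j _ /=.
by rewrite dotpDr dotpNr cosB; ring.
Qed.

Section fourier_limit.
Context {R : realType} {d : nat}.
Local Notation mu := (@lebesgue_rV R d).
Variables (Phi g : 'rV[R]_d -> R) (M C : R).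
Hypotheses (cPhi : continuous Phi) (PhiM : forall x, `|Phi x| <= M).
Hypotheses (mg : measurable_fun setT g) (gC : forall w, `|g w| <= C).
Hypothesis Phi_g : is_fourier_transform Phi g.

Definition fourier_const : R := (2 * pi) `^ (- (d%:R / 2)) * (2 * pi) ^+ d.

Lemma fourier_const_gt0 : 0 < fourier_const.
Proof. by rewrite mulr_gt0 ?powR_gt0 ?exprn_gt0// mulr_gt0// pi_gt0. Qed.

Lemma fourier_re_cos_gauss (e : R) (v x : 'rV[R]_d) : 0 < e ->
  fourier_re (fun w : 'rV[R]_d => cos (dotp w v + 0) * gauss e w) x =
  (2 * pi) `^ (- (d%:R / 2)) / 2 * (gauss_mass e ^+ d *
    (gauss e^-1 (x - - v) + gauss e^-1 (x - v))).
Proof.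
move=> e0; rewrite /fourier_re -mulrA; congr (_ * _).
transitivity (\int[mu]_w (2^-1 * (cos (dotp w (x - - v) + 0) * gauss e w +
   cos (dotp w (x - v) + 0) * gauss e w))).
  apply: eq_Rintegral => w _; rewrite !addr0 !dotpDr !dotpNr opprK cosD cosB.
  by field.
have i1 := integrable_cos_gauss (x - - v) 0 e0.
have i2 := integrable_cos_gauss (x - v) 0 e0.
rewrite RintegralZl//; last first.
  by have := integrableD measurableT i1 i2; apply: eq_integrable.
rewrite RintegralD// !Rintegral_cos_gauss// cos0 !mul1r -/(gauss_mass e).
by rewrite -mulrDr.
Qed.

Lemma integrable_gcos_gauss (e : R) (v : 'rV[R]_d) : 0 < e ->
  mu.-integrable setT (EFin \o (fun w => g w * (cos (dotp w v + 0) * gauss e w))).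
Proof.
move=> e0; apply: (@integrable_le_gauss _ _ e C 0) => //.
  by apply: measurable_funM => //; exact: measurable_cos_gauss.
move=> w; rewrite subr0 !normrM (ger0_norm (gauss_ge0 _ _)) mulrA.
rewrite ler_wpM2r ?gauss_ge0//.
have C0 : 0 <= C by apply: le_trans (gC 0).
rewrite -[leRHS]mulr1 ler_pM// ler_norml cos_geN1 cos_le1//.
Qed.

(** The distributional identity is tested on a modulated Gaussian, whose transform is a pair of
    Gaussians concentrating at [v] and [- v]. A cosine sees only the even part of [Phi], which is
    all that enters a quadratic form. *)
Lemma cvg_gcos_gauss (v : 'rV[R]_d) :
  \int[mu]_w (g w * (cos (dotp w v + 0) * gauss e w)) @[e --> 0^'+] -->
  fourier_const * ((Phi (- v) + Phi v) / 2).
Proof.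
have h1 := @cvg_gauss_mollifier R d Phi M cPhi PhiM (- v).
have h2 := @cvg_gauss_mollifier R d Phi M cPhi PhiM v.
pose k : R := (2 * pi) `^ (- (d%:R / 2)) / 2.
have h := cvgM (cvgD h1 h2) (cvg_cst k).
have kE : ((2 * pi) ^+ d * Phi (- v) + (2 * pi) ^+ d * Phi v) * k =
    fourier_const * ((Phi (- v) + Phi v) / 2).
  by rewrite /k /fourier_const; ring.
rewrite -kE; apply: (cvg_trans _ (h _ _ _)); apply: near_eq_cvg; near=> e.
have e0 : 0 < e by near: e; exact: nbhs_right_gt.
have E0 : 0 < e^-1 by rewrite invr_gt0.
have [<- _] := Phi_g (schwartz_cos_gauss v 0 e0).
under eq_Rintegral do rewrite fourier_re_cos_gauss// mulrCA (mulrCA (Phi _)) (mulrDr (Phi _)) -/k.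
have i1 := @integrable_bounded_gauss R d Phi M cPhi PhiM _ (- v) E0.
have i2 := @integrable_bounded_gauss R d Phi M cPhi PhiM _ v E0.
have i12 : mu.-integrable setT (EFin \o (fun x => Phi x * gauss e^-1 (x - - v) +
    Phi x * gauss e^-1 (x - v))).
  by have := integrableD measurableT i1 i2; apply: eq_integrable.
rewrite RintegralZl//; last first.
  have := integrableZl measurableT (gauss_mass e ^+ d) i12.
  by apply: eq_integrable => // x _ /=; rewrite EFinM.
rewrite RintegralZl// RintegralD//.
by rewrite /= mulrDr mulrC.
Unshelve. all: end_near. Qed.

Lemma gtrig_sqrE {I : finType} (a : I -> R) (z : I -> 'rV[R]_d) (e : R) : 0 < e ->
  mu.-integrable setT (EFin \o (fun w => g w * (trig_sqr a z w * gauss e w))) /\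
  \int[mu]_w (g w * (trig_sqr a z w * gauss e w)) =
  \sum_i \sum_j a i * a j * \int[mu]_w (g w * (cos (dotp w (z i - z j) + 0) * gauss e w)).
Proof.
move=> e0.
have E : (fun w => g w * (trig_sqr a z w * gauss e w)) =
    (fun w => \sum_(i <- index_enum I) \sum_(j <- index_enum I) (a i * a j) *
       (g w * (cos (dotp w (z i - z j) + 0) * gauss e w))).
  apply/funext => w; rewrite trig_sqrE mulr_suml mulr_sumr; apply: eq_bigr => i _.
  rewrite mulr_suml mulr_sumr; apply: eq_bigr => j _.
  by rewrite addr0; ring.
have iij i j : mu.-integrable setT (EFin \o (fun w => (a i * a j) *
     (g w * (cos (dotp w (z i - z j) + 0) * gauss e w)))).
  have := integrableZl measurableT (a i * a j) (integrable_gcos_gauss (z i - z j) e0).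
  by apply: eq_integrable => // x _ /=; rewrite EFinM.
have h i := Rintegral_bigsum (index_enum I) (iij i).
rewrite E; have [h1 h2] := Rintegral_bigsum (index_enum I) (fun i => (h i).1).
split=> //; rewrite h2; apply: eq_bigr => i _; rewrite (h i).2.
apply: eq_bigr => j _; rewrite RintegralZl//.
exact: integrable_gcos_gauss.
Qed.

(* Bochner: the quadratic form of Phi is the Gaussian-regularised integral of
   g against the squared modulus of the exponential sum. *)
Lemma cvg_gtrig_sqr {I : finType} (a : I -> R) (z : I -> 'rV[R]_d) :
  \int[mu]_w (g w * (trig_sqr a z w * gauss e w)) @[e --> 0^'+] -->
  fourier_const * \sum_i \sum_j a i * a j * Phi (z i - z j).
Proof.
have -> : fourier_const * \sum_i \sum_j a i * a j * Phi (z i - z j) =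
    \sum_i \sum_j a i * a j * (fourier_const * ((Phi (- (z i - z j)) + Phi (z i - z j)) / 2)).
  transitivity (fourier_const / 2 *
     (\sum_i \sum_j a i * a j * Phi (- (z i - z j)) + \sum_i \sum_j a i * a j * Phi (z i - z j))).
    rewrite [X in _ * (X + _)](_ : _ = \sum_i \sum_j a i * a j * Phi (z i - z j)).
      by field.
    rewrite exchange_big; apply: eq_bigr => i _; apply: eq_bigr => j _.
    by rewrite opprB (mulrC (a i)).
  rewrite -big_split mulr_sumr; apply: eq_bigr => i _ /=.
  rewrite -big_split mulr_sumr; apply: eq_bigr => j _ /=.
  by ring.
have h : \sum_i \sum_j a i * a j *
    \int[mu]_w (g w * (cos (dotp w (z i - z j) + 0) * gauss e w)) @[e --> 0^'+] -->
  \sum_i \sum_j a i * a j * (fourier_const * ((Phi (- (z i - z j)) + Phi (z i - z j)) / 2)).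
  apply: cvg_bigsum => i _; apply: cvg_bigsum => j _.
  apply: cvgM; first exact: cvg_cst.
  exact: cvg_gcos_gauss.
apply: (cvg_trans _ h); apply: near_eq_cvg; near=> e.
have e0 : 0 < e by near: e; exact: nbhs_right_gt.
by have [_ ->] := gtrig_sqrE a z e0.
Unshelve. all: end_near. Qed.

End fourier_limit.

(** * Taylor remainders and vanishing moments *)

Lemma poly_primitive {R : numFieldType} (p : {poly R}) :
  exists q : {poly R}, [/\ q^`() = p, q.[0] = 0 & (size q <= (size p).+1)%N].
Proof.
exists (\poly_(i < (size p).+1) (p`_i.-1 / i%:R)); split; last exact: size_poly.
  apply/polyP => i; rewrite coef_deriv coef_poly ltnS /=.
  case: ltnP => [_|h]; last by rewrite mul0rn nth_default.
  by rewrite -[LHS]mulr_natr divfK// pnatr_eq0.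
by rewrite horner_coef0 coef_poly /= invr0 mulr0.
Qed.

Section taylor.
Context {R : realType}.

Lemma le_abs_expn (f f' : R -> R) n : f 0 = 0 ->
  (forall x : R, is_derive x 1 f (f' x)) -> (forall x : R, `|f' x| <= `|x| ^+ n) ->
  forall x : R, `|f x| <= `|x| ^+ n.+1.
Proof.
move=> f0 df f'n x.
have cf : continuous f.
  move=> u; apply: (@differentiable_continuous _ R^o R^o); apply/derivable1_diffP.
  by have [] := df u.
have key y z : y <= z -> exists2 c, y <= c <= z & f z - f y = f' c * (z - y).
  move=> yz; have [c] := @MVT_segment R f f' y z yz (fun u _ => df u)
    (continuous_subspaceT cf).
  by rewrite in_itv/= => h1 h2; exists c.
have bound c : `|c| <= `|x| -> `|f' c * x| <= `|x| ^+ n.+1.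
  move=> cx; rewrite normrM exprSr ler_wpM2r// (le_trans (f'n c))//.
  by rewrite lerXn2r ?nnegrE.
have [x0|/ltW x0] := leP 0 x.
  have [c /andP[c0 cx]] := key 0 x x0; rewrite f0 !subr0 => ->.
  by apply: bound; rewrite !ger0_norm.
have [c /andP[cx c0]] := key x 0 x0; rewrite f0 !sub0r mulrN => /oppr_inj ->.
by apply: bound; rewrite !ler0_norm// lerN2.
Qed.

(** Simultaneous induction by integration from 0, each remainder being, up to sign, the primitive of
    the other. The polynomials are known only through their degree, which is what vanishing moments
    act on. *)
Lemma cos_sin_taylor n : exists p q : {poly R},
  [/\ (size p <= n)%N, (size q <= n)%N,
      forall x, `|cos x - p.[x]| <= `|x| ^+ n &
      forall x, `|sin x - q.[x]| <= `|x| ^+ n].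
Proof.
elim: n => [|n [p [q [sp sq hp hq]]]].
  exists 0, 0; rewrite size_poly0; split=> // x; rewrite horner0 subr0 expr0.
    by rewrite ler_norml cos_geN1 cos_le1.
  by rewrite ler_norml sin_geN1 sin_le1.
have [P [P' P0 sP]] := poly_primitive p; have [Q [Q' Q0 sQ]] := poly_primitive q.
exists (1 - Q), P; split.
- rewrite (leq_trans (size_polyD _ _))// geq_max size_poly1 size_polyN ltnS leq0n.
  exact: leq_trans sQ _.
- exact: leq_trans sP _.
- apply: (@le_abs_expn _ (fun x => - (sin x - q.[x]))) => [|x|x].
  + by rewrite !hornerE Q0 cos0 subr0 subrr.
  + have dQ : is_derive x 1 (horner (1 - Q)) (- q.[x]).
      by apply: is_derive_eq; rewrite derivB Q' derivC sub0r hornerN.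
    by apply: is_derive_eq; rewrite opprB opprK addrC.
  + by rewrite normrN.
- apply: (@le_abs_expn _ (fun x => cos x - p.[x])) => [|x|x] //.
  + by rewrite P0 sin0 subr0.
  + have dP : is_derive x 1 (horner P) p.[x] by apply: is_derive_eq; rewrite P'.
    by apply: is_derive_eq.
Qed.

End taylor.

Section vanishing_moments.
Context {R : realType} {d : nat} {I : finType}.
Variables (a : I -> R) (z : I -> 'rV[R]_d) (L r : R) (l : nat).
Hypotheses (aL : \sum_i `|a i| <= L) (zr : forall i, norm2 (z i) <= r).
Hypothesis moments : forall w k, (k < l)%N -> \sum_i a i * dotp w (z i) ^+ k = 0.

Let sum_poly w (p : {poly R}) : (size p <= l)%N ->
  \sum_i a i * p.[dotp w (z i)] = 0.
Proof.
move=> pl; under eq_bigr do rewrite (horner_coef_wide _ pl) mulr_sumr.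
rewrite exchange_big big1// => k _.
under eq_bigr do rewrite mulrCA; rewrite -mulr_sumr moments ?mulr0//.
Qed.

Let sum_bound w (f : R -> R) (p : {poly R}) : (size p <= l)%N ->
  (forall x, `|f x - p.[x]| <= `|x| ^+ l) ->
  (\sum_i a i * f (dotp w (z i))) ^+ 2 <= L ^+ 2 * (norm2 w * r) ^+ (2 * l).
Proof.
move=> pl hp; rewrite mulnC exprM -exprMn.
have L0 : 0 <= L by apply: le_trans aL; apply: sumr_ge0.
rewrite -[leLHS]real_normK ?num_real//.
case: (pickP I) => [i0 _|I0]; last first.
  by rewrite big_pred0// normr0 expr0n sqr_ge0.
have r0 : 0 <= r by apply: le_trans (zr i0); exact: norm2_ge0.
rewrite lerXn2r ?nnegrE// ?mulr_ge0 ?exprn_ge0 ?mulr_ge0 ?norm2_ge0//.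
have -> : \sum_i a i * f (dotp w (z i)) =
    \sum_i (a i * f (dotp w (z i)) - a i * p.[dotp w (z i)]).
  by rewrite sumrB (sum_poly w pl) subr0.
apply: (le_trans (ler_norm_sum _ _ _)).
apply: (@le_trans _ _ (\sum_i `|a i| * (norm2 w * r) ^+ l)); last first.
  by rewrite -mulr_suml ler_wpM2r// exprn_ge0 ?mulr_ge0 ?norm2_ge0.
apply: ler_sum => i _; rewrite -mulrBr normrM ler_wpM2l// (le_trans (hp _))//.
rewrite lerXn2r ?nnegrE ?mulr_ge0 ?norm2_ge0// (le_trans (dotp_abs_le_norm2 _ _))//.
by rewrite ler_wpM2l// norm2_ge0.
Qed.

(** The Taylor polynomials of degree below [l] are annihilated by the moments, so that only
    remainders of order [l] are left in the cosine and sine sums. *)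
Lemma trig_sqr_le_moments w :
  trig_sqr a z w <= 2 * L ^+ 2 * (norm2 w * r) ^+ (2 * l).
Proof.
have [p [q [sp sq hp hq]]] := @cos_sin_taylor R l.
by rewrite -mulrA mulr2n mulrDl mul1r lerD//; [exact: sum_bound sp hp|exact: sum_bound sq hq].
Qed.

Lemma trig_sqr_le w : trig_sqr a z w <= 2 * L ^+ 2.
Proof.
have L0 : 0 <= L by apply: le_trans aL; apply: sumr_ge0.
have h (f : R -> R) : (forall x, `|f x| <= 1) ->
    (\sum_i a i * f (dotp w (z i))) ^+ 2 <= L ^+ 2.
  move=> f1; rewrite -[leLHS]real_normK ?num_real// lerXn2r ?nnegrE//.
  apply: (le_trans (ler_norm_sum _ _ _)); apply: le_trans aL; apply: ler_sum => i _.
  by rewrite normrM ler_piMr.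
rewrite mulr2n mulrDl mul1r lerD// h// => x; rewrite ler_norml.
  by rewrite cos_geN1 cos_le1.
by rewrite sin_geN1 sin_le1.
Qed.

End vanishing_moments.

Lemma trig_sqr_translate {R : realType} {d : nat} {I : finType} (a : I -> R)
    (z : I -> 'rV[R]_d) c w : trig_sqr a (fun i => z i - c) w = trig_sqr a z w.
Proof.
rewrite !trig_sqrE; apply: eq_bigr => i _; apply: eq_bigr => j _.
by rewrite opprB addrA subrK.
Qed.

(** * Dyadic scales and the upper bound for the quadratic form *)

Section dyadic.
Context {R : realType}.
Implicit Types (y b : R) (J l : nat).

(* Telescoping against G y = A min(1, y/2)^2 - B max(1, y)^(-2b). *)
Lemma sum_dyadic_le b : 0 < b -> exists2 C : R, 0 < C &
  forall (l : nat) J (r : R), b + 1 <= l%:R -> 0 < r ->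
  \sum_(j < J) (2 ^+ j * r) `^ (- 2 * b) * Num.min 1 ((2 ^+ j * r) ^+ (2 * l)) <= C.
Proof.
move=> b0.
have q1 : (2 : R) `^ (- 2 * b) < 1.
  rewrite mulNr powRN invf_lt1 ?powR_gt0//.
  have := @gt0_ltr_powR R (2 * b) (mulr_gt0 (ltr0Sn R 1) b0) 1 2.
  by rewrite powR1 !nnegrE => -> //; rewrite ltr1n.
set q := (2 : R) `^ (- 2 * b) in q1 *.
(* [B] and the factor [4 / 3] are fitted to the increments of [G]:
   [y^(-2b) - (2y)^(-2b) = (1 - q) y^(-2b)] for [y >= 1], and [y^2 - (y/2)^2 = 3/4 y^2] for
   [y <= 1]. *)
pose B := (1 - q)^-1; have B0 : 0 < B by rewrite invr_gt0 subr_gt0.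
pose G y := 4 / 3 * Num.min 1 (y / 2) ^+ 2 - B * Num.max 1 y `^ (- 2 * b).
have max_pow y : Num.max 1 y `^ (- 2 * b) <= 1.
  have y1 : 1 <= Num.max 1 y by rewrite le_max lexx.
  rewrite mulNr powRN invf_le1 ?powR_gt0 ?(lt_le_trans _ y1)//.
  rewrite -[leLHS](@powRr0 _ (Num.max 1 y)) ler_powR// mulr_ge0// ltW//.
exists (4 / 3 + B); first by rewrite addr_gt0.
move=> l J r bl r0.
have step y : 0 < y -> y `^ (- 2 * b) * Num.min 1 (y ^+ (2 * l)) <= G (2 * y) - G y.
  move=> y0; rewrite /G (_ : 2 * y / 2 = y); last by field.
  have [y1|y1] := leP y 1.
    rewrite min_r; last by rewrite exprn_ile1// ltW.
    rewrite [Num.min 1 _]min_r; last by lra.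
    rewrite powR1.
    have h1 := max_pow (2 * y).
    (* Here [b + 1 <= l] makes the exponent [2 l - 2 b] at least 2. *)
    have h2 : y `^ (- 2 * b) * y ^+ (2 * l) <= y ^+ 2.
      rewrite -!powR_mulrn ?(ltW y0)// -powRD; last by rewrite (gt_eqF y0) implybT.
      apply: ger_powR; first by rewrite y0.
      by rewrite natrM; lra.
    apply: (le_trans h2).
    have h3 : 0 <= B * (1 - Num.max 1 (2 * y) `^ (- 2 * b)) by rewrite mulr_ge0 ?subr_ge0// ltW.
    by lra.
  rewrite min_l; last by rewrite exprn_ege1// ltW.
  rewrite mulr1 [Num.max 1 _]max_r; last by lra.
  rewrite powRM ?(ltW y0)// -/q.
  set Y := y `^ _.
  have h4 : Num.min 1 (y / 2) ^+ 2 <= 1.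
    rewrite exprn_ile1// ?ge_min ?lexx// le_min ler01/= divr_ge0// ltW//.
  have YE : Y = B * Y - B * (q * Y).
    by rewrite -mulrBr -[X in X - _]mul1r -mulrBl mulrA mulVf ?mul1r// gt_eqF// subr_gt0.
  rewrite expr1n; move: YE h4; set u := B * (q * Y); set v := B * Y => YE h4.
  lra.
apply: (@le_trans _ _ (G (2 ^+ J * r) - G r)).
  elim: J => [|J IH]; first by rewrite big_ord0 expr0 mul1r subrr.
  rewrite big_ord_recr /=.
  have := step (2 ^+ J * r); rewrite mulrA -exprS => /(_ (mulr_gt0 (exprn_gt0 _ (ltr0Sn R 1)) r0)).
  by move: IH; set u := \sum_(_ < _) _; lra.
rewrite /G.
have p1 := max_pow r.
have p2 : 0 <= B * Num.max 1 (2 ^+ J * r) `^ (- 2 * b) by rewrite mulr_ge0 ?powR_ge0// ltW.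
have p3 : Num.min 1 (2 ^+ J * r / 2) ^+ 2 <= 1.
  rewrite exprn_ile1// ?ge_min ?lexx// le_min ler01/= divr_ge0// mulr_ge0 ?exprn_ge0// ltW//.
have p4 : 0 <= Num.min 1 (r / 2) ^+ 2 by rewrite sqr_ge0.
have p5 : B * Num.max 1 r `^ (- 2 * b) <= B by rewrite ler_piMr// ltW.
lra.
Qed.

End dyadic.

Section quadratic_upper.
Context {R : realType}.

(** For the least [j] with [q <= 4 ^+ j] the term of index [j] alone dominates, its exponential
    being at least [expR (- 1)]. Beyond [4 ^+ J] the regularising Gaussian lies below the last
    exponential because [2 / 4 ^+ J <= e]; this keeps the sum finite. *)
Lemma decay_le_dyadic (tau q e : R) J : 0 <= tau -> 0 <= q -> 2 / 4 ^+ J <= e ->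
  (1 + q) `^ (- tau) * expR (- (e / 2) * q) <= expR 1 * 4 `^ tau *
    \sum_(j < J.+1) (2 ^+ j) `^ (- 2 * tau) * expR (- (q / 4 ^+ j)).
Proof.
move=> t0 q0 eJ.
have pow4 j : (2 ^+ j) `^ (- 2 * tau) = ((4 : R) ^+ j) `^ (- tau).
  rewrite mulNr -mulrN powRrM; congr (_ `^ _).
  by rewrite powR_mulrn ?exprn_ge0// -exprM mulnC exprM -natrX.
have term_ge0 (j : 'I_J.+1) : true -> 0 <= (2 ^+ j) `^ (- 2 * tau) * expR (- (q / 4 ^+ j)).
  by move=> _; rewrite mulr_ge0 ?powR_ge0 ?expR_ge0.
have decay j : 4 ^+ j <= 4 * (1 + q) -> (1 + q) `^ (- tau) <= 4 `^ tau * (2 ^+ j) `^ (- 2 * tau).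
  move=> h; rewrite pow4 !powRN ler_pdivlMr ?powR_gt0 ?exprn_gt0//.
  rewrite mulrC ler_pdivrMr ?powR_gt0 ?ltr_pwDl// -powRM ?addr_ge0//.
  by apply: ge0_ler_powR => //; rewrite nnegrE ?exprn_ge0 ?mulr_ge0 ?addr_ge0.
suff [j [jJ h1 h2]] : exists j, [/\ (j <= J)%N, 4 ^+ j <= 4 * (1 + q) &
    expR (- (e / 2) * q) <= expR 1 * expR (- (q / 4 ^+ j))].
  rewrite (bigD1 (Ordinal (jJ : (j < J.+1)%N)))//= mulrDr.
  rewrite -[leLHS]addr0 lerD//; last first.
    by rewrite mulr_ge0 ?mulr_ge0 ?expR_ge0 ?powR_ge0//; apply: sumr_ge0 => i _; exact: term_ge0.
  apply: (le_trans (ler_pM (powR_ge0 _ _) (expR_ge0 _) (decay j h1) h2)).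
  by rewrite le_eqVlt; apply/orP; left; apply/eqP; ring.
have [qJ|qJ] := leP q (4 ^+ J); last first.
  exists J; split=> //; first by lra.
  rewrite -expRD ler_expR mulNr.
  have h : q / 4 ^+ J <= e / 2 * q.
    by rewrite mulrC ler_wpM2r// ler_pdivlMr// mulrC.
  by lra.
have ex : exists j, q <= 4 ^+ j by exists J.
case: (ex_minnP ex) => j qj jmin; exists j; split.
- exact: jmin.
- case: j qj jmin => [|j] qj jmin; first by rewrite expr0; lra.
  rewrite exprS ler_pM2l//; have [q4|q4] := leP q (4 ^+ j).
    by have := jmin _ q4; rewrite ltnn.
  by rewrite (le_trans (ltW q4))// lerDr.
- rewrite -expRD ler_expR; apply: (@le_trans _ _ 0).
    have e0 : 0 <= e by apply: le_trans eJ; rewrite divr_ge0// exprn_ge0.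
    by rewrite mulNr oppr_le0; apply: mulr_ge0 => //; rewrite divr_ge0.
  by rewrite subr_ge0 ler_pdivrMr ?exprn_gt0// mul1r.
Qed.

Lemma expn_gauss_le d (w : 'rV[R]_d) (r h : R) l : 0 < h ->
  (norm2 w * r) ^+ (2 * l) * gauss (h ^- 2) w <=
  (2 * l)%:R ^+ l * (h * r) ^+ (2 * l).
Proof.
move=> h0; pose x := dotp w w / (2 * h ^+ 2).
have x0 : 0 <= x by rewrite divr_ge0 ?dotp_ge0// mulr_ge0 ?exprn_ge0// ltW.
have -> : gauss (h ^- 2) w = (expR x)^-1.
  by rewrite -expRN /gauss; congr expR; rewrite /x; field; rewrite gt_eqF.
rewrite ler_pdivrMr ?expR_gt0//.
have -> : (norm2 w * r) ^+ (2 * l) = (h * r) ^+ (2 * l) * (2 ^+ l * x ^+ l).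
  rewrite !exprM -!exprMn; congr (_ ^+ _); rewrite !exprMn sqr_norm2 /x.
  by field; rewrite gt_eqF.
rewrite mulrAC [leRHS]mulrC ler_wpM2l//.
  by rewrite exprM exprn_ge0// sqr_ge0.
have -> : (2 * l)%:R ^+ l = 2 ^+ l * l%:R ^+ l :> R by rewrite natrM exprMn.
rewrite -[leRHS]mulrA ler_wpM2l ?exprn_ge0//.
exact: expr_le_expR.
Qed.

End quadratic_upper.

Section quadratic_upper_bound.
Context {R : realType} {d : nat}.
Local Notation mu := (@lebesgue_rV R d).
Variables (Phi g : 'rV[R]_d -> R) (M Cg tau : R).
Hypotheses (cPhi : continuous Phi) (PhiM : forall x, `|Phi x| <= M).
Hypotheses (mg : measurable_fun setT g) (Phi_g : is_fourier_transform Phi g).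
Hypothesis tau_gt : d%:R / 2 < tau.
Hypothesis g_le : forall w, 0 <= g w <= Cg * (1 + norm2 w ^+ 2) `^ (- tau).
Let b := tau - d%:R / 2.

Let b0 : 0 < b. Proof. by rewrite subr_gt0. Qed.

Let tau0 : 0 <= tau. Proof. by rewrite (le_trans _ (ltW tau_gt))// divr_ge0. Qed.

Let Cg0 : 0 <= Cg.
Proof.
have /andP[h1 h2] := g_le 0; have := le_trans h1 h2.
by rewrite pmulr_lge0// powR_gt0// ltr_pwDl// sqr_ge0.
Qed.

Lemma g_bounded w : `|g w| <= Cg.
Proof.
have /andP[h1 h2] := g_le w; rewrite ger0_norm// (le_trans h2)// ler_piMr//.
rewrite powRN invf_le1 ?powR_gt0 ?ltr_pwDl ?sqr_ge0//.
rewrite -[leLHS](@powRr0 _ (1 + norm2 w ^+ 2)) ler_powR// lerDl sqr_ge0//.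
Qed.

(** The decay is replaced by Gaussians of width [s j = 2 ^+ j]. At scale [j] the mass is of order
    [s j ^+ d] and the exponential sum is, up to [L ^+ 2], of order at most the minimum of 1 and
    [(s j * r) ^+ (2 * l)]. As [2 b = 2 tau - d], the terms are [r^(2b)] times those of
    [sum_dyadic_le], and the bound is independent of [e]. *)
Lemma quadratic_form_upper l : b + 1 <= l%:R -> exists2 C : R, 0 < C &
  forall (I : finType) (a : I -> R) (z : I -> 'rV[R]_d) (c : 'rV[R]_d) (L r : R),
  0 < r -> \sum_i `|a i| <= L -> (forall i, norm2 (z i - c) <= r) ->
  (forall w k, (k < l)%N -> \sum_i a i * dotp w (z i - c) ^+ k = 0) ->
  \sum_i \sum_j a i * a j * Phi (z i - z j) <= C * L ^+ 2 * r `^ (2 * b).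
Proof.
move=> bl; have [C1 C10 hC1] := sum_dyadic_le b0.
pose K := Cg * (expR 1 * 4 `^ tau) * (2 * (2 * l)%:R ^+ l) * Num.sqrt (2 * pi) ^+ d.
have K0 : 0 <= K.
  by rewrite !mulr_ge0 ?exprn_ge0 ?sqrtr_ge0 ?powR_ge0 ?expR_ge0.
exists ((@fourier_const R d)^-1 * (K * C1 + 1)).
  by rewrite mulr_gt0 ?invr_gt0 ?fourier_const_gt0// ltr_wpDl// mulr_ge0// ltW.
move=> I a z c L r r0 aL zr mom.
have L0 : 0 <= L by apply: le_trans aL; apply: sumr_ge0.
have limQ := @cvg_gtrig_sqr R d Phi g M Cg cPhi PhiM mg g_bounded Phi_g I a z.
suff bound e : 0 < e -> \int[mu]_w (g w * (trig_sqr a z w * gauss e w)) <=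
    K * C1 * (L ^+ 2 * r `^ (2 * b)).
  rewrite -[leRHS]mulrA -[leRHS]mulrA ler_pdivlMl ?fourier_const_gt0//.
  apply: (@le_trans _ _ (K * C1 * (L ^+ 2 * r `^ (2 * b)))); last first.
    by rewrite ler_wpM2r ?mulr_ge0 ?sqr_ge0 ?powR_ge0// lerDl.
  rewrite -(cvg_lim _ limQ)//; apply: limr_le; first by apply/cvg_ex; eexists; exact: limQ.
  by near=> e; apply: bound; near: e; exact: nbhs_right_gt.
move=> e0.
have [J eJ] : exists J, 2 / 4 ^+ J <= e.
  near \oo => J; exists J.
  rewrite ler_pdivrMr ?exprn_gt0// -ler_pdivrMl//.
  apply: (@le_trans _ _ J%:R).
    by near: J; exact: nbhs_infty_ger.
  by rewrite -natrX ler_nat ltnW// ltn_expl.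
pose s j : R := 2 ^+ j; have s0 j : 0 < s j by rewrite exprn_gt0.
pose t j := (s j * r) `^ (- 2 * b) * Num.min 1 ((s j * r) ^+ (2 * l)).
pose m j : R := Num.min 1 ((s j * r) ^+ (2 * l)).
pose q j := Cg * (expR 1 * 4 `^ tau) * (s j) `^ (- 2 * tau) *
   (2 * L ^+ 2 * (2 * l)%:R ^+ l * m j).
have m0 j : 0 <= m j by rewrite le_min ler01 exprn_ge0// mulr_ge0// ltW.
have [iF _] := gtrig_sqrE mg g_bounded a z e0.
have mom_le w j : trig_sqr a z w * gauss ((s j) ^- 2) w <=
    2 * L ^+ 2 * (2 * l)%:R ^+ l * m j.
  have L20 : 0 <= 2 * L ^+ 2 by rewrite mulr_ge0// sqr_ge0.
  rewrite -(trig_sqr_translate a z c) -mulrA /m.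
  have [_|_] := leP 1 ((s j * r) ^+ (2 * l)).
    rewrite mulr1; apply: (@le_trans _ _ (2 * L ^+ 2 * 1)).
      apply: ler_pM; rewrite ?trig_sqr_ge0 ?gauss_ge0//.
        exact: trig_sqr_le.
      by rewrite gauss_le1// invr_ge0 exprn_ge0// ltW.
    rewrite ler_wpM2l//; case: (l) => [|n]; first by rewrite expr0.
    by rewrite exprn_ege1// ler1n.
  have h := trig_sqr_le_moments aL zr mom w.
  apply: (le_trans (ler_wpM2r (gauss_ge0 _ _) h)).
  by rewrite -[leLHS]mulrA ler_wpM2l// expn_gauss_le.
have term_le w j : expR (- (dotp w w / 4 ^+ j)) * trig_sqr a z w <=
    2 * L ^+ 2 * (2 * l)%:R ^+ l * m j * gauss ((s j) ^- 2) w.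
  (* One factor absorbs the power of [norm2 w] in the moment bound, the other is integrated. *)
  have -> : expR (- (dotp w w / 4 ^+ j)) = gauss ((s j) ^- 2) w * gauss ((s j) ^- 2) w.
    have -> : (4 : R) ^+ j = s j ^+ 2 
      by rewrite -[s j]/(2 ^+ j) -exprM mulnC exprM; congr (_ ^+ _); rewrite -natrX.
    by rewrite -gaussD /gauss; congr expR; field; rewrite gt_eqF.
  by rewrite -mulrA mulrC ler_wpM2r ?gauss_ge0// mulrC.
have ptw w : g w * (trig_sqr a z w * gauss e w) <=
    \sum_(j < J.+1) q j * gauss ((s j) ^- 2) w.
  have /andP[g0 g1] := g_le w.
  have h := decay_le_dyadic tau0 (dotp_ge0 w) eJ.
  apply: (@le_trans _ _ (Cg * (expR 1 * 4 `^ tau) * (\sum_(j < J.+1) s j `^ (-2 * tau) *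
      expR (- (dotp w w / 4 ^+ j))) * trig_sqr a z w)).
    rewrite mulrCA mulrC ler_wpM2r ?trig_sqr_ge0//.
    apply: (@le_trans _ _ (Cg * ((1 + norm2 w ^+ 2) `^ (- tau) * gauss e w))).
      by rewrite mulrA ler_wpM2r ?gauss_ge0.
    by rewrite -[leRHS]mulrA ler_wpM2l// sqr_norm2.
  rewrite -[leLHS]mulrA mulr_suml mulr_sumr; apply: ler_sum => j _.
  rewrite /q -[leRHS]mulrA -[leRHS]mulrA ler_wpM2l//.
    by rewrite !mulr_ge0 ?expR_ge0 ?powR_ge0.
  by rewrite -[leLHS]mulrA ler_wpM2l ?powR_ge0.
have sV0 j : 0 < (s j) ^- 2 by rewrite invr_gt0 exprn_gt0.
have iq (j : 'I_J.+1) : mu.-integrable setT (EFin \o (fun w => q j * gauss ((s j) ^- 2) w)).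
  have := integrableZl measurableT (q j) (integrable_gauss (0 : 'rV[R]_d) (sV0 j)).
  by apply: eq_integrable => // w _ /=; rewrite subr0 EFinM.
have [iS ES] := Rintegral_bigsum (index_enum 'I_J.+1) iq.
apply: (le_trans (le_Rintegral measurableT iF iS (fun w _ => ptw w))).
rewrite ES.
have massE (j : 'I_J.+1) : \int[mu]_w (q j * gauss ((s j) ^- 2) w) =
    K * (L ^+ 2 * r `^ (2 * b)) * t j.
  transitivity (\int[mu]_w (q j * gauss ((s j) ^- 2) (w - 0))).
    by apply: eq_Rintegral => w _; rewrite subr0.
  rewrite RintegralZl//; last exact: integrable_gauss.
  rewrite Rintegral_gauss// invrK sqrtrM ?mulr_ge0 ?pi_ge0// sqrtr_sqr.
  rewrite (ger0_norm (ltW (s0 j))) exprMn /t /m.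
  have -> : (s j * r) `^ (- 2 * b) = s j `^ (- 2 * tau) * s j ^+ d * (r `^ (2 * b))^-1.
    rewrite powRM ?(ltW (s0 j)) ?(ltW r0)// mulNr [r `^ _]powRN.
    rewrite -[s j ^+ d]powR_mulrn ?(ltW (s0 j))// -powRD; last first.
      by rewrite (gt_eqF (s0 j)) implybT.
    by congr (_ `^ _ * _); rewrite /b; field.
  rewrite /q /K /m.
  have rb : r `^ (2 * b) != 0 by rewrite gt_eqF// powR_gt0.
  by field.
under eq_bigr do rewrite massE.
rewrite -mulr_sumr -[leLHS]mulrA -[leRHS]mulrA ler_wpM2l//.
rewrite mulrC ler_wpM2r ?mulr_ge0 ?sqr_ge0 ?powR_ge0//.
exact: hC1.
Unshelve. all: end_near. Qed.

End quadratic_upper_bound.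

(** * Lower bound for the quadratic form *)

Section cos_product.
Context {R : realType}.
Implicit Types (u x : R) (n : nat).

Lemma abs_sin_le x : `|sin x| <= `|x|.
Proof.
rewrite -[leRHS]expr1; apply: (@le_abs_expn _ sin cos); rewrite ?sin0// => y.
by rewrite expr0 ler_norml cos_geN1 cos_le1.
Qed.

Lemma cos_ge_sqr x : 1 - x ^+ 2 / 2 <= cos x.
Proof.
have -> : x = x / 2 *+ 2 by rewrite -mulr_natr divfK.
rewrite cos_mulr2n; have := cos2Dsin2 (x / 2).
have : sin (x / 2) ^+ 2 <= (x / 2) ^+ 2.
  by rewrite -[leLHS]real_normK ?num_real// -[leRHS]real_normK ?num_real// lerXn2r ?nnegrE ?abs_sin_le.
by rewrite -mulr_natr; lra.
Qed.

Lemma abs_sin_ge x : `|x| <= 1 -> `|x| / 2 <= `|sin x|.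
Proof.
have pos (y : R) : 0 <= y -> y <= 1 -> y / 2 <= sin y.
  move=> y0 y1; have [c] := @MVT_segment R sin cos 0 y y0 (fun u _ => is_derive_sin u)
    (continuous_subspaceT (@continuous_sin R)).
  rewrite sin0 !subr0 in_itv/= => /andP[c0 cy] ->.
  rewrite mulrC ler_wpM2r// (le_trans _ (cos_ge_sqr c))//.
  have : c ^+ 2 <= 1 by rewrite exprn_ile1// (le_trans cy).
  by lra.
have [x0|/ltW x0] := leP 0 x.
  rewrite [`|x|]ger0_norm// => x1; have h := pos _ x0 x1.
  by rewrite ger0_norm// (le_trans _ h)// divr_ge0.
rewrite [`|x|]ler0_norm// => x1; have nx0 : 0 <= - x by rewrite oppr_ge0.
have h := pos _ nx0 x1; rewrite -normrN -sinN ger0_norm//.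
by rewrite (le_trans _ h)// divr_ge0.
Qed.

(** Finite Viete product, approximating [sin u / u]. Unlike that quotient it is a trigonometric
    polynomial, and its frequencies are at most 1 in absolute value. *)
Definition cos_prod n u : R := \prod_(j < n) cos (u / 2 ^+ j.+1).

Lemma cos_prodE n u : 2 ^+ n * sin (u / 2 ^+ n) * cos_prod n u = sin u.
Proof.
elim: n => [|n IH]; first by rewrite /cos_prod big_ord0 expr0 mul1r divr1 mulr1.
rewrite -[RHS]IH /cos_prod big_ord_recr /=.
have -> : u / 2 ^+ n = u / 2 ^+ n.+1 *+ 2.
  by rewrite -mulr_natr exprS; field; rewrite expf_neq0.
by rewrite sin_mulr2n -mulr_natr exprS; ring.
Qed.

Lemma cos_prod_le1 n u : `|cos_prod n u| <= 1.
Proof.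
elim: n => [|n IH]; rewrite /cos_prod ?big_ord0 ?normr1// big_ord_recr normrM.
by rewrite mulr_ile1// ler_norml cos_geN1 cos_le1.
Qed.

(** Viete's identity gives decay like [1 / u] as long as [u / 2 ^+ n] stays where the sine is
    comparable to its argument. The product is periodic, so the range of [u] has to be
    restricted. *)
Lemma cos_prod_decay n u : `|u| <= 2 ^+ n -> cos_prod n u ^+ 2 * (1 + u ^+ 2) <= 5.
Proof.
move=> un; have p0 : 0 < 2 ^+ n :> R by rewrite exprn_gt0.
have h : `|u / 2 ^+ n| <= 1.
  by rewrite normrM normfV [`|2 ^+ n|]ger0_norm ?(ltW p0)// ler_pdivrMr// mul1r.
have h1 : `|cos_prod n u| * (`|u| / 2) <= 1.
  apply: (@le_trans _ _ `|sin u|); last by rewrite ler_norml sin_geN1 sin_le1.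
  rewrite -(cos_prodE n u) normrM mulrC ler_wpM2r// normrM [`|2 ^+ n|]ger0_norm ?(ltW p0)//.
  have := abs_sin_ge h; rewrite normrM normfV [`|2 ^+ n|]ger0_norm ?(ltW p0)//.
  move=> /(ler_wpM2l (ltW p0)); apply: le_trans.
  by rewrite mulrAC mulrCA divff ?gt_eqF// mulr1.
have h2 : cos_prod n u ^+ 2 <= 1.
  by rewrite -[leLHS]real_normK ?num_real// exprn_ile1// cos_prod_le1.
have h3 : cos_prod n u ^+ 2 * u ^+ 2 <= 4.
  rewrite -[X in X * _]real_normK ?num_real// -[X in _ * X]real_normK ?num_real//.
  have h4 : 0 <= `|cos_prod n u| * `|u| by rewrite mulr_ge0.
  by rewrite -exprMn; nra.
by lra.
Qed.

Lemma cos_prod_ge n u : `|u| <= 1 -> 1 / 4 <= cos_prod n u ^+ 2.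
Proof.
move=> u1; have [->|u0] := eqVneq u 0.
  rewrite /cos_prod big1 ?expr1n; first by lra.
  by move=> j _; rewrite mul0r cos0.
have p0 : 0 < 2 ^+ n :> R by rewrite exprn_gt0.
have h := abs_sin_ge u1; rewrite -(cos_prodE n u) !normrM in h.
have h2 : `|2 ^+ n| * `|sin (u / 2 ^+ n)| <= `|u|.
  apply: (le_trans (ler_wpM2l (normr_ge0 _) (abs_sin_le _))).
  by rewrite -normrM mulrC divfK// gt_eqF.
have {}h := le_trans h (ler_wpM2r (normr_ge0 _) h2).
have : 1 / 2 <= `|cos_prod n u|.
  by rewrite -(@ler_pM2l _ `|u|) ?normr_gt0// mul1r.
by rewrite -[X in _ -> _ <= X]real_normK ?num_real//; nra.
Qed.

End cos_product.

Lemma integrable_bounded_mul_gauss {R : realType} {d : nat} (e C : R)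
    (f : 'rV[R]_d -> R) : 0 < e -> measurable_fun setT f ->
  (forall w, `|f w| <= C) ->
  (@lebesgue_rV R d).-integrable setT (EFin \o (fun w => f w * gauss e w)).
Proof.
move=> e0 mf fC; apply: (@integrable_le_gauss _ _ e C 0) => //.
  by apply: measurable_funM => //; exact: measurable_gauss_center.
by move=> w; rewrite subr0 normrM (ger0_norm (gauss_ge0 _ _)) ler_wpM2r ?gauss_ge0.
Qed.

(** * Cutoff functions with small spectrum *)

Section cutoff.
Context {R : realType} {d : nat}.
Local Notation mu := (@lebesgue_rV R d).
Implicit Types (T : seq 'rV[R]_d) (v w : 'rV[R]_d).

Definition cos_seq T w : R := \prod_(t <- T) cos (dotp w t).

Lemma measurable_cos_seq T v : measurable_fun setT (fun w => cos (dotp w v) * cos_seq T w).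
Proof.
apply: continuous_measurable_rV => w.
have cd v' : cos (dotp x v') @[x --> w] --> cos (dotp w v').
  apply: (cvg_comp _ cos); last exact: continuous_cos.
  exact: continuous_dotp.
apply: (@cvgM _ _ (nbhs w)) => //; rewrite /cos_seq; elim: T => [|t T IH].
  by under eq_fun do rewrite big_nil; rewrite big_nil; exact: cvg_cst.
under eq_fun do rewrite big_cons; rewrite big_cons.
exact: (@cvgM _ _ (nbhs w)).
Qed.

Lemma cos_seq_le1 T w : `|cos_seq T w| <= 1.
Proof.
rewrite /cos_seq; elim: T => [|t T IH]; first by rewrite big_nil normr1.
by rewrite big_cons normrM mulr_ile1// ler_norml cos_geN1 cos_le1.
Qed.

Lemma integrable_cos_seq T v (e : R) : 0 < e ->
  mu.-integrable setT (EFin \o (fun w => cos (dotp w v) * cos_seq T w * gauss e w)).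
Proof.
move=> e0; apply: (@integrable_bounded_mul_gauss _ _ _ 1) => //.
  exact: measurable_cos_seq.
by move=> w; rewrite normrM mulr_ile1 ?cos_seq_le1// ler_norml cos_geN1 cos_le1.
Qed.

(* cos_seq T is the Fourier transform of a measure supported in the ball of
   radius \sum |t|, so that away from this ball only the Gaussian tail is seen. *)
Lemma Rintegral_cos_seq T v (r e : R) : 0 < e -> 0 <= r ->
  r + \sum_(t <- T) norm2 t <= norm2 v ->
  `|\int[mu]_w (cos (dotp w v) * cos_seq T w * gauss e w)| <=
    gauss_mass e ^+ d * expR (- (e^-1 / 2) * r ^+ 2).
Proof.
move=> e0 r0; elim: T v => [|t T IH] v.
  rewrite big_nil addr0 => rv.
  apply: (@le_trans _ _ `|\int[mu]_w (cos (dotp w v + 0) * gauss e w)|).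
    rewrite le_eqVlt; apply/orP; left; apply/eqP; congr (`|_|).
    by apply: eq_Rintegral => w _; rewrite /cos_seq big_nil mulr1 addr0.
  rewrite Rintegral_cos_gauss// cos0 mul1r ger0_norm; last first.
    by rewrite mulr_ge0 ?gauss_ge0// exprn_ge0// sqrtr_ge0.
  rewrite ler_wpM2l ?exprn_ge0 ?gauss_mass_ge0// ler_expR !mulNr lerN2.
  rewrite ler_wpM2l ?divr_ge0 ?invr_ge0 ?(ltW e0)// -sqr_norm2.
  by rewrite lerXn2r ?nnegrE ?norm2_ge0.
rewrite big_cons => rv.
have h1 : r + \sum_(t <- T) norm2 t <= norm2 (v + t).
  have := ler_norm2D (v + t) (- t); rewrite addrK norm2N; lra.
have h2 : r + \sum_(t <- T) norm2 t <= norm2 (v - t).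
  have := ler_norm2D (v - t) t; rewrite subrK; lra.
have i1 := integrable_cos_seq T (v + t) e0.
have i2 := integrable_cos_seq T (v - t) e0.
have -> : \int[mu]_w (cos (dotp w v) * cos_seq (t :: T) w * gauss e w) =
    2^-1 * (\int[mu]_w (cos (dotp w (v + t)) * cos_seq T w * gauss e w) +
    \int[mu]_w (cos (dotp w (v - t)) * cos_seq T w * gauss e w)).
  rewrite -RintegralD// -RintegralZl//; last first.
    by have := integrableD measurableT i1 i2; apply: eq_integrable.
  apply: eq_Rintegral => w _; rewrite /cos_seq big_cons !dotpDr dotpNr cosD cosB.
  by field.
rewrite normrM ger0_norm ?invr_ge0//.
have := ler_normD (\int[mu]_w (cos (dotp w (v + t)) * cos_seq T w * gauss e w))
  (\int[mu]_w (cos (dotp w (v - t)) * cos_seq T w * gauss e w)).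
have := IH _ h1; have := IH _ h2.
set A := gauss_mass e ^+ d * _; lra.
Qed.

End cutoff.

Section cutoff_seq.
Context {R : realType} {d : nat}.
Implicit Types (w : 'rV[R]_d).

(** For each coordinate, [2 * p] copies of the arguments of the Viete product at scale [h]: the even
    power makes the product of cosines nonnegative, and [p] sets its rate of decay. *)
Definition cutoff_seq p n (h : R) : seq 'rV[R]_d :=
  flatten [seq flatten (nseq (2 * p) [seq (h / 2 ^+ j.+1) *: delta_mx ord0 i
    | j <- iota 0 n]) | i <- enum 'I_d].

Lemma cos_cutoff_seq p n h w :
  cos_seq (cutoff_seq p n h) w = \prod_i (cos_prod n (h * w ord0 i) ^+ 2) ^+ p.
Proof.
rewrite /cos_seq big_flatten big_map big_enum /=; apply: eq_bigr => i _.
rewrite -exprM; elim: (2 * p)%N => [|m IH]; first by rewrite big_nil expr0.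
rewrite /= big_cat IH exprS; congr (_ * _).
have -> : iota 0 n = index_iota 0 n by rewrite /index_iota subn0.
rewrite big_map /cos_prod big_mkord.
apply: eq_bigr => j _; congr cos.
by rewrite dotpZr dotpC dotp_delta mulrAC.
Qed.

Lemma norm2_delta (i : 'I_d) : norm2 (delta_mx ord0 i : 'rV[R]_d) = 1.
Proof. by rewrite /norm2 dotp_delta mxE !eqxx sqrtr1. Qed.

Lemma sum_cutoff_seq p n h : 0 <= h ->
  \sum_(t <- cutoff_seq p n h) norm2 t <= (d * (2 * p))%:R * h.
Proof.
move=> h0.
have inner (i : 'I_d) : \sum_(t <- [seq (h / 2 ^+ j.+1) *: delta_mx ord0 i | j <- iota 0 n])
    norm2 (t : 'rV[R]_d) <= h.
  have -> : iota 0 n = index_iota 0 n by rewrite /index_iota subn0.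
  rewrite big_map big_mkord.
  apply: (@le_trans _ _ (h * (1 - (2 ^+ n)^-1))); last first.
    by rewrite ler_piMr// lerBlDr lerDl invr_ge0 exprn_ge0.
  elim: n => [|m IH]; first by rewrite big_ord0 expr0 invr1 subrr mulr0.
  rewrite big_ord_recr /=; apply: (le_trans (lerD IH (lexx _))).
  rewrite norm2Z norm2_delta mulr1 ger0_norm ?divr_ge0 ?exprn_ge0//.
  rewrite le_eqVlt; apply/orP; left; apply/eqP.
  by rewrite exprS; field; rewrite expf_neq0.
rewrite big_flatten big_map big_enum /=.
apply: (@le_trans _ _ (\sum_(i < d) (2 * p)%:R * h)); last first.
  by rewrite sumr_const card_ord -[leLHS]mulr_natl (natrM _ d) mulrA.
apply: ler_sum => i _; elim: (2 * p)%N => [|m IH]; first by rewrite big_nil mul0r.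
by rewrite /= big_cat /= -(addn1 m) natrD mulrDl mul1r [leLHS]addrC lerD.
Qed.

Lemma cutoff_seq_ge0 p n h w : 0 <= cos_seq (cutoff_seq p n h) w.
Proof.
by rewrite cos_cutoff_seq; apply: prodr_ge0 => i _; rewrite exprn_ge0// sqr_ge0.
Qed.

Lemma cutoff_seq_ge p n h w : h ^+ 2 * dotp w w <= 1 ->
  4^-1 ^+ (d * p) <= cos_seq (cutoff_seq p n h) w.
Proof.
move=> hw; rewrite cos_cutoff_seq mulnC exprM.
rewrite -[X in _ ^+ X]card_ord -prodr_const; apply: ler_prod => i _.
rewrite exprn_ge0//= lerXn2r ?nnegrE ?sqr_ge0// -div1r cos_prod_ge//.
rewrite -(@ler_pXn2r _ 2)// ?nnegrE// expr1n real_normK ?num_real// exprMn.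
apply: le_trans hw; rewrite ler_wpM2l ?sqr_ge0// /dotp (bigD1 i)//= -expr2 lerDl.
by apply: sumr_ge0 => j _; rewrite -expr2 sqr_ge0.
Qed.

Lemma prod_ge1Dsum (I : Type) (r : seq I) (y : I -> R) : (forall i, 0 <= y i) ->
  1 + \sum_(i <- r) y i <= \prod_(i <- r) (1 + y i).
Proof.
move=> y0; elim: r => [|i r IH]; first by rewrite !big_nil addr0.
rewrite !big_cons; apply: le_trans (ler_wpM2l _ IH); last by rewrite addr_ge0.
have := y0 i; have : 0 <= \sum_(j <- r) y j by apply: sumr_ge0.
by set s := \sum_(_ <- _) _; nra.
Qed.

Lemma gauss_decay (e tau : R) (p : nat) : 0 < e -> tau <= p%:R -> exists Q : R,
  forall w, Q <= dotp w w -> gauss e w <= (1 + dotp w w) `^ (- tau).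
Proof.
move=> e0 tp; pose Q := (p.+1%:R * 2 / e) ^+ p.+1 * expR (e / 2).
exists Q => w; set q := dotp w w => Qq.
have q0 : 0 <= q := dotp_ge0 w.
have q1 : 0 < 1 + q by rewrite ltr_pwDl.
rewrite powRN -[gauss e w]invrK lef_pV2 ?posrE ?invr_gt0 ?gauss_gt0 ?powR_gt0//.
rewrite /gauss -expRN mulNr opprK -/q.
apply: (@le_trans _ _ ((1 + q) ^+ p)).
  by rewrite -powR_mulrn ?(ltW q1)// ler_powR// lerDl.
have h : (e / 2 * (1 + q)) ^+ p.+1 <= p.+1%:R ^+ p.+1 * expR (e / 2 * (1 + q)).
  by apply: expr_le_expR; rewrite mulr_ge0 ?(ltW q1)// divr_ge0// ltW.
have {}h : (1 + q) ^+ p.+1 <= Q * expR (e / 2 * q).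
  rewrite /Q -mulrA -expRD -[X in expR (X + _)]mulr1 -mulrDr.
  have -> : p.+1%:R * 2 / e = p.+1%:R / (e / 2) by field; rewrite gt_eqF.
  have e20 : 0 < (e / 2) ^+ p.+1 by rewrite exprn_gt0// divr_gt0.
  rewrite exprMn exprVn mulrAC ler_pdivlMr//.
  by rewrite -exprMn mulrC.
rewrite -(ler_pM2r q1) -exprSr (le_trans h)// mulrC ler_wpM2l ?expR_ge0//.
by rewrite (le_trans Qq)// lerDr.
Qed.

(** [n] depends on [e]: where every [h * w ord0 i] is at most [2 ^+ n] in absolute value the Viete
    products decay, and elsewhere [w] is so large that the Gaussian alone suffices. The constant
    depends on neither; its factor [H / h] comes from [1 + h^2 q >= (h / H)^2 (1 + q)]. *)
Lemma cutoff_seq_decay (p : nat) (h H e tau : R) : 0 < h -> h <= H -> 1 <= H ->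
  0 < e -> 0 <= tau -> tau <= p%:R -> exists n, forall w,
  cos_seq (cutoff_seq p n h) w * gauss e w <=
    5 ^+ (d * p) * (H / h) `^ (2 * tau) * (1 + dotp w w) `^ (- tau).
Proof.
move=> h0 hH H1 e0 t0 tp; have [Q hQ] := gauss_decay e0 tp.
have H0 : 0 < H := lt_le_trans ltr01 H1.
have Hh1 : 1 <= H / h by rewrite ler_pdivlMr// mul1r.
have Hh2 : 1 <= (H / h) `^ (2 * tau).
  by rewrite -[leLHS](@powRr0 _ (H / h)) ler_powR// mulr_ge0.
have [n hn] : exists n : nat, Q * h ^+ 2 <= n%:R.
  by near \oo => n; exists n; near: n; exact: nbhs_infty_ger.
exists n => w; set q := dotp w w.
have q0 : 0 <= q := dotp_ge0 w.
have q1 : 0 < 1 + q by rewrite ltr_pwDl.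
have S1 : cos_seq (cutoff_seq p n h) w <= 1.
  by apply: (le_trans (ler_norm _)); exact: cos_seq_le1.
have [/forallP small|/forallPn[i]] := boolP [forall i, `|h * w ord0 i| <= 2 ^+ n].
  apply: (@le_trans _ _ (cos_seq (cutoff_seq p n h) w)).
    by rewrite ler_piMr ?cutoff_seq_ge0// gauss_le1// ltW.
  have hq0 : 0 < 1 + h ^+ 2 * q by rewrite ltr_pwDl// mulr_ge0// sqr_ge0.
  have step1 : cos_seq (cutoff_seq p n h) w * (1 + h ^+ 2 * q) ^+ p <= 5 ^+ (d * p).
    apply: (@le_trans _ _ (cos_seq (cutoff_seq p n h) w *
        \prod_i (1 + (h * w ord0 i) ^+ 2) ^+ p)).
      rewrite ler_wpM2l ?cutoff_seq_ge0// prodrXl lerXn2r ?nnegrE ?(ltW hq0)//.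
        by apply: prodr_ge0 => i _; rewrite addr_ge0// sqr_ge0.
      apply: le_trans (prod_ge1Dsum _ _); last by move=> i; exact: sqr_ge0.
      rewrite lerD2l /q /dotp mulr_sumr; apply: ler_sum => i _.
      by rewrite exprMn expr2 lexx.
    rewrite cos_cutoff_seq -big_split /= mulnC exprM -[X in _ ^+ X]card_ord -prodr_const.
    apply: ler_prod => i _; rewrite -exprMn.
    have A0 : 0 <= cos_prod n (h * w ord0 i) ^+ 2 * (1 + (h * w ord0 i) ^+ 2).
      by apply: mulr_ge0; [exact: sqr_ge0|rewrite addr_ge0// sqr_ge0].
    rewrite exprn_ge0//= lerXn2r ?nnegrE//.
    exact: cos_prod_decay.
  rewrite -ler_pdivlMr ?exprn_gt0// in step1.
  apply: (le_trans step1); rewrite -[leRHS]mulrA ler_wpM2l ?exprn_ge0//.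
  apply: (@le_trans _ _ ((1 + h ^+ 2 * q) `^ (- tau))).
    by rewrite -powR_invn ?(ltW hq0)// ler_powR ?lerN2// lerDl mulr_ge0// sqr_ge0.
  have -> : (H / h) `^ (2 * tau) = ((h / H) ^+ 2) `^ (- tau).
    have y0 : 0 <= h / H by rewrite divr_ge0 ?(ltW h0) ?(ltW H0).
    rewrite -[H / h]invf_div -[(h / H)^-1]powR_inv1// -[(h / H) ^+ 2]powR_mulrn//.
    by rewrite -!powRrM; congr (_ `^ _); ring.
  rewrite -powRM ?sqr_ge0 ?(ltW q1)// !powRN lef_pV2 ?posrE ?powR_gt0//; last first.
    by rewrite mulr_gt0// exprn_gt0// divr_gt0.
  have y0 : 0 <= h / H by rewrite divr_ge0 ?(ltW h0) ?(ltW H0).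
  apply: ge0_ler_powR; rewrite ?nnegrE ?(ltW hq0)//.
    by apply: mulr_ge0; [exact: sqr_ge0|exact: ltW].
  rewrite mulrDr mulr1 lerD//.
    by rewrite exprn_ile1// ler_pdivrMr// mul1r.
  rewrite ler_wpM2r// lerXn2r ?nnegrE ?(ltW h0)//.
  by rewrite ler_pdivrMr// ler_peMr// ltW.
rewrite -ltNge => wi.
have Qq : Q <= q.
  have h20 : 0 < h ^+ 2 by rewrite exprn_gt0.
  rewrite -(ler_pM2r h20) (le_trans hn)//.
  apply: (@le_trans _ _ ((2 ^+ n) ^+ 2)).
    rewrite -exprM -natrX ler_nat (leq_trans (ltnW (ltn_expl n (ltnSn 1))))//.
    by rewrite leq_exp2l// leq_pmulr.
  apply: (@le_trans _ _ (`|h * w ord0 i| ^+ 2)).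
    by rewrite lerXn2r ?nnegrE ?exprn_ge0// ltW.
  rewrite real_normK ?num_real// exprMn mulrC ler_wpM2r ?(ltW h20)//.
  rewrite /q /dotp (bigD1 i)//= -expr2 lerDl.
  by apply: sumr_ge0 => j _; rewrite -expr2 sqr_ge0.
apply: (@le_trans _ _ (1 * (1 + q) `^ (- tau))).
  by rewrite mul1r; apply: le_trans (hQ _ Qq); rewrite ler_piMl ?gauss_ge0.
rewrite ler_wpM2r ?powR_ge0// -[leLHS]mul1r ler_pM//.
by rewrite exprn_ege1// ler1n.
Unshelve. all: end_near. Qed.

End cutoff_seq.

Section cutoff_mass.
Context {R : realType} {d : nat}.
Local Notation mu := (@lebesgue_rV R d).

Lemma gauss_massZ (k e : R) : 0 < k -> 0 < e -> gauss_mass (k ^+ 2 * e) = k^-1 * gauss_mass e.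
Proof.
move=> k0 e0; have p0 := pi_gt0 R.
rewrite /gauss_mass -[in RHS](ger0_norm (ltW (_ : 0 < k^-1))) ?invr_gt0//.
rewrite -sqrtr_sqr -sqrtrM ?sqr_ge0//; congr Num.sqrt.
by field; rewrite !gt_eqF.
Qed.

Lemma gauss_mass_le (e e' : R) : 0 < e -> e <= e' -> gauss_mass e' <= gauss_mass e.
Proof.
move=> e0 ee; have e'0 := lt_le_trans e0 ee.
apply: ler_wsqrtr; rewrite ler_wpM2l ?mulr_ge0 ?pi_ge0//.
by rewrite lef_pV2.
Qed.

Lemma integrable_cos_seq0 T (e : R) : 0 < e ->
  mu.-integrable setT (EFin \o (fun w => cos_seq T w * gauss e w)).
Proof.
move=> e0; have := integrable_cos_seq T 0 e0; apply: eq_integrable => // w _ /=.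
by rewrite dotp0r cos0 mul1r.
Qed.

(* Comparison with the difference of two Gaussians, which is negative outside
   the ball of radius 1/h. *)
Lemma cutoff_seq_mass (p n : nat) (h e : R) : 0 < h -> 0 < e ->
  e <= 4 * d.+1%:R * h ^+ 2 ->
  4^-1 ^+ (d * p) * (2^-1 ^+ d.+1 * gauss_mass (2 * d.+1%:R * h ^+ 2) ^+ d) <=
  \int[mu]_w (cos_seq (cutoff_seq p n h) w * gauss e w).
Proof.
move=> h0 e0 et; pose b : R := d.+1%:R; pose t := 4 * b * h ^+ 2.
have b0 : 0 < b by rewrite ltr0n.
have t0 : 0 < t by rewrite !mulr_gt0// exprn_gt0.
(* [gauss t] and [kb * gauss (t / 2)] cross exactly at [norm2 w = h^-1]. Moreover
   [kb <= 2^-1 ^+ d.+1], so the subtracted mass is at most half of the lower bound for the first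
   one. *)
pose kb := expR (- b).
have t2 : 2 * b * h ^+ 2 = t / 2 by rewrite /t; field.
rewrite -/b t2.
have te0 : 0 < t + e by rewrite addr_gt0.
have te20 : 0 < t / 2 + e by rewrite addr_gt0// divr_gt0.
have i1 : mu.-integrable setT (EFin \o (fun w => gauss (t + e) (w - 0))).
  exact: integrable_gauss.
have i2 : mu.-integrable setT (EFin \o (fun w => kb * gauss (t / 2 + e) (w - 0))).
  have := integrableZl measurableT kb (integrable_gauss (0 : 'rV[R]_d) te20).
  by apply: eq_integrable => // w _ /=; rewrite EFinM.
have i12 : mu.-integrable setT (EFin \o (fun w =>
    gauss (t + e) (w - 0) - kb * gauss (t / 2 + e) (w - 0))).
  by have := integrableB measurableT i1 i2; apply: eq_integrable.
have i3 : mu.-integrable setT (EFin \o (fun w => 4^-1 ^+ (d * p) * (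
    gauss (t + e) (w - 0) - kb * gauss (t / 2 + e) (w - 0)))).
  have := integrableZl measurableT (4^-1 ^+ (d * p)) i12.
  by apply: eq_integrable => // w _ /=; rewrite EFinM.
apply: (@le_trans _ _ (\int[mu]_w (4^-1 ^+ (d * p) * (
    gauss (t + e) (w - 0) - kb * gauss (t / 2 + e) (w - 0))))); last first.
  apply: le_Rintegral => //; first exact: integrable_cos_seq0.
  move=> w _; rewrite !subr0 !gaussD mulrA -mulrBl mulrA ler_wpM2r ?gauss_ge0//.
  have S0 := cutoff_seq_ge0 p n h w.
  have [hw|hw] := leP (h ^+ 2 * dotp w w) 1.
    apply: le_trans (cutoff_seq_ge p n hw).
    rewrite ler_piMr ?exprn_ge0// lerBlDr (le_trans (gauss_le1 _ (ltW t0)))// lerDl.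
    by rewrite mulr_ge0 ?expR_ge0 ?gauss_ge0.
  apply: le_trans S0; rewrite mulr_ge0_le0 ?exprn_ge0// subr_le0.
  rewrite /kb /gauss -expRD ler_expR -/b.
  have : b <= b * (h ^+ 2 * dotp w w) by rewrite ler_peMr ?(ltW hw)// ltW.
  by rewrite /t; lra.
rewrite RintegralZl// ler_wpM2l ?exprn_ge0// RintegralB// RintegralZl//; last first.
  exact: integrable_gauss.
rewrite !Rintegral_gauss// -/(gauss_mass _) -/(gauss_mass _).
have h1 : 2^-1 * gauss_mass (t / 2) <= gauss_mass (t + e).
  rewrite -gauss_massZ ?divr_gt0//; apply: gauss_mass_le => //.
  by rewrite /t -/b in et *; lra.
have h2 : gauss_mass (t / 2 + e) <= gauss_mass (t / 2).
  by apply: gauss_mass_le; rewrite ?divr_gt0// lerDl ltW.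
have m0 : 0 <= gauss_mass (t / 2) ^+ d by rewrite exprn_ge0// gauss_mass_ge0.
have h3 : 2^-1 ^+ d * gauss_mass (t / 2) ^+ d <= gauss_mass (t + e) ^+ d.
  by rewrite -exprMn lerXn2r ?nnegrE ?mulr_ge0 ?gauss_mass_ge0.
have h4 : gauss_mass (t / 2 + e) ^+ d <= gauss_mass (t / 2) ^+ d.
  by rewrite lerXn2r ?nnegrE ?gauss_mass_ge0.
have h5 : kb <= 2^-1 ^+ d.+1.
  rewrite /kb expRN /b -[d.+1%:R]mulr1 expRM_natl -exprVn lerXn2r ?nnegrE ?invr_ge0 ?expR_ge0//.
  by rewrite lef_pV2 ?posrE ?expR_gt0// (le_trans _ (expR_ge1Dx 1)).
have h6 : kb * gauss_mass (t / 2 + e) ^+ d <= 2^-1 ^+ d.+1 * gauss_mass (t / 2) ^+ d.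
  by rewrite ler_pM ?expR_ge0// exprn_ge0// gauss_mass_ge0.
move: h3 h6; rewrite [2^-1 ^+ d.+1]exprS.
set A := gauss_mass (t + e) ^+ d; set B := kb * _.
have := mulr_ge0 (exprn_ge0 d (_ : 0 <= 2^-1 :> R)) m0.
set C := 2^-1 ^+ d * _ => _ hA; rewrite -mulrA -/C => hB.
by lra.
Qed.

End cutoff_mass.

Section quadratic_lower_bound.
Context {R : realType} {d : nat}.
Local Notation mu := (@lebesgue_rV R d).
Variables (Phi g : 'rV[R]_d -> R) (M cg Cg tau : R).
Hypotheses (cPhi : continuous Phi) (PhiM : forall x, `|Phi x| <= M).
Hypotheses (mg : measurable_fun setT g) (Phi_g : is_fourier_transform Phi g).
Hypotheses (d_gt0 : (0 < d)%N) (tau_gt : d%:R / 2 < tau) (cg0 : 0 < cg).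
Hypothesis g_ge : forall w, cg * (1 + norm2 w ^+ 2) `^ (- tau) <= g w.
Hypothesis g_le : forall w, 0 <= g w <= Cg * (1 + norm2 w ^+ 2) `^ (- tau).
Let b := tau - d%:R / 2.

(** The mass grows at most like the power [- d] of the parameter, while [expr_le_expR] bounds the
    exponential by a multiple of its power [d.+1]; the product tends to 0. *)
Lemma near_gauss_tail (K r eta : R) : 0 <= K -> 0 < r -> 0 < eta ->
  \forall e \near 0^'+, K * (gauss_mass (e + e) ^+ d *
    expR (- ((e + e)^-1 / 2) * r ^+ 2)) <= eta.
Proof.
move=> K0 r0 eta0; have p0 := pi_gt0 R.
pose B : R := K * ((2 * pi) ^+ d * (d.+1%:R ^+ d.+1 * (2 / r ^+ 2) ^+ d.+1)).
have r20 : 0 < r ^+ 2 by rewrite exprn_gt0.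
have B0 : 0 <= B.
  have h1 : 0 <= 2 / r ^+ 2 by rewrite divr_ge0// ltW.
  have h2 : 0 <= 2 * pi :> R by rewrite mulr_ge0// ltW.
  by rewrite mulr_ge0// mulr_ge0 ?exprn_ge0// mulr_ge0 ?exprn_ge0.
near=> e'; set e := e' + e'.
have e'0 : 0 < e' by near: e'; exact: nbhs_right_gt.
have e0 : 0 < e by rewrite addr_gt0.
have e1 : e <= 1.
  have : e' <= 2^-1 by near: e'; apply: nbhs_right_le; rewrite invr_gt0.
  by rewrite /e; lra.
have m1 : gauss_mass e <= 2 * pi / e.
  have y1 : 1 <= 2 * pi / e.
    by rewrite ler_pdivlMr// mul1r (le_trans e1)//; have := pi_ge2 R; lra.
  rewrite -[leRHS]ger0_norm ?(le_trans ler01)// -sqrtr_sqr ler_wsqrtr// expr2.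
  by rewrite ler_peMl// (le_trans ler01).
have h1 : expR (- (e^-1 / 2) * r ^+ 2) <= d.+1%:R ^+ d.+1 * (2 / r ^+ 2 * e) ^+ d.+1.
  have x0 : 0 < e^-1 / 2 * r ^+ 2 by rewrite mulr_gt0// divr_gt0// invr_gt0.
  have hx := expr_le_expR d.+1 (ltW x0).
  rewrite mulNr expRN; have -> : 2 / r ^+ 2 * e = (e^-1 / 2 * r ^+ 2)^-1.
    by field; rewrite !gt_eqF.
  by rewrite exprVn ler_pdivlMr ?exprn_gt0// mulrC ler_pdivrMr ?expR_gt0.
apply: (@le_trans _ _ (B * e)).
  rewrite /B -mulrA ler_wpM2l//.
  apply: (@le_trans _ _ ((2 * pi / e) ^+ d * (d.+1%:R ^+ d.+1 * (2 / r ^+ 2 * e) ^+ d.+1))).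
    rewrite ler_pM ?expR_ge0 ?exprn_ge0 ?gauss_mass_ge0// lerXn2r ?nnegrE ?gauss_mass_ge0//.
    by rewrite divr_ge0 ?mulr_ge0 ?(ltW p0) ?(ltW e0).
  rewrite !exprMn exprVn !(exprS e) le_eqVlt; apply/orP; left; apply/eqP.
  by field; rewrite ?expf_neq0 ?gt_eqF.
rewrite (@le_trans _ _ ((B + 1) * e))//; first by rewrite ler_wpM2r ?(ltW e0)// lerDl.
rewrite mulrC -ler_pdivlMr ?ltr_wpDl//.
have : e' <= eta / (B + 1) / 2.
  by near: e'; apply: nbhs_right_le; rewrite !divr_gt0// ltr_wpDl.
by rewrite /e; lra.
Unshelve. all: end_near. Qed.

(** By [(1 + X)^2 + Y^2 >= 1 + 2 X] the squared modulus dominates an expression linear in the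
    coefficients other than [a i0]. Against the cutoff these cosines integrate to a Gaussian tail,
    while the constant 1 yields a mass of order [h^(-d)]. The coefficients are fixed before [e], so
    the limit removes them, and [c] depends neither on them nor on their number. *)
Lemma quadratic_form_lower (D : R) : exists2 c : R, 0 < c &
  forall (I : finType) (a : I -> R) (z : I -> 'rV[R]_d) (i0 : I) (rho : R),
  0 < rho -> rho <= D -> a i0 = 1 ->
  (forall i, i != i0 -> rho <= norm2 (z i - z i0)) ->
  c * rho `^ (2 * b) <= \sum_i \sum_j a i * a j * Phi (z i - z j).
Proof.
have b0 : 0 < b by rewrite subr_gt0.
have tau0 : 0 <= tau by rewrite (le_trans _ (ltW tau_gt))// divr_ge0.
have [p tp] : exists p : nat, tau <= p%:R.
  by near \oo => p; exists p; near: p; exact: nbhs_infty_ger.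
pose p1 := p.+1.
have tp1 : tau <= p1%:R by rewrite (le_trans tp)// ler_nat.
(* With [h = rho / m] the cutoff frequencies have total length at most [rho / 2], half of the
   separation; [p1] is a successor so that [m] is positive. *)
pose m : R := (d * (2 * p1))%:R * 2.
have m0 : 0 < m by rewrite mulr_gt0// ltr0n !muln_gt0 d_gt0.
pose H := Num.max 1 (D / m).
have H1 : 1 <= H by rewrite le_max lexx.
have H0 : 0 < H := lt_le_trans ltr01 H1.
pose c1 := cg / (5 ^+ (d * p1) * H `^ (2 * tau)).
have c10 : 0 < c1 by rewrite divr_gt0// mulr_gt0 ?exprn_gt0 ?powR_gt0.
pose I0 := 4^-1 ^+ (d * p1) * (2^-1 ^+ d.+1 * gauss_mass (2 * d.+1%:R : R) ^+ d).
have I00 : 0 < I0.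
  by rewrite !mulr_gt0 ?exprn_gt0 ?invr_gt0 ?gauss_mass_gt0// mulr_gt0// ltr0n.
exists ((@fourier_const R d)^-1 * (c1 * (I0 / 2) * (m^-1) `^ (2 * b))).
  rewrite mulr_gt0 ?invr_gt0 ?fourier_const_gt0// mulr_gt0 ?powR_gt0 ?invr_gt0//.
  by rewrite mulr_gt0// divr_gt0.
move=> I a z i0 rho rho0 rhoD ai0 zi0.
have limQ := @cvg_gtrig_sqr R d Phi g M Cg cPhi PhiM mg (g_bounded tau_gt g_le) Phi_g I a z.
rewrite -[leLHS]mulrA ler_pdivrMl ?fourier_const_gt0//.
rewrite -(cvg_lim _ limQ)//; apply: limr_ge; first by apply/cvg_ex; eexists; exact: limQ.
pose h := rho / m.
have h0 : 0 < h by rewrite divr_gt0.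
have hH : h <= H by rewrite le_max ler_wpM2r ?invr_ge0 ?(ltW m0)// orbT.
pose K := 2 * \sum_(i | i != i0) `|a i|.
have K0 : 0 <= K by rewrite mulr_ge0// sumr_ge0.
near=> e.
have e0 : 0 < e by near: e; exact: nbhs_right_gt.
have e20 : 0 < e + e by rewrite addr_gt0.
(* [n] is chosen after [e]; the mass and tail bounds used below are uniform in [n]. *)
have [n hn] := @cutoff_seq_decay R d p1 h H e tau h0 hH H1 e0 tau0 tp1.
set S := cos_seq (cutoff_seq p1 n h) in hn.
have S0 w : 0 <= S w := cutoff_seq_ge0 p1 n h w.
have [iF _] := gtrig_sqrE mg (g_bounded tau_gt g_le) a z e0.
have iC (i : I) : mu.-integrable setT (EFin \o (fun w =>
    2 * a i * (cos (dotp w (z i - z i0)) * S w * gauss (e + e) w))).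
  have := integrableZl measurableT (2 * a i)
     (integrable_cos_seq (cutoff_seq p1 n h) (z i - z i0) e20).
  by apply: eq_integrable => // w _ /=; rewrite EFinM.
have [iX EX] := Rintegral_bigsum [seq i <- index_enum I | i != i0] iC.
have iS : mu.-integrable setT (EFin \o (fun w => S w * gauss (e + e) w)).
  exact: integrable_cos_seq0.
have iSX := integrableD measurableT iS iX.
pose k := c1 * h `^ (2 * tau).
have k0 : 0 <= k by rewrite mulr_ge0 ?powR_ge0// ltW.
have ikSX : mu.-integrable setT (EFin \o (fun w => k * (S w * gauss (e + e) w +
    \sum_(i <- [seq i <- index_enum I | i != i0])
      2 * a i * (cos (dotp w (z i - z i0)) * S w * gauss (e + e) w)))).
  have := integrableZl measurableT k iSX.
  by apply: eq_integrable => // w _ /=; rewrite EFinM EFinD.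
have trig_ge w : 1 + \sum_(i <- [seq i <- index_enum I | i != i0])
    2 * a i * cos (dotp w (z i - z i0)) <= trig_sqr a z w.
  rewrite -(trig_sqr_translate a z (z i0)) /trig_sqr (bigD1 i0)//= subrr dotp0r cos0.
  rewrite ai0 mulr1 big_filter.
  under eq_bigr do rewrite -mulrA; rewrite -mulr_sumr.
  set X := \sum_(_ | _) _; set Y := \sum_i _.
  have := sqr_ge0 X; have := sqr_ge0 Y; nra.
have pt w : k * (S w * gauss (e + e) w +
    \sum_(i <- [seq i <- index_enum I | i != i0])
      2 * a i * (cos (dotp w (z i - z i0)) * S w * gauss (e + e) w)) <=
    g w * (trig_sqr a z w * gauss e w).
  apply: (@le_trans _ _ (k * (S w * gauss (e + e) w * trig_sqr a z w))).
    rewrite ler_wpM2l//.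
    have -> : S w * gauss (e + e) w + \sum_(i <- [seq i <- index_enum I | i != i0])
      2 * a i * (cos (dotp w (z i - z i0)) * S w * gauss (e + e) w) =
      S w * gauss (e + e) w * (1 + \sum_(i <- [seq i <- index_enum I | i != i0])
        2 * a i * cos (dotp w (z i - z i0))).
      rewrite mulrDr mulr1 mulr_sumr; congr (_ + _); apply: eq_bigr => i _; ring.
    by rewrite ler_wpM2l// mulr_ge0 ?gauss_ge0.
  (* The parameter [e + e] provides one Gaussian for the decay bound and one for the
     regularisation. *)
  have -> : k * (S w * gauss (e + e) w * trig_sqr a z w) =
     (k * (S w * gauss e w)) * (trig_sqr a z w * gauss e w) by rewrite gaussD; ring.
  rewrite ler_wpM2r ?mulr_ge0 ?trig_sqr_ge0 ?gauss_ge0//.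
  apply: le_trans (g_ge w).
  apply: le_trans (ler_wpM2l k0 (hn w)) _.
  rewrite -sqr_norm2 mulrA ler_wpM2r ?powR_ge0// /k /c1.
  rewrite powRM ?invr_ge0 ?(ltW h0) ?(ltW H0)// -[h^-1]powR_inv1 ?(ltW h0)// -powRrM mulN1r powRN.
  have hp : h `^ (2 * tau) != 0 by rewrite gt_eqF// powR_gt0.
  have Hp : H `^ (2 * tau) != 0 by rewrite gt_eqF// powR_gt0.
  rewrite le_eqVlt; apply/orP; left; apply/eqP.
  by field; rewrite hp Hp expf_neq0.
apply: le_trans (le_Rintegral measurableT ikSX iF (fun w _ => pt w)).
rewrite RintegralZl//.
rewrite RintegralD// EX.
have mass := @cutoff_seq_mass R d p1 n h (e + e) h0 e20.
have tail i : i != i0 -> `|\int[mu]_w (cos (dotp w (z i - z i0)) * S w * gauss (e + e) w)| <=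
    gauss_mass (e + e) ^+ d * expR (- ((e + e)^-1 / 2) * (rho / 2) ^+ 2).
  move=> ii0; apply: Rintegral_cos_seq => //; first by rewrite divr_ge0// ltW.
  apply: le_trans (zi0 i ii0); rewrite [leRHS]splitr lerD2l.
  apply: (le_trans (sum_cutoff_seq _ _ (ltW h0))).
  rewrite /h /m le_eqVlt; apply/orP; left; apply/eqP; field.
  by rewrite !pnatr_eq0 /= -lt0n.
have cross : - (K * (gauss_mass (e + e) ^+ d * expR (- ((e + e)^-1 / 2) * (rho / 2) ^+ 2))) <=
    \sum_(i <- [seq i <- index_enum I | i != i0])
     \int[mu]_w (2 * a i * (cos (dotp w (z i - z i0)) * S w * gauss (e + e) w)).
  rewrite big_filter lerNl -sumrN /K mulrAC mulr_sumr.
  apply: ler_sum => i ii0; rewrite RintegralZl//; last exact: integrable_cos_seq.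
  rewrite (le_trans (ler_norm _))// normrN normrM (normrM 2) ger0_norm// mulrAC.
  rewrite ler_wpM2l ?mulr_ge0//.
  exact: tail.
have hd : h ^- d = h `^ (2 * b) / h `^ (2 * tau).
  rewrite -powR_invn ?(ltW h0)// -powRN -powRD; last by rewrite (gt_eqF h0) implybT.
  by congr (_ `^ _); rewrite /b; field.
have massE : 4^-1 ^+ (d * p1) * (2^-1 ^+ d.+1 * gauss_mass (2 * d.+1%:R * h ^+ 2) ^+ d) =
    I0 * h ^- d.
  rewrite [_ * h ^+ 2]mulrC gauss_massZ// ?mulr_gt0// ?ltr0n// exprMn [h^-1 ^+ d]exprVn /I0.
  by ring.
have hb0 : 0 < h `^ (2 * b) by rewrite powR_gt0.
have ht0 : 0 < h `^ (2 * tau) by rewrite powR_gt0.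
apply: (@le_trans _ _ (k * (I0 * h ^- d / 2))).
  have -> : rho = h * m by rewrite /h divfK// gt_eqF.
  rewrite powRM ?(ltW h0) ?(ltW m0)// hd /k -[m^-1]powR_inv1 ?(ltW m0)// -powRrM mulN1r powRN.
  have mp : m `^ (2 * b) != 0 by rewrite gt_eqF// powR_gt0.
  rewrite le_eqVlt; apply/orP; left; apply/eqP.
  by field; rewrite mp !gt_eqF.
rewrite ler_wpM2l//.
have tail_le : K * (gauss_mass (e + e) ^+ d * expR (- ((e + e)^-1 / 2) * (rho / 2) ^+ 2)) <=
    I0 * h ^- d / 2.
  near: e; apply: near_gauss_tail => //; first by rewrite divr_gt0.
  by rewrite divr_gt0// mulr_gt0// invr_gt0 exprn_gt0.
have : e + e <= 4 * d.+1%:R * h ^+ 2.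
  have : e <= 2 * d.+1%:R * h ^+ 2.
    near: e; apply: nbhs_right_le.
    by rewrite mulr_gt0 ?exprn_gt0// mulr_gt0 ?ltr0n.
  by lra.
move=> /mass; rewrite massE -/S => hm.
by move: cross tail_le hm; lra.
Unshelve. all: end_near. Qed.

End quadratic_lower_bound.

(** * Distances to spans in the native space *)

Section native.
Context {R : realType} {T : eqType} {k : T -> T -> R} (H : native_space k).
Implicit Types (f g h : T -> R) (X : seq T) (x y : T) (a c D : R).
Local Notation dot := (ns_dot H).
Local Notation ns := (ns_set H).

Lemma ns_lin a f g : ns f -> ns g -> ns (fun x => a * f x + g x).
Proof. exact: ns_setP. Qed.

Lemma nsB f g : ns f -> ns g -> ns (f \- g).
Proof.
move=> nf ng; have := ns_lin (-1) ng nf; congr (ns _).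
by apply/funext => x /=; rewrite mulN1r addrC.
Qed.

Lemma dotPl a f g h : ns f -> ns g -> ns h ->
  dot (fun x => a * f x + g x) h = a * dot f h + dot g h.
Proof. exact: ns_dotP. Qed.

Lemma dotPr a f g h : ns f -> ns g -> ns h ->
  dot h (fun x => a * f x + g x) = a * dot h f + dot h g.
Proof.
move=> nf ng nh; rewrite ns_dotC//; last exact: ns_lin.
by rewrite dotPl// !(ns_dotC (n := H) nh).
Qed.

Lemma dotBl f g h : ns f -> ns g -> ns h -> dot (f \- g) h = dot f h - dot g h.
Proof.
move=> nf ng nh; have -> : f \- g = (fun x => -1 * g x + f x).
  by apply/funext => x /=; rewrite mulN1r addrC.
by rewrite dotPl// mulN1r addrC.
Qed.

Lemma dotBr f g h : ns f -> ns g -> ns h -> dot h (f \- g) = dot h f - dot h g.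
Proof.
by move=> nf ng nh; rewrite ns_dotC ?dotBl//; [rewrite !(ns_dotC (n := H) nh)|exact: nsB].
Qed.

Lemma dot_ge0 f : ns f -> 0 <= dot f f.
Proof.
move=> nf; have [->|f0] := pselect (f = cst 0); last exact/ltW/ns_dot_gt0.
have n0 := ns_set0 H; have := dotBl n0 n0 n0.
have -> : (cst 0 \- cst 0 : T -> R) = cst 0 by apply/funext => x /=; rewrite subr0.
by move=> h; rewrite h subrr.
Qed.

Lemma ns_norm_ge0 f : 0 <= ns_norm H f. Proof. exact: sqrtr_ge0. Qed.

Lemma sqr_ns_norm f : ns f -> ns_norm H f ^+ 2 = dot f f.
Proof. by move=> nf; rewrite sqr_sqrtr// dot_ge0. Qed.

Lemma dot_cauchy f g : ns f -> ns g -> dot f g ^+ 2 <= dot f f * dot g g.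
Proof.
move=> nf ng; have [g0|g0] := eqVneq (dot g g) 0.
  have -> : g = cst 0.
    by apply: contrapT => /(ns_dot_gt0 (n := H) ng); rewrite g0 ltxx.
  have n0 := ns_set0 H; have := dotBr n0 n0 nf.
  have -> : (cst 0 \- cst 0 : T -> R) = cst 0 by apply/funext => x /=; rewrite subr0.
  by move=> ->; rewrite subrr expr0n mulr_ge0// dot_ge0.
have g1 : 0 < dot g g by rewrite lt_neqAle eq_sym g0 dot_ge0.
pose t := - (dot f g / dot g g).
have := dot_ge0 (ns_lin t ng nf).
rewrite dotPl// ?dotPr// ?(ns_dotC (n := H) ng nf)//; try exact: ns_lin.
rewrite /t => hh; rewrite -ler_pdivrMr//.
have -> : dot f g ^+ 2 / dot g g = dot f g / dot g g * dot f g by rewrite expr2 mulrAC.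
rewrite -subr_ge0; apply: le_trans hh _; rewrite le_eqVlt; apply/orP; left; apply/eqP.
by field.
Qed.

Lemma ns_norm_lin a f g : ns f -> ns g ->
  ns_norm H (fun x => a * f x + g x) <= `|a| * ns_norm H f + ns_norm H g.
Proof.
move=> nf ng.
have nfg := ns_lin a nf ng.
rewrite -(@ler_pXn2r _ 2)// ?nnegrE ?addr_ge0 ?mulr_ge0 ?ns_norm_ge0//.
rewrite sqr_ns_norm// dotPl// !dotPr// (ns_dotC (n := H) ng nf).
rewrite -(sqr_ns_norm nf) -(sqr_ns_norm ng).
have h : `|dot f g| <= ns_norm H f * ns_norm H g.
  rewrite -(@ler_pXn2r _ 2)// ?nnegrE ?mulr_ge0 ?ns_norm_ge0//.
  by rewrite real_normK ?num_real// exprMn !sqr_ns_norm// dot_cauchy.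
have h2 : a * dot f g <= `|a| * (ns_norm H f * ns_norm H g).
  by rewrite (le_trans (ler_norm _))// normrM ler_wpM2l.
have h3 : `|a| ^+ 2 = a ^+ 2 by rewrite real_normK ?num_real.
rewrite sqrrD exprMn h3.
by move: h2; set u := ns_norm H f; set v := ns_norm H g; set w := dot f g => h2; nra.
Qed.

Lemma nsk x : ns (k ^~ x). Proof. exact: ns_kernel. Qed.

Lemma dotk f x : ns f -> dot f (k ^~ x) = f x.
Proof. exact: ns_reproducing. Qed.

Lemma span_lin X a f g : kernel_span k X f -> kernel_span k X g ->
  kernel_span k X (fun x => a * f x + g x).
Proof.
move=> [u ->] [v ->]; exists (fun x => a * u x + v x); apply/funext => y.
by rewrite mulr_sumr -big_split; apply: eq_bigr => x _ /=; rewrite mulrDl mulrA.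
Qed.

Lemma span0 X : kernel_span k X (cst 0).
Proof.
by exists (cst 0); apply/funext => y; rewrite big1// => x _; rewrite mul0r.
Qed.

Lemma span_min X (S : set (T -> R)) : S (cst 0) ->
  (forall a f g, S f -> S g -> S (fun x => a * f x + g x)) ->
  (forall x, x \in X -> S (k ^~ x)) -> kernel_span k X `<=` S.
Proof.
move=> S0 SL; elim: X => [|x X IH] SX f [a ->].
  by rewrite (_ : (fun y => _) = cst 0)//; apply/funext => y; rewrite big_nil.
rewrite (_ : (fun y => _) = (fun y => a x * k y x + \sum_(z <- X) a z * k y z)); last first.
  by apply/funext => y; rewrite big_cons.
apply: SL; first by apply: SX; rewrite mem_head.
by apply: IH; [move=> z zX; apply: SX; rewrite inE zX orbT|exists a].
Qed.

(** [X] may contain [x] several times, and every occurrence gets the same coefficient; hence the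
    division by the multiplicity [m]. *)
Lemma span_mem X x : x \in X -> kernel_span k X (k ^~ x).
Proof.
move=> xX; pose m : R := (count_mem x X)%:R.
have m0 : m != 0 by rewrite pnatr_eq0 -lt0n -has_count has_pred1.
exists (fun y => (y == x)%:R / m); apply/funext => y.
rewrite (eq_bigr (fun z => if z == x then k y x / m else 0)); last first.
  by move=> z _; case: eqP => [->|_]; rewrite ?mul0r// mul1r mulrC.
by rewrite -big_mkcond big_const_seq iter_addr addr0 -mulr_natr divfK.
Qed.

Lemma span_ns X : kernel_span k X `<=` ns.
Proof.
apply: span_min; [exact: ns_set0|exact: ns_lin|move=> x _; exact: nsk].
Qed.

Lemma span_mono X Y : {subset X <= Y} -> kernel_span k X `<=` kernel_span k Y.
Proof.
move=> XY; apply: span_min; [exact: span0|exact: span_lin|].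
by move=> x /XY; exact: span_mem.
Qed.

(* By the reproducing property, orthogonality to the span means vanishing on
   X, so that projecting is interpolating. *)
Lemma span_orth X f : ns f -> (forall x, x \in X -> f x = 0) ->
  forall v, kernel_span k X v -> dot f v = 0.
Proof.
move=> nf fX v vX; suff [] : ns v /\ dot f v = 0 by [].
move: v vX; apply: span_min.
- split; first exact: ns_set0.
  have n0 := ns_set0 H; have := dotBr n0 n0 nf.
  have -> : (cst 0 \- cst 0 : T -> R) = cst 0 by apply/funext => x /=; rewrite subr0.
  by move=> ->; rewrite subrr.
- move=> a g h [ng g0] [nh h0]; split; first exact: ns_lin.
  by rewrite dotPr// g0 h0 mulr0 addr0.
- by move=> x /fX fx0; split; [exact: nsk|rewrite dotk].
Qed.

(** Newton's scheme: the residual [w] of [k ^~ x] vanishes on [X], and a multiple of it corrects the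
    value at [x]. If [w x = 0], then [w] has norm zero, so [k ^~ x] lies in the span of [X], and
    [f \- p0], orthogonal to that span, already vanishes at [x]. *)
Lemma interpolation X f : ns f ->
  exists2 p, kernel_span k X p & forall x, x \in X -> f x = p x.
Proof.
elim: X f => [|x X IH] f nf; first by exists (cst 0) => //; exact: span0.
have [p0 sp0 fp0] := IH f nf; have [p1 sp1 fp1] := IH _ (nsk x).
have sub : {subset X <= x :: X} by move=> z zX; rewrite inE zX orbT.
have np0 := span_ns sp0; have np1 := span_ns sp1.
pose w := k ^~ x \- p1.
have nw : ns w by apply: nsB => //; exact: nsk.
have wX z : z \in X -> w z = 0 by move=> zX; rewrite /w /= fp1// subrr.
have [wx|wx] := eqVneq (w x) 0.
  have w0 : w = cst 0.
    apply: contrapT => /(ns_dot_gt0 (n := H) nw).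
    rewrite {2}/w dotBr ?dotk ?nsk//; last exact: nsk.
    by rewrite wx (span_orth nw wX sp1) subr0 ltxx.
  exists p0; first exact: span_mono sub _ sp0.
  move=> z; rewrite inE => /orP[/eqP ->|]; last exact: fp0.
  have nfp : ns (f \- p0) by exact: nsB.
  have : dot (f \- p0) (k ^~ x) = 0.
    have -> : k ^~ x = p1.
      by apply/funext => y; apply/eqP; rewrite -subr_eq0 -[_ - _]/(w y) w0.
    apply: span_orth sp1 => // z' z'X /=.
    by rewrite fp0// subrr.
  by rewrite dotk//= => /subr0_eq.
exists (fun z => ((f x - p0 x) / w x) * w z + p0 z).
  apply: span_lin; last exact: span_mono sub _ sp0.
  rewrite (_ : w = fun z => -1 * p1 z + k z x); last first.
    by apply/funext => z; rewrite /w /= mulN1r addrC.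
  apply: span_lin; first exact: span_mono sub _ sp1.
  by apply: span_mem; rewrite mem_head.
move=> z; rewrite inE => /orP[/eqP ->|zX]; first by rewrite divfK// subrK.
by rewrite [w z]wX// mulr0 add0r fp0.
Qed.

(** The interpolant is an orthogonal projection, so that [xget] does not return its default
    value. *)
Lemma ns_projP X f : ns f -> kernel_span k X (ns_proj H X f) /\
  forall v, kernel_span k X v -> dot (f \- ns_proj H X f) v = 0.
Proof.
move=> nf; rewrite /ns_proj.
set A := [set p | _]; suff [p Ap] : exists p, A p by have := xgetPex (cst 0) (ex_intro A p Ap).
have [p sp fp] := interpolation X nf; exists p; split=> // v sv.
apply: span_orth sv; first by apply: nsB => //; exact: span_ns sp.
by move=> x xX /=; rewrite fp// subrr.
Qed.

(** Approximation without reference to a projection: such bounds add up under linear combinations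
    and pass to larger point sets. *)
Definition near_span X f D :=
  ns f /\ exists2 v, kernel_span k X v & ns_norm H (f \- v) <= D.

Lemma near_span_power X x : near_span X (k ^~ x) (power_function H X x).
Proof.
split; first exact: nsk.
by exists (ns_proj H X (k ^~ x)) => //; have [] := ns_projP X (nsk x).
Qed.

(** Pythagoras: the orthogonal projection is the best approximation. *)
Lemma power_le_near X x D : near_span X (k ^~ x) D -> power_function H X x <= D.
Proof.
move=> [_ [v sv]]; apply: le_trans; rewrite /power_function.
have [sp hp] := ns_projP X (nsk x); set p := ns_proj H X _ in sp hp *.
have np := span_ns sp; have nv := span_ns sv.
have n1 := nsB (nsk x) np; have n2 := nsB np nv; have n3 := nsB (nsk x) nv.
rewrite -(@ler_pXn2r _ 2)// ?nnegrE ?ns_norm_ge0// !sqr_ns_norm//.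
have E : k ^~ x \- v = fun y => 1 * (k ^~ x \- p) y + (p \- v) y.
  by apply/funext => y /=; rewrite mul1r addrA subrK.
have s2 : kernel_span k X (p \- v).
  rewrite (_ : p \- v = fun y => -1 * v y + p y); first exact: span_lin.
  by apply/funext => y /=; rewrite mulN1r addrC.
have h0 := hp _ s2; have h0' : dot (p \- v) (k ^~ x \- p) = 0 by rewrite ns_dotC.
rewrite E dotPl//; last exact: ns_lin.
rewrite (dotPr 1 n1 n2 n1) (dotPr 1 n1 n2 n2) h0 h0' !mulr0 add0r addr0 !mul1r lerDl.
exact: dot_ge0.
Qed.

Lemma near_span_mono X Y f D E : {subset X <= Y} -> D <= E ->
  near_span X f D -> near_span Y f E.
Proof.
move=> XY DE [nf [v sv h]]; split=> //; exists v; last exact: le_trans h DE.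
exact: span_mono sv.
Qed.

Lemma near_span_lin X a f g D E : near_span X f D -> near_span X g E ->
  near_span X (fun x => a * f x + g x) (`|a| * D + E).
Proof.
move=> [nf [u su hu]] [ng [v sv hv]]; split; first exact: ns_lin.
exists (fun x => a * u x + v x); first exact: span_lin.
have nu := span_ns su; have nv := span_ns sv.
rewrite (_ : _ \- _ = fun x => a * (f \- u) x + (g \- v) x); last first.
  by apply/funext => x /=; ring.
apply: (le_trans (ns_norm_lin a (nsB nf nu) (nsB ng nv))).
by rewrite lerD// ler_wpM2l.
Qed.

Lemma near_span0 X : near_span X (cst 0) 0.
Proof.
split; first exact: ns_set0.
exists (cst 0); first exact: span0.
have -> : (cst 0 \- cst 0 : T -> R) = cst 0 by apply/funext => x /=; rewrite subr0.
have n0 := ns_set0 H.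
rewrite /ns_norm.
have := dotBr n0 n0 n0.
have -> : (cst 0 \- cst 0 : T -> R) = cst 0 by apply/funext => x /=; rewrite subr0.
by rewrite subrr => ->; rewrite sqrtr0.
Qed.

Lemma near_span_sum X (I : Type) (r : seq I) (c : I -> R) (f : I -> T -> R) (D : I -> R) :
  (forall i, near_span X (f i) (D i)) ->
  near_span X (fun x => \sum_(i <- r) c i * f i x) (\sum_(i <- r) `|c i| * D i).
Proof.
move=> h; elim: r => [|i r IH].
  by rewrite big_nil (_ : (fun x => _) = cst 0); [exact: near_span0|apply/funext => x; rewrite big_nil].
rewrite big_cons (_ : (fun x => _) = fun x => c i * f i x + \sum_(j <- r) c j * f j x).
  exact: near_span_lin.
by apply/funext => x; rewrite big_cons.
Qed.

Lemma near_span_norm X f D : ns f -> ns_norm H f <= D -> near_span X f D.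
Proof.
move=> nf fD; split=> //; exists (cst 0); first exact: span0.
by rewrite (_ : f \- cst 0 = f)//; apply/funext => x /=; rewrite subr0.
Qed.

Definition kernel_comb {I : finType} (a : I -> R) (z : I -> T) : T -> R :=
  fun y => \sum_i a i * k y (z i).

Lemma kernel_comb_ns {I : finType} (a : I -> R) (z : I -> T) : ns (kernel_comb a z).
Proof.
rewrite /kernel_comb; elim: (index_enum I) => [|i r IH].
  rewrite (_ : (fun x => _) = cst 0); first exact: ns_set0.
  by apply/funext => x; rewrite big_nil.
rewrite (_ : (fun x => _) = fun y => a i * k y (z i) + \sum_(i <- r) a i * k y (z i)).
  by apply: ns_lin => //; exact: nsk.
by apply/funext => x; rewrite big_cons.
Qed.

Lemma dot_kernel_comb {I : finType} (a : I -> R) (z : I -> T) f : ns f ->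
  dot f (kernel_comb a z) = \sum_i a i * f (z i).
Proof.
move=> nf; rewrite /kernel_comb.
suff [] : ns (fun y => \sum_(i <- index_enum I) a i * k y (z i)) /\
    dot f (fun y => \sum_(i <- index_enum I) a i * k y (z i)) = \sum_i a i * f (z i) by [].
elim: (index_enum I) => [|i r [IH1 IH2]].
  rewrite (_ : (fun x => _) = cst 0); last by apply/funext => x; rewrite big_nil.
  split; first exact: ns_set0.
  have n0 := ns_set0 H; have := dotBr n0 n0 nf.
  have -> : (cst 0 \- cst 0 : T -> R) = cst 0 by apply/funext => x /=; rewrite subr0.
  by move=> ->; rewrite subrr big_nil.
rewrite (_ : (fun x => _) = fun y => a i * k y (z i) + \sum_(i <- r) a i * k y (z i)); last first.
  by apply/funext => x; rewrite big_cons.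
split; first by apply: ns_lin => //; exact: nsk.
by rewrite dotPr ?dotk//; [rewrite IH2 big_cons|exact: nsk].
Qed.

Lemma sqr_norm_kernel_comb {I : finType} (a : I -> R) (z : I -> T) :
  ns_norm H (kernel_comb a z) ^+ 2 = \sum_i \sum_j a i * a j * k (z i) (z j).
Proof.
have n := kernel_comb_ns a z.
rewrite sqr_ns_norm// dot_kernel_comb//; apply: eq_bigr => i _.
by rewrite mulr_sumr; apply: eq_bigr => j _; rewrite mulrA.
Qed.

End native.

(** * Local polynomial reproduction in cones *)

Section lagrange.
Context {R : realType}.

Lemma horner_le (p : {poly R}) (Z : R) x : `|x| <= Z ->
  `|p.[x]| <= \sum_(i < size p) `|p`_i| * Z ^+ i.
Proof.
move=> xZ; rewrite horner_coef (le_trans (ler_norm_sum _ _ _))//.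
apply: ler_sum => i _; rewrite normrM ler_wpM2l// normrX lerXn2r ?nnegrE//.
exact: le_trans xZ.
Qed.

(** The weights are the values at [x] of the Lagrange basis for the nodes [0, ..., l - 1], hence
    uniformly bounded for [|x| <= Z]. *)
Lemma lagrange_reproduction l (Z : R) : (0 < l)%N -> exists2 B : R, 1 <= B &
  forall x, `|x| <= Z -> exists u : 'I_l -> R, (forall m, `|u m| <= B) /\
    forall n, (n < l)%N -> \sum_m u m * m%:R ^+ n = x ^+ n.
Proof.
move=> l0; pose X (n : nat) : R := n%:R.
have Xinj : injective X by move=> m n /eqP; rewrite eqr_nat => /eqP.
pose L (m : 'I_l) : {poly R} := tnth (qpoly.lagrange l X) m.
exists (1 + \sum_m \sum_(i < size (L m)) `|(L m)`_i| * `|Z| ^+ i).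
  by rewrite lerDl sumr_ge0// => m _; rewrite sumr_ge0// => i _; rewrite mulr_ge0 ?exprn_ge0.
move=> x xZ; exists (fun m => (L m).[x]); split=> [m|n nl].
  rewrite (le_trans (horner_le _ (le_trans xZ (ler_norm Z))))//.
  rewrite (bigD1 m)//= addrCA lerDl addr_ge0// sumr_ge0// => j _.
  by rewrite sumr_ge0// => i _; rewrite mulr_ge0 ?exprn_ge0.
have := @qpoly.lagrange_gen R l X l0 Xinj 'X^n.
rewrite size_polyXn => /(_ nl) /(congr1 (horner^~ x)); rewrite hornerXn => ->.
rewrite horner_sum; apply: eq_bigr => m _.
by rewrite hornerM hornerC hornerXn mulrC.
Qed.

End lagrange.

Section tensor.
Context {R : realType} {d : nat}.
Implicit Types (w z y : 'rV[R]_d).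

(** Expansion over words [f] of length [k]. The exponent of coordinate [i] counts the letters equal
    to [i] and is at most [k], so that for [k < l] the one-dimensional reproduction applies to each
    coordinate. *)
Lemma dotp_expE w y k : dotp w y ^+ k =
  \sum_(f : {ffun 'I_k -> 'I_d}) (\prod_j w ord0 (f j)) *
    \prod_i y ord0 i ^+ #|[pred j | f j == i]|.
Proof.
rewrite -[X in _ ^+ X]card_ord -prodr_const /dotp bigA_distr_bigA.
apply: eq_bigr => f _; rewrite big_split; congr (_ * _) => /=.
rewrite (partition_big f xpredT)//=; apply: eq_bigr => i _.
rewrite -prodr_const; apply: eq_big => [j|j /eqP ->] //.
Qed.

Lemma tensor_reproduction l (Z : R) : (0 < l)%N -> exists2 B : R, 1 <= B &
  forall z, (forall i, `|z ord0 i| <= Z) ->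
  exists u : {ffun 'I_d -> 'I_l} -> R, (forall m, `|u m| <= B) /\
    forall w k, (k < l)%N -> \sum_m u m * dotp w (\row_i (m i)%:R) ^+ k = dotp w z ^+ k.
Proof.
move=> l0; have [B B1 hB] := lagrange_reproduction Z l0.
exists (B ^+ d); first exact: exprn_ege1.
move=> z zZ; have /choice[v hv] : forall i, exists u : 'I_l -> R,
    (forall m, `|u m| <= B) /\
    forall n, (n < l)%N -> \sum_m u m * m%:R ^+ n = z ord0 i ^+ n.
  by move=> i; exact: hB.
exists (fun m => \prod_i v i (m i)); split=> [m|w k kl].
  rewrite normr_prod -[X in _ ^+ X]card_ord -prodr_const.
  by apply: ler_prod => i _; rewrite normr_ge0/=; have [+ _] := hv i; apply.
under eq_bigr do rewrite dotp_expE mulr_sumr.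
rewrite exchange_big dotp_expE; apply: eq_bigr => f _ /=.
under eq_bigr do rewrite mulrCA; rewrite -mulr_sumr; congr (_ * _).
transitivity (\prod_i \sum_m v i m * m%:R ^+ #|[pred j | f j == i]|).
  rewrite bigA_distr_bigA; apply: eq_bigr => m _.
  by rewrite -big_split; apply: eq_bigr => i _; rewrite mxE.
apply: eq_bigr => i _; have [_ ->//] := hv i.
by rewrite (leq_ltn_trans (max_card _))// card_ord.
Qed.

Lemma norm2_le_coord y (B : R) : 0 <= B -> (forall i, `|y ord0 i| <= B) ->
  norm2 y <= d%:R * B.
Proof.
move=> B0 yB; rewrite -(@ler_pXn2r _ 2)// ?nnegrE ?norm2_ge0 ?mulr_ge0// sqr_norm2.
apply: (@le_trans _ _ (\sum_(i < d) B ^+ 2)).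
  apply: ler_sum => i _; rewrite -expr2 -[leLHS]real_normK ?num_real//.
  by rewrite lerXn2r ?nnegrE.
rewrite sumr_const card_ord exprMn -[leLHS]mulr_natl ler_wpM2r ?sqr_ge0//.
by rewrite -natrX ler_nat; case: (d) => // n; rewrite -mulnn leq_pmull.
Qed.

End tensor.

Section cone_approximation.
Context {R : realType} {d : nat}.
Implicit Types (x v xi w : 'rV[R]_d) (theta r t s : R).

Lemma cone_ball x xi theta r t v : 0 < theta < pi / 2 -> norm2 xi = 1 ->
  0 < t -> norm2 v <= (1 - cos theta) / 2 * t -> 2 * t <= r ->
  cone x xi theta r (x + t *: xi + v).
Proof.
move=> /andP[th0 th1] xi1 t0 vt tr.
have c0 : 0 < cos theta.
  apply: cos_gt0_pihalf; rewrite th1 andbT (lt_trans _ th0)// oppr_lt0 divr_gt0//.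
  exact: pi_gt0.
set rho := (1 - cos theta) / 2 in vt.
have c1 : cos theta <= 1 := cos_le1 theta.
have rho0 : 0 <= rho by rewrite /rho; lra.
pose w := t *: xi + v.
have tc : 0 < t * cos theta by rewrite mulr_gt0.
have wxi : t - rho * t <= dotp w xi.
  rewrite dotpDl dotpZl -[dotp xi xi]sqr_norm2 xi1 expr1n mulr1 lerD2l.
  rewrite (le_trans (_ : _ <= - norm2 v)) ?lerN2// lerNl.
  by rewrite (le_trans (ler_norm _))// normrN (le_trans (dotp_abs_le_norm2 _ _))// xi1 mulr1.
have wle : norm2 w <= t + rho * t.
  rewrite (le_trans (ler_norm2D _ _))// lerD// norm2Z xi1 mulr1 ger0_norm// ltW//.
have wpos : 0 < norm2 w.
  have : 0 < dotp w xi by apply: lt_le_trans wxi; rewrite /rho; lra.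
  move=> /lt_le_trans/(_ (dotp_le_norm2 _ _)); rewrite xi1 mulr1//.
exists ((norm2 w)^-1 *: w), (norm2 w); split.
- by rewrite norm2Z ger0_norm ?invr_ge0 ?(ltW wpos)// mulVf// gt_eqF.
- rewrite dotpZl ler_pdivlMl//; apply: le_trans wxi.
  apply: (@le_trans _ _ ((t + rho * t) * cos theta)).
    by rewrite ler_wpM2r// ltW.
  (* [(t - rho * t) - (t + rho * t) * cos theta] equals [t * (1 - cos theta) ^+ 2 / 2]; this is
     where the choice of [rho] comes from. *)
  by have := mulr_ge0 (ltW t0) (sqr_ge0 (1 - cos theta)); rewrite /rho expr2; lra.
- rewrite norm2_ge0/= (le_trans wle)// (le_trans _ tr)// /rho; lra.
- by rewrite scalerA divff ?gt_eqF// scale1r addrA.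
Qed.

(** A grid of mesh [s] is placed in a ball inside the cone at [x0], at a distance of order [s]. The
    same grid serves every point of the cell around [x0]: in grid units their coordinates stay
    within [Z], which keeps the weights bounded. *)
Lemma local_reproduction (Om : set 'rV[R]_d) l : (0 < d)%N -> (0 < l)%N ->
  interior_cone_condition Om -> exists (s0 B C : R), [/\ 0 < s0, 1 <= B, 0 < C &
  forall (x0 : Om) s, 0 < s -> s <= s0 ->
  exists (y : {ffun 'I_d -> 'I_l} -> Om) (c : 'rV[R]_d),
    (forall m, norm2 (val (y m) - c) <= C * s) /\
  forall x : Om, (forall i, `|val x ord0 i - val x0 ord0 i| <= s) ->
  exists u : {ffun 'I_d -> 'I_l} -> R, [/\ forall m, `|u m| <= B,
    norm2 (val x - c) <= C * s &
    forall w k, (k < l)%N ->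
      \sum_m u m * dotp w (val (y m) - c) ^+ k = dotp w (val x - c) ^+ k]].
Proof.
move=> d0 l0 [theta [r [th r0 hcone]]].
have [th0 th1] := andP th.
pose rho := (1 - cos theta) / 2.
have rho0 : 0 < rho.
  rewrite divr_gt0// subr_gt0 lt_neqAle cos_le1 andbT.
  apply/eqP => c1; have := @cos2Dsin2 R theta; rewrite c1 expr1n => h.
  have : 0 < sin theta.
    by apply: sin_gt0_pi; rewrite th0 (lt_trans th1)// ltr_pdivrMr// ltr_pMr ?pi_gt0// ltr1n.
  have : sin theta ^+ 2 = 0 by lra.
  by move=> /eqP; rewrite sqrf_eq0 => /eqP ->; rewrite ltxx.
(* The grid points have norm at most [d * l * s]; [q] makes this the radius [rho * t] of the ball at
   height [t = q * s] in the cone. *)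
pose q : R := d%:R * l%:R / rho.
have q0 : 0 < q by rewrite divr_gt0// mulr_gt0// ltr0n.
pose Z := 1 + q.
have [B B1 hB] := @tensor_reproduction R d l Z l0.
exists (r / (2 * q)), B, (d%:R * (Z + l%:R)); split=> //.
- by rewrite divr_gt0// mulr_gt0.
- by rewrite mulr_gt0 ?ltr0n// addr_gt0 ?ltr0n// addr_gt0.
move=> x0 s sp ss; have [xi xi1 sub] := hcone (val x0) (set_valP x0).
pose t := q * s; have t0 : 0 < t by rewrite mulr_gt0.
have tr : 2 * t <= r.
  have q20 : 0 < 2 * q by rewrite mulr_gt0.
  by rewrite ler_pdivlMr// in ss; rewrite /t; lra.
pose c := val x0 + t *: xi.
pose node (m : {ffun 'I_d -> 'I_l}) : 'rV[R]_d := \row_i (m i)%:R.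
have nodel m : norm2 (s *: node m) <= d%:R * l%:R * s.
  rewrite norm2Z (gtr0_norm sp) mulrC ler_wpM2r ?(ltW sp)// norm2_le_coord// => i.
  by rewrite mxE ger0_norm// ler_nat ltnW.
have inOm m : (c + s *: node m) \in Om.
  rewrite inE; apply: sub; apply: cone_ball => //.
  apply: (le_trans (nodel m)); rewrite -/rho.
  by have -> : rho * t = d%:R * l%:R * s by rewrite /t /q; field; rewrite gt_eqF.
pose y m : Om := SigSub (inOm m).
have yE m : val (y m) - c = s *: node m by rewrite /= addrC addKr.
exists y, c; split=> [m|x xx0].
  rewrite yE (le_trans (nodel m))// ler_wpM2r ?(ltW sp)// ler_wpM2l//.
  by rewrite lerDr /Z addr_ge0 ?ltW.
pose z := s^-1 *: (val x - c).
have zZ i : `|z ord0 i| <= Z.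
  rewrite mxE normrM normfV (gtr0_norm sp) ler_pdivrMl// !mxE opprD addrA.
  rewrite (le_trans (ler_normB _ _))// mulrDr mulr1 lerD//.
  rewrite normrM (gtr0_norm t0) [leRHS]mulrC -/t ler_piMr ?(ltW t0)//.
  by rewrite -xi1 coord_le_norm2.
have [u [uB hu]] := hB z zZ; exists u; split=> //.
- have -> : val x - c = s *: z by rewrite scalerA divff ?gt_eqF// scale1r.
  rewrite norm2Z (gtr0_norm sp) mulrC ler_wpM2r ?(ltW sp)//.
  have Z0 : 0 <= Z by rewrite addr_ge0// ltW.
  by rewrite (le_trans (norm2_le_coord Z0 zZ))// ler_wpM2l// lerDl.
- move=> w k kl.
  have -> : val x - c = s *: z by rewrite scalerA divff ?gt_eqF// scale1r.
  rewrite dotpZr exprMn -hu// mulr_sumr; apply: eq_bigr => m _.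
  by rewrite yE dotpZr exprMn mulrCA.
Qed.

End cone_approximation.

(** * Counting selected points in a cell *)

Section det_row_replace.
Context {F : fieldType} {n : nat}.

Definition row_replace (U : 'M[F]_n) (j : 'I_n) (u : 'rV[F]_n) : 'M[F]_n :=
  \matrix_(a, b) if a == j then u ord0 b else U a b.

(** Cramer's rule, by expansion along row [j] and the adjugate. *)
Lemma det_row_replace (U : 'M[F]_n) j (c : 'rV[F]_n) :
  \det (row_replace U j (c *m U)) = c ord0 j * \det U.
Proof.
have h : \det (row_replace U j (c *m U)) = (c *m U *m \adj U) ord0 j.
  rewrite (expand_det_row _ j) [RHS]mxE; apply: eq_bigr => b _.
  rewrite mxE eqxx; congr (_ * _); rewrite [RHS]mxE /cofactor; congr (_ * \det _).
  by apply/matrixP => a e; rewrite !mxE eq_sym (negbTE (neq_lift _ _)).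
by rewrite h -mulmxA mul_mx_adj mul_mx_scalar mxE mulrC.
Qed.

End det_row_replace.

Lemma det_le {R : realFieldType} n (U : 'M[R]_n) (B : R) :
  (forall a b, `|U a b| <= B) -> `|\det U| <= n`!%:R * B ^+ n.
Proof.
move=> UB; rewrite /determinant (le_trans (ler_norm_sum _ _ _))//.
have -> : n`! = #|{perm 'I_n}|.
  rewrite -[in LHS](card_ord n) -cardsT -card_perm; apply: eq_card => s.
  by rewrite [RHS]inE [LHS]unfold_in; apply/fintype.subsetP => i _; rewrite finset.in_setT.
rewrite -sum1_card natr_sum mulr_suml; apply: ler_sum => s _.
rewrite mul1r normrM normrX normrN1 expr1n mul1r normr_prod.
rewrite -[X in _ ^+ X]card_ord -prodr_const; apply: ler_prod => i _.
by rewrite normr_ge0 UB.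
Qed.

Section cluster.
Context {R : realType} {T : eqType} {k : T -> T -> R} (H : native_space k).
Variables (x : nat -> T) (N : nat) (n : nat) (y : 'I_n -> T) (cell : pred nat).
Variables (B D W : R).
Hypotheses (D0 : 0 < D) (DW : D <= W) (B1 : 1 <= B).
Hypothesis power_y : forall l, power_function H (mkseq x N) (y l) <= W.

Let comb (u : 'rV[R]_n) : T -> R := kernel_comb (k := k) (fun l => u ord0 l) y.

(* Each chosen point enlarges the volume spanned by the coefficient rows by a
   factor 2: otherwise it would be a combination, with coefficients bounded by
   2, of rows that are D-close to the span of the points already chosen. *)
Lemma cluster_volume M :
  (forall i, (i < M)%N -> cell i ->
     exists2 u : 'rV[R]_n, (forall l, `|u ord0 l| <= B) &
       ns_norm H (comb u \- k ^~ (x (N + i)%N)) <= D) ->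
  (forall i, (i < M)%N -> cell i ->
     (2 * n).+1%:R * D < power_function H (mkseq x (N + i)) (x (N + i)%N)) ->
  exists U : 'M[R]_n, [/\ 2 ^+ (\sum_(i < M) cell i) * (D / W) ^+ n <= `|\det U|,
    forall a b, `|U a b| <= B &
    forall a, near_span H (mkseq x (N + M)) (comb (row a U)) D].
Proof.
have W0 : 0 < W by apply: lt_le_trans DW.
elim: M => [|M IH] h2 h3.
  (* The initial rows are the node translates scaled by [D / W]: residuals of at most [W] become at
     most [D]. *)
  exists ((D / W)%:M); split.
  - rewrite big_ord0 expr0 mul1r det_scalar ger0_norm// exprn_ge0// divr_ge0 ?(ltW D0) ?(ltW W0)//.
  - move=> a b; rewrite mxE; case: (a == b); rewrite ?mulr0n ?mulr1n.
      rewrite ger0_norm ?divr_ge0 ?(ltW D0) ?(ltW W0)// (le_trans _ B1)// ler_pdivrMr// mul1r//.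
    by rewrite normr0 (le_trans _ B1).
  - move=> a; rewrite addn0.
    have := near_span_lin (D / W) (near_span_power H (mkseq x N) (y a)) (near_span0 H _).
    have -> : (fun z => D / W * k z (y a) + cst 0 z) = comb (row a (D / W)%:M).
      apply/funext => z; rewrite addr0 /comb /kernel_comb (bigD1 a)//= big1 => [|l la].
        by rewrite !mxE eqxx mulr1n addr0.
      by rewrite !mxE eq_sym (negbTE la) mulr0n mul0r.
    apply: near_span_mono => //; rewrite addr0 ger0_norm ?divr_ge0 ?(ltW D0) ?(ltW W0)//.
    apply: (@le_trans _ _ (D / W * W)); last by rewrite divfK// gt_eqF.
    by rewrite ler_wpM2l// divr_ge0 ?(ltW D0) ?(ltW W0).
have [||U [dU UB Unear]] := IH.
- by move=> i iM; apply: h2; rewrite ltnS ltnW.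
- by move=> i iM; apply: h3; rewrite ltnS ltnW.
have sub : {subset mkseq x (N + M) <= mkseq x (N + M.+1)}.
  move=> z /mapP[i]; rewrite mem_iota => /andP[_ iM] ->.
  by apply: map_f; rewrite mem_iota/= addnS ltnS ltnW.
rewrite big_ord_recr /=.
have [cM|cM] := boolP (cell M); last first.
  exists U; split=> //; first by rewrite addn0.
  by move=> a; exact: near_span_mono sub (lexx _) (Unear a).
have [u uB hu] := h2 M (ltnSn M) cM; have P := h3 M (ltnSn M) cM.
have U0 : \det U != 0.
  rewrite -normr_gt0; apply: lt_le_trans dU.
  by rewrite mulr_gt0// exprn_gt0// divr_gt0.
pose c := u *m invmx U.
have uc : u = c *m U by rewrite mulmxKV// unitmxE unitfE.
have combE : comb u = fun z => \sum_j c ord0 j * comb (row j U) z.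
  apply/funext => z; rewrite /comb /kernel_comb.
  under [RHS]eq_bigr do rewrite mulr_sumr.
  rewrite exchange_big; apply: eq_bigr => l _ /=.
  by rewrite uc mxE mulr_suml; apply: eq_bigr => j _; rewrite [row _ _ _ _]mxE mulrA.
have ncu := kernel_comb_ns H (fun l => u ord0 l) y.
have nkx := nsk H (x (N + M)%N).
have [/forallP small|/forallPn[j]] := boolP [forall j, `|c ord0 j| <= 2].
  exfalso; move: P; apply/negP; rewrite -leNgt; apply: power_le_near.
  have h4 := near_span_sum (index_enum 'I_n) (fun j => c ord0 j) Unear.
  have h5 := near_span_norm (mkseq x (N + M)) (nsB ncu nkx) hu.
  have := near_span_lin (-1) h5 h4.
  have -> : (fun z => -1 * (comb u \- k^~ (x (N + M)%N)) z +
      \sum_j c ord0 j * comb (row j U) z) = k ^~ (x (N + M)%N).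
    by apply/funext => z; rewrite /= combE; ring.
  apply: near_span_mono => //; rewrite normrN1 mul1r -mulr_suml -natr1 mulrDl mul1r.
  rewrite [leLHS]addrC lerD2r ler_wpM2r ?(ltW D0)//.
  apply: (@le_trans _ _ (\sum_(i < n) 2)); first exact: ler_sum.
  by rewrite sumr_const card_ord natrM mulr_natr.
rewrite -ltNge => cj; exists (row_replace U j u); split.
- rewrite uc det_row_replace normrM exprD expr1 mulrAC.
  rewrite [leLHS]mulrC ler_pM ?(ltW cj)// mulr_ge0 ?exprn_ge0 ?divr_ge0 ?(ltW D0) ?(ltW W0)//.
- by move=> a b; rewrite mxE; case: ifP.
- move=> a; have [->|aj] := eqVneq a j.
    have -> : row j (row_replace U j u) = u.
      by apply/rowP => b; rewrite !mxE eqxx.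
    split; first exact: kernel_comb_ns.
    exists (k ^~ (x (N + M)%N)) => //; apply: span_mem; apply: map_f.
    by rewrite mem_iota/= addnS ltnSn.
  have -> : row a (row_replace U j u) = row a U.
    by apply/rowP => b; rewrite !mxE (negbTE aj).
  exact: near_span_mono sub (lexx _) (Unear a).
Qed.

(** The rows keep entries of size at most [B], so the determinant cannot exceed [n! B^n] however
    often it is doubled. *)
Lemma cluster_count M :
  (forall i, (i < M)%N -> cell i ->
     exists2 u : 'rV[R]_n, (forall l, `|u ord0 l| <= B) &
       ns_norm H (comb u \- k ^~ (x (N + i)%N)) <= D) ->
  (forall i, (i < M)%N -> cell i ->
     (2 * n).+1%:R * D < power_function H (mkseq x (N + i)) (x (N + i)%N)) ->
  2 ^+ (\sum_(i < M) cell i) <= n`!%:R * (B * (W / D)) ^+ n.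
Proof.
move=> h2 h3; have [U [dU UB _]] := cluster_volume h2 h3.
have W0 : 0 < W by apply: lt_le_trans DW.
have DW0 : 0 < (D / W) ^+ n by rewrite exprn_gt0// divr_gt0.
rewrite -(ler_pM2r DW0) (le_trans dU)// (le_trans (det_le UB))//.
rewrite -mulrA -exprMn le_eqVlt; apply/orP; left; apply/eqP; congr (_ * _ ^+ _).
by field; rewrite !gt_eqF.
Qed.

End cluster.

Lemma ler_ereal_sup_range {R : realType} {T : Type} (f : T -> R) (c v : R) (y : T) :
  (c%:E * ereal_sup (range (fun y => (f y)%:E)) <= v%:E)%E -> 0 < c -> c * f y <= v.
Proof.
move=> h c0; rewrite -lee_fin EFinM (le_trans _ h)// lee_wpmul2l//.
  by rewrite lee_fin ltW.
by apply: ereal_sup_ubound; exists y.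
Qed.

Lemma sum_option {V : nmodType} {I : finType} (F : option I -> V) :
  \sum_i F i = F None + \sum_j F (Some j).
Proof.
rewrite (bigD1 None)//=; congr (_ + _).
rewrite (reindex_omap Some id) /=; last by case.
by apply: eq_bigl => j; rewrite eqxx.
Qed.

(** * Rate of the power function *)

Section greedy.
Context {R : realType} {d : nat} {Om : set 'rV[R]_d} {k : Om -> Om -> R}.
Variables (H : native_space k) (Phi g : 'rV[R]_d -> R) (M cg Cg tau : R).
Hypotheses (d_gt0 : (0 < d)%N) (tau_gt : d%:R / 2 < tau).
Hypotheses (k_Phi : translation_invariant k Phi).
Hypotheses (cPhi : continuous Phi) (PhiM : forall x, `|Phi x| <= M).
Hypotheses (mg : measurable_fun setT g) (Phi_g : is_fourier_transform Phi g).
Hypothesis cg0 : 0 < cg.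
Hypothesis g_bnd : forall w, cg * (1 + norm2 w ^+ 2) `^ (- tau) <= g w
  <= Cg * (1 + norm2 w ^+ 2) `^ (- tau).
Hypotheses (Om_compact : compact Om) (Om_cone : interior_cone_condition Om).
Let b := tau - d%:R / 2.
Let alpha := b / d%:R.

Let b0 : 0 < b. Proof. by rewrite subr_gt0. Qed.

Let alpha0 : 0 < alpha. Proof. by rewrite divr_gt0// ltr0n. Qed.

Let g_ge w : cg * (1 + norm2 w ^+ 2) `^ (- tau) <= g w.
Proof. by have /andP[] := g_bnd w. Qed.

Let g_le w : 0 <= g w <= Cg * (1 + norm2 w ^+ 2) `^ (- tau).
Proof.
have /andP[h ->] := g_bnd w; rewrite andbT (le_trans _ h)//.
by rewrite mulr_ge0 ?powR_ge0// ltW.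
Qed.

Lemma compact_coord_bounded : exists2 r : R, 0 < r & forall (x : Om) i, `|val x ord0 i| <= r.
Proof.
have [r [_ hr]] := compact_bounded Om_compact.
have r0 : 0 < `|r| + 1 by rewrite ltr_wpDl.
exists (`|r| + 1) => // x i.
have h : `|val x| <= `|r| + 1.
  apply: hr; last exact: set_valP.
  by rewrite (le_lt_trans (ler_norm _))// ltrDl.
apply: le_trans h; rewrite [leRHS]mx_normrE.
exact: (le_bigmax _ (fun ij => `|val x ij.1 ij.2|) (ord0, i)).
Qed.

Local Notation Pw := (power_function H).

Lemma power_bounded X y : Pw X y <= Num.sqrt M.
Proof.
apply: power_le_near; apply: near_span_norm; first exact: nsk.
rewrite /ns_norm dotk; last exact: nsk.
by apply: ler_wsqrtr; rewrite k_Phi (le_trans (ler_norm _)).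
Qed.

Lemma power_anti X Y y : {subset X <= Y} -> Pw Y y <= Pw X y.
Proof.
move=> XY; apply: power_le_near.
exact: near_span_mono XY (lexx _) (near_span_power H X y).
Qed.

(** The residual is a kernel combination with coefficient 1 at [y], the index [None], whatever the
    coefficients of the projection are. *)
Lemma power_lower (D : R) : exists2 c : R, 0 < c & forall (X : seq Om) (y : Om) (rho : R),
  0 < rho -> rho <= D -> (forall z, z \in X -> rho <= norm2 (val z - val y)) ->
  c * rho `^ b <= Pw X y.
Proof.
have [c c0 hc] := @quadratic_form_lower R d Phi g M cg Cg tau cPhi PhiM mg Phi_g
  d_gt0 tau_gt cg0 g_ge g_le D.
exists (Num.sqrt c); first by rewrite sqrtr_gt0.
move=> X y rho rho0 rhoD Xy.
have [[a pE] _] := ns_projP X (nsk H y).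
pose w (i : option 'I_(size X)) : R := if i is Some j then - a (tnth (in_tuple X) j) else 1.
pose z (i : option 'I_(size X)) : Om := if i is Some j then tnth (in_tuple X) j else y.
have E : k ^~ y \- ns_proj H X (k ^~ y) = kernel_comb (k := k) w z.
  apply/funext => t; rewrite /kernel_comb sum_option /= mul1r pE; congr (_ + _).
  rewrite (big_tnth _ _ X) -sumrN; apply: eq_bigr => j _.
  by rewrite mulNr.
rewrite /power_function E.
rewrite -(@ler_pXn2r _ 2)// ?nnegrE ?ns_norm_ge0 ?mulr_ge0 ?sqrtr_ge0 ?powR_ge0//.
rewrite sqr_norm_kernel_comb exprMn sqr_sqrtr ?(ltW c0)// -powR_mulrn ?powR_ge0// -powRrM.
under eq_bigr do under eq_bigr do rewrite k_Phi.
rewrite mulrC (mulrC b) mulrC.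
apply: (hc _ w (fun i => val (z i)) None) => // -[j _|] //=.
by apply: Xy; rewrite mem_tnth.
Qed.

(** The functional with weights [u] at the nodes and -1 at [x] annihilates polynomials of degree
    below [l]; the quadratic form gives its norm. *)
Lemma power_upper : exists n (s0 B C : R), [/\ 0 < s0, 1 <= B, 0 < C &
  forall (x0 : Om) s, 0 < s -> s <= s0 -> exists y : 'I_n -> Om,
  forall x : Om, (forall i, `|val x ord0 i - val x0 ord0 i| <= s) ->
  exists2 u : 'rV[R]_n, (forall l, `|u ord0 l| <= B) &
    ns_norm H (kernel_comb (k := k) (fun l => u ord0 l) y \- k ^~ x) <= C * s `^ b].
Proof.
have [l bl] : exists l : nat, b + 1 <= l%:R.
  by near \oo => l; exists l; near: l; exact: nbhs_infty_ger.
have l0 : (0 < l)%N.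
  by rewrite lt0n; apply: contraTneq bl => ->; rewrite -ltNge ltr_wpDl ?ltr01// ltW.
have [C C0 hC] := @quadratic_form_upper R d Phi g M Cg tau cPhi PhiM mg Phi_g
  tau_gt g_le l bl.
have [s0 [B [C1 [s00 B1 C10 hloc]]]] := local_reproduction d_gt0 l0 Om_cone.
pose J := {ffun 'I_d -> 'I_l}.
pose L : R := 1 + #|J|%:R * B.
have L0 : 0 <= L by rewrite addr_ge0// mulr_ge0// (le_trans _ B1).
exists #|J|, s0, B, (Num.sqrt (C * L ^+ 2 * C1 `^ (2 * b))); split=> //.
  have L1 : 0 < L by rewrite ltr_wpDr// mulr_ge0// (le_trans _ B1).
  by rewrite sqrtr_gt0 mulr_gt0 ?powR_gt0// mulr_gt0// exprn_gt0.
move=> x0 s sp ss; have [y [c [yc hy]]] := hloc x0 s sp ss.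
exists (fun i => y (enum_val i)) => x xx0; have [u [uB xc mom]] := hy x xx0.
exists (\row_i u (enum_val i)); first by move=> i; rewrite mxE.
pose w (i : option J) : R := if i is Some j then u j else -1.
pose z (i : option J) : Om := if i is Some j then y j else x.
rewrite (_ : _ \- _ = kernel_comb (k := k) w z); last first.
  apply/funext => t; rewrite /kernel_comb sum_option /= mulN1r addrC; congr (_ + _).
  rewrite [RHS](reindex_onto (@enum_val J (pred_of_simpl predT)) enum_rank) /=; last first.
    by move=> j _; exact: enum_rankK.
  by apply: eq_big => [i|i _]; rewrite ?mxE// enum_valK eqxx.
rewrite -(@ler_pXn2r _ 2)// ?nnegrE ?ns_norm_ge0 ?mulr_ge0 ?sqrtr_ge0 ?powR_ge0//.
rewrite sqr_norm_kernel_comb exprMn sqr_sqrtr; last first.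
  by rewrite mulr_ge0 ?powR_ge0// mulr_ge0 ?sqr_ge0// ltW.
rewrite -[(s `^ b) ^+ 2]powR_mulrn ?powR_ge0// -powRrM (mulrC b) -[leRHS]mulrA.
rewrite -powRM ?(ltW C10) ?(ltW sp)//.
under eq_bigr do under eq_bigr do rewrite k_Phi.
apply: (hC _ w (fun i => val (z i)) c) => //.
- exact: mulr_gt0.
- rewrite sum_option /= normrN1 lerD2l.
  apply: (@le_trans _ _ (\sum_(j : J) B)); first exact: ler_sum.
  by rewrite sumr_const -[leLHS]mulr_natl.
- by case.
- move=> v m ml; rewrite sum_option /= mom// mulN1r addNr//.
Unshelve. all: end_near. Qed.

Lemma mkseq_sub (x : nat -> Om) m n : (m <= n)%N -> {subset mkseq x m <= mkseq x n}.
Proof.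
move=> mn z /mapP[i]; rewrite mem_iota => /andP[_ im] ->.
by apply: map_f; rewrite mem_iota/= (leq_trans im).
Qed.

(** [m] is one more than an integer part; the summand [s0] absorbs this unit because [s <= s0]. *)
Lemma grid_cells : exists2 C : R, 0 < C & forall s0 s : R, 0 < s -> s <= s0 ->
  exists m (cell : Om -> {ffun 'I_d -> 'I_m}), m%:R <= (C + s0) / s /\
  forall x y, cell x = cell y -> forall i, `|val x ord0 i - val y ord0 i| <= s.
Proof.
have [r r0 hr] := compact_coord_bounded; exists (2 * r); first by rewrite mulr_gt0.
move=> s0 s sp ss.
pose q (x : Om) i : R := (val x ord0 i + r) / s.
have q0 x i : 0 <= q x i.
  by rewrite divr_ge0 ?(ltW sp)//; have := hr x i; rewrite ler_norml; lra.
pose m := (Num.truncn (2 * r / s)).+1.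
have qm x i : (Num.truncn (q x i) < m)%N.
  rewrite ltnS; apply: le_truncn; rewrite ler_wpM2r ?invr_ge0 ?(ltW sp)//.
  by have := hr x i; rewrite ler_norml; lra.
exists m, (fun x => [ffun i => Ordinal (qm x i)]); split=> [|x y xy i].
  have h : (Num.truncn (2 * r / s))%:R <= 2 * r / s.
    by rewrite truncn_le ?divr_ge0 ?mulr_ge0 ?(ltW r0) ?(ltW sp).
  rewrite mulrDl /m -natr1 lerD// ler_pdivlMr// mul1r//.
have : Num.truncn (q x i) = Num.truncn (q y i).
  by move/ffunP : xy => /(_ i); rewrite !ffunE => /(congr1 val).
have /andP[x1 x2] := truncn_itv (q0 x i); have /andP[y1 y2] := truncn_itv (q0 y i).
move=> E; rewrite E in x1 x2.
have : `|q x i - q y i| <= 1.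
  by rewrite -natr1 in x2 y2; rewrite ler_norml; apply/andP; split; lra.
have -> : q x i - q y i = (val x ord0 i - val y ord0 i) / s by rewrite /q; field; rewrite gt_eqF.
by rewrite normrM normfV (gtr0_norm sp) ler_pdivrMr// mul1r.
Qed.

(** Logarithms bound [m] linearly in [ln ga^-1], and [ln G < G] at [G = ga^(-1/alpha)] turns the
    logarithm into a power that costs exactly one factor [ga^-1] in the rate. *)
Lemma pow2_bound (K ga : R) (n m : nat) : 1 <= K -> 0 < ga -> ga <= 1 ->
  2 ^+ m <= K * (ga^-1) ^+ n ->
  m%:R <= (ln K + n%:R * alpha) / ln 2 * ga `^ (- alpha^-1).
Proof.
move=> K1 ga0 ga1 h.
have K0 : 0 < K := lt_le_trans ltr01 K1.
have l2 : 0 < ln 2 :> R by rewrite ln_gt0// ltr1n.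
have h1 : ln 2 * m%:R <= ln K + n%:R * ln (ga^-1).
  have gi0 : 0 < ga^-1 by rewrite invr_gt0.
  have gn0 : 0 < ga^-1 ^+ n by rewrite exprn_gt0.
  have : ln (2 ^+ m) <= ln (K * ga^-1 ^+ n) by rewrite ler_ln ?posrE ?exprn_gt0// mulr_gt0.
  rewrite lnM ?posrE//.
  by rewrite (lnXn _ gi0) (lnXn _ (ltr0Sn R 1)) -[ln 2 *+ m]mulr_natr -[_ *+ n]mulr_natl.
set G := ga `^ (- alpha^-1).
have G1 : 1 <= G.
  rewrite /G powRN -powR_inv1 ?powR_ge0// -powRrM mulrC powRrM powR_inv1 ?(ltW ga0)//.
  rewrite -[leLHS](@powRr0 _ (ga^-1)) ler_powR// ?invr_ge0 ?(ltW alpha0)//.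
  by rewrite invr_ge1 ?unitfE ?gt_eqF.
have h2 : ln (ga^-1) <= alpha * G.
  have -> : ln (ga^-1) = alpha * ln G.
    rewrite /G ln_powR lnV ?posrE// mulrA mulrN divff ?gt_eqF// mulN1r//.
  rewrite ler_wpM2l ?(ltW alpha0)// ltW// ln_sublinear// (lt_le_trans ltr01)//.
rewrite mulrAC ler_pdivlMr// [leLHS]mulrC (le_trans h1)// mulrDl lerD//.
  by rewrite ler_peMr// ln_ge0.
by rewrite -mulrA ler_wpM2l.
Qed.

Definition stable_points (gamma : R) (x : nat -> Om) :=
  forall N y, gamma * Pw (mkseq x N) y <= Pw (mkseq x N) (x N).

Lemma power_rate : exists2 A : R, 0 < A & forall (gamma : R) (x : nat -> Om),
  0 < gamma <= 1 -> stable_points gamma x -> forall (p : nat) y,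
  Pw (mkseq x (2 ^ p)) y <= A * gamma `^ (-2) * (2 ^ p)%:R `^ (- alpha).
Proof.
have [n [s0 [B [C [s00 B1 C0 hup]]]]] := power_upper.
have [Cg' Cg'0 hgrid] := grid_cells.
pose Bk := Num.sqrt M + 1.
have Bk0 : 0 < Bk by rewrite ltr_wpDl ?sqrtr_ge0.
(* The second summand forces the mesh [s] below [s0], since [D] turns out to be at most [Bk]. *)
pose C1 := C + Bk / s0 `^ b.
have C10 : 0 < C1 by rewrite addr_gt0// divr_gt0// powR_gt0.
pose n1 : R := (2 * n).+1%:R.
have n10 : 0 < n1 by rewrite ltr0n.
pose K1 := n`!%:R * (B * (n1 * 2 `^ alpha)) ^+ n.
have a2 : 1 <= 2 `^ alpha :> R.
  by rewrite -[leLHS](@powRr0 _ 2) ler_powR ?ler1n// ltW.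
have K11 : 1 <= K1.
  rewrite mulr_ege1 ?ler1n ?fact_gt0// exprn_ege1// mulr_ege1// mulr_ege1// ler1n//.
pose K2 := (ln K1 + n%:R * alpha) / ln 2.
have l2 : 0 < ln 2 :> R by rewrite ln_gt0// ltr1n.
have K20 : 0 <= K2.
  by rewrite divr_ge0 ?(ltW l2)// addr_ge0 ?ln_ge0// mulr_ge0// ltW.
pose E := (Cg' + s0) ^+ d * (C1 * n1) `^ (alpha^-1) * 2 * K2.
have E0 : 0 <= E.
  rewrite mulr_ge0// mulr_ge0// mulr_ge0 ?powR_ge0// exprn_ge0//.
  by rewrite addr_ge0 ?(ltW Cg'0) ?(ltW s00).
(* [Bk] settles the case [p = 0]; the other summand gives [E < A^(1/alpha)], which contradicts the
   final count. *)
pose A := Bk + (E + 1) `^ alpha.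
have EA : (E + 1) `^ alpha <= A by rewrite lerDr ltW.
have A0 : 0 < A by rewrite ltr_pwDl// powR_ge0.
exists A => // gamma x /andP[g0 g1] stab.
pose zeta p : R := A * gamma `^ (-2) * (2 ^ p)%:R `^ (- alpha).
have zeta0 p : 0 < zeta p by rewrite !mulr_gt0 ?powR_gt0// ltr0n expn_gt0.
elim=> [|p IH] y.
  apply: (le_trans (power_bounded _ _)); rewrite expn0 powR1 mulr1.
  apply: (@le_trans _ _ A); first by rewrite /A /Bk -addrA lerDl addr_ge0 ?powR_ge0.
  rewrite ler_peMr ?(ltW A0)// powRN invf_ge1 ?powR_gt0//.
  by rewrite -[leRHS](@powRr0 _ gamma); apply: ger_powR; rewrite ?g0.
rewrite -/(zeta p.+1) leNgt; apply/negP => py.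
pose N := (2 ^ p)%N.
have N0 : (0 < N)%N by rewrite expn_gt0.
have zetaS : zeta p = 2 `^ alpha * zeta p.+1.
  rewrite /zeta expnS natrM powRM// mulrCA; congr (_ * _).
  by rewrite mulrA [2 `^ (- alpha)]powRN divff ?mul1r// gt_eqF// powR_gt0.
(* [n1 * D] is the threshold for selected points, and [zeta p / D = n1 * 2^alpha / gamma] does not
   depend on [p]. *)
pose D := gamma * zeta p.+1 / n1.
have D0 : 0 < D by rewrite divr_gt0// mulr_gt0.
have selected i : (i < N)%N -> n1 * D < Pw (mkseq x (N + i)) (x (N + i)%N).
  move=> iN; rewrite /D mulrC divfK ?gt_eqF//.
  apply: lt_le_trans (stab (N + i)%N y); rewrite ltr_pM2l//.
  apply: (lt_le_trans py); apply: power_anti; apply: mkseq_sub.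
  by rewrite expnS mul2n -addnn leq_add2l ltnW.
have DW : D <= zeta p.
  rewrite zetaS /D ler_pdivrMr// mulrAC ler_wpM2r ?(ltW (zeta0 _))//.
  by rewrite (le_trans g1)// mulr_ege1// ler1n.
pose s := (D / C1) `^ b^-1.
have sp : 0 < s by rewrite powR_gt0// divr_gt0.
have sb : s `^ b = D / C1.
  by rewrite /s -powRrM mulVf ?gt_eqF// powRr1// divr_ge0 ?(ltW D0) ?(ltW C10).
have DBk : D <= Bk.
  have n1D : D <= n1 * D by rewrite ler_peMl ?(ltW D0)// ler1n.
  apply: (le_trans n1D); apply: (le_trans (ltW (selected 0%N N0))).
  by apply: (le_trans (power_bounded _ _)); rewrite lerDl.
have ss : s <= s0.
  rewrite leNgt; apply/negP => s0s.
  have := @gt0_ltr_powR R b b0 s0 s; rewrite !nnegrE (ltW s00) (ltW sp).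
  move=> /(_ isT isT s0s); rewrite sb ltr_pdivlMr//.
  apply/negP; rewrite -leNgt (le_trans DBk)// /C1 mulrDr.
  rewrite [X in _ <= _ + X]mulrC divfK ?lerDr ?mulr_ge0 ?powR_ge0 ?(ltW C0)//.
  by rewrite gt_eqF// powR_gt0.
have [m [cell [mle hcell]]] := hgrid s0 s sp ss.
have KG0 : 0 <= K2 * gamma `^ (- alpha^-1).
  by apply: mulr_ge0; [exact: K20|exact: powR_ge0].
have count_le (t : {ffun 'I_d -> 'I_m}) :
    (\sum_(i < N) (cell (x (N + i)%N) == t))%:R <= K2 * gamma `^ (- alpha^-1).
  have [i0 /eqP ci0|none] := pickP (fun i : 'I_N => cell (x (N + i)%N) == t); last first.
    by rewrite big1 => [|i _]; rewrite ?KG0// none.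
  have [yn hyn] := hup (x (N + i0)%N) s sp ss.
  apply: pow2_bound => //.
  have yW l : power_function H (mkseq x N) (yn l) <= zeta p by exact: IH.
  have := @cluster_count R Om k H x N n yn (fun i => cell (x (N + i)%N) == t) B D (zeta p)
    D0 DW B1 yW N.
  have -> : n`!%:R * (B * (zeta p / D)) ^+ n = K1 * gamma^-1 ^+ n.
    rewrite /K1 -[RHS]mulrA -exprMn; congr (_ * _ ^+ _).
    by rewrite zetaS /D; field; rewrite !gt_eqF.
  apply.
  - move=> i iN /eqP ci; have [] := hyn (x (N + i)%N).
      by move=> j; apply: hcell; rewrite ci.
    move=> u uB hu; exists u => //; apply: (le_trans hu).
    rewrite sb mulrA ler_pdivrMr// mulrC ler_wpM2l ?(ltW D0)//.
    by rewrite lerDl divr_ge0 ?powR_ge0 ?(ltW Bk0).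
  - by move=> i iN _; exact: selected.
have NE : N%:R = \sum_(t : {ffun 'I_d -> 'I_m})
    (\sum_(i < N) (cell (x (N + i)%N) == t))%:R :> R.
  rewrite -natr_sum exchange_big /=; congr (_%:R).
  rewrite (eq_bigr (fun _ => 1%N)) ?sum1_card ?card_ord// => i _.
  rewrite (bigD1 (cell (x (N + i)%N)))//= eqxx big1// => t tc.
  by rewrite eq_sym (negbTE tc).
have Nle : N%:R <= m%:R ^+ d * (K2 * gamma `^ (- alpha^-1)) :> R.
  rewrite NE; apply: (@le_trans _ _ (\sum_(t : {ffun 'I_d -> 'I_m}) K2 * gamma `^ (- alpha^-1))).
    by apply: ler_sum => t _; exact: count_le.
  by rewrite sumr_const card_ffun !card_ord -[leLHS]mulr_natl natrX.
have sd : (s^-1) ^+ d = (C1 * n1) `^ (alpha^-1) * gamma `^ (alpha^-1) * A `^ (- alpha^-1) *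
    (2 * N%:R).
  have -> : (s^-1) ^+ d = (D / C1) `^ (- alpha^-1).
    rewrite exprVn -powR_invn ?(ltW sp)// /s -powRrM; congr (_ `^ _).
    by rewrite /alpha; field; rewrite pnatr_eq0 -lt0n d_gt0 (gt_eqF b0).
  have -> : (D / C1) `^ (- alpha^-1) = (C1 / D) `^ (alpha^-1).
    have DC0 : 0 <= D / C1 by rewrite divr_ge0 ?(ltW D0) ?(ltW C10).
    by rewrite -[C1 / D]invf_div -[(D / C1)^-1]powR_inv1// -powRrM mulN1r.
  have N20 : 0 < (2 ^ p.+1)%:R :> R by rewrite ltr0n expn_gt0.
  have gg : gamma `^ (-2) = gamma^-1 ^+ 2.
    by rewrite -[-2]/(- (2%:R)) powR_invn ?(ltW g0)// exprVn.
  have -> : C1 / D = C1 * n1 * gamma * A^-1 * (2 ^ p.+1)%:R `^ alpha.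
    rewrite /D /zeta gg powRN; field.
    by rewrite !gt_eqF// powR_gt0.
  rewrite !powRM ?mulr_ge0 ?powR_ge0 ?invr_ge0 ?(ltW A0) ?(ltW g0) ?(ltW C10) ?(ltW n10)//.
  rewrite -powRrM divff ?gt_eqF// powRr1 ?(ltW N20)//.
  congr (_ * _ * _ * _); last by rewrite expnS natrM.
  by rewrite -[A^-1]powR_inv1 ?(ltW A0)// -powRrM mulN1r.
(* As [zeta] carries [gamma^(-2)], [D] carries [gamma^(-1)] and the number of cells
   [gamma^(1/alpha)], which cancels the factor in the number of points per cell. *)
have gAG : gamma `^ (alpha^-1) * gamma `^ (- alpha^-1) = 1.
  by rewrite powRN divff// gt_eqF// powR_gt0.
have : N%:R <= E * A `^ (- alpha^-1) * N%:R :> R.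
  apply: (le_trans Nle).
  apply: (@le_trans _ _ (((Cg' + s0) / s) ^+ d * (K2 * gamma `^ (- alpha^-1)))).
    rewrite ler_wpM2r// lerXn2r ?nnegrE//.
    by rewrite divr_ge0 ?(ltW sp)// addr_ge0// ltW.
  rewrite exprMn sd le_eqVlt; apply/orP; left; apply/eqP.
  rewrite -[RHS]mulr1 -[X in _ = _ * X]gAG /E; ring.
apply/negP; rewrite -ltNge -[ltRHS]mul1r ltr_pM2r ?ltr0n//.
rewrite powRN ltr_pdivrMr ?powR_gt0// mul1r.
apply: (@lt_le_trans _ _ (E + 1)); first by rewrite ltrDl.
have -> : E + 1 = ((E + 1) `^ alpha) `^ (alpha^-1).
  by rewrite -powRrM divff ?gt_eqF// powRr1// addr_ge0.
by apply: ge0_ler_powR; rewrite ?nnegrE ?powR_ge0 ?invr_ge0 ?(ltW alpha0) ?(ltW A0).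
Qed.

End greedy.

(** * From the power function to the fill distance *)

Section fill_distance.
Context {R : realType} {d : nat} {Om : set 'rV[R]_d}.

Lemma fill_distance_le (X : seq Om) (h : R) :
  (forall y : Om, exists2 z, z \in X & norm2 (val y - val z) <= h) ->
  (fill_distance X <= h%:E)%E.
Proof.
move=> Xh; apply: ge_ereal_sup => _ [y _ <-].
have [z + yz] := Xh y; elim: X {Xh} => // t X IH.
rewrite inE big_cons ge_min => /orP[/eqP <-|zX]; first by rewrite lee_fin yz.
by rewrite IH// orbT.
Qed.

End fill_distance.

Unset Implicit Arguments.

Theorem theorem14 (R : realType) (d : nat) (Om : set 'rV[R]_d)
    (k : Om -> Om -> R) (H : native_space k) (tau : R)
    (d_gt0 : (0 < d)%N)
    (tau_gt : d%:R / 2 < tau)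
    (k_sym : forall x y, k x y = k y x)
    (k_smooth : exists2 Phi : 'rV[R]_d -> R,
       translation_invariant k Phi & fourier_decay Phi tau)
    (H_sobolev : equiv_sobolev H tau)
    (Om_compact : compact Om)
    (Om_cone : interior_cone_condition Om)
    (Om_lip : lipschitz_boundary Om) :
  exists2 c : R, 0 < c &
    forall (gamma : R) (eta : (Om -> R) -> seq Om -> Om -> R)
        (f : Om -> R) (x : nat -> Om),
      0 < gamma <= 1 ->
      (forall g X y, 0 <= eta g X y) ->
      ns_set H f ->
      gamma_stabilized H gamma (eta f) x ->
      forall N : nat, (0 < N)%N ->
        (fill_distance (mkseq x N) <=
          (c * gamma `^ (- 2 / (tau - d%:R / 2)) * N%:R `^ (- 1 / d%:R))%:E)%E.
Proof.
have [Phi kPhi [cPhi [[M PhiM] [g [mg Phi_g [cg [Cg [cg0 _ g_bnd]]]]]]]] := k_smooth.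
have [A A0 rate] := power_rate H d_gt0 tau_gt kPhi cPhi PhiM mg Phi_g cg0 g_bnd
  Om_compact Om_cone.
have [r r0 hr] := compact_coord_bounded Om_compact.
pose D := d%:R * (2 * r).
have diam (y z : Om) : norm2 (val y - val z) <= D.
  apply: norm2_le_coord => [|i]; first by rewrite mulr_ge0// ltW.
  rewrite !mxE (le_trans (ler_normB _ _))// mulr2n mulrDl mul1r lerD//.
have [c c0 low] := power_lower H d_gt0 tau_gt kPhi cPhi PhiM mg Phi_g cg0 g_bnd D.
set b := tau - d%:R / 2 in rate low *.
have b0 : 0 < b by rewrite subr_gt0.
have d0 : 0 < d%:R :> R by rewrite ltr0n.
pose alpha := b / d%:R.
have alpha0 : 0 < alpha by rewrite divr_gt0.
have [K K0 KE] : exists2 K, 0 < K & c * K = A * 2 `^ alpha.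
  exists (A * 2 `^ alpha / c); first by rewrite divr_gt0// mulr_gt0// powR_gt0.
  by rewrite mulrC divfK// gt_eqF.
(* The factor 2 makes the last comparison strict, through [2^b > 1]. *)
exists (2 * K `^ b^-1); first by rewrite mulr_gt0// powR_gt0.
move=> gamma eta f x g01 _ _ stab N N0; have [g0 g1] := andP g01.
have stable : stable_points H gamma x.
  by move=> n y; have [h _] := stab n; exact: ler_ereal_sup_range h g0.
have NR0 : 0 < N%:R :> R by rewrite ltr0n.
set h := 2 * _ * _ * _.
have h0 : 0 < h by rewrite !mulr_gt0 ?powR_gt0.
have hb : h `^ b = 2 `^ b * (K * gamma `^ (- 2) * N%:R `^ (- alpha)).
  rewrite /h !powRM ?mulr_ge0 ?powR_ge0// -!powRrM -!mulrA; congr (_ * _).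
  congr (_ * _); first by rewrite mulVf ?gt_eqF// powRr1// ltW.
  by congr (_ `^ _ * _ `^ _); rewrite /alpha; field; rewrite gt_eqF.
apply: fill_distance_le => y; apply: contrapT => far.
have dist z : z \in mkseq x N -> h <= norm2 (val z - val y).
  move=> zX; rewrite leNgt; apply/negP => lt_h; apply: far; exists z => //.
  by rewrite norm2_distC ltW.
have hD : h <= D.
  (* [x 0] is one of the points because [N] is positive, which brings [h] into the range of the
     lower bound. *)
  by apply: le_trans (dist (x 0) _) (diam _ _); apply: map_f; rewrite mem_iota.
have := low (mkseq x N) y h h0 hD dist.
apply/negP; rewrite -ltNge hb.
(* The rate is known at powers of 2. Passing from [2 ^ p] to [N < 2 ^ p.+1] costs the factor
   [2^alpha] contained in [K]. *)
have [/= pN Np] := andP (trunc_log_bounds (ltnSn 1) N0).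
set p := trunc_log 2 N in pN Np.
apply: (le_lt_trans (power_anti H y (mkseq_sub (x := x) pN))).
apply: (le_lt_trans (rate gamma x g01 stable p y)).
have p0 : 0 < (2 ^ p)%:R :> R by rewrite ltr0n expn_gt0.
have pN_le : (2 ^ p)%:R `^ (- alpha) <= 2 `^ alpha * N%:R `^ (- alpha) :> R.
  rewrite !powRN ler_pdivlMr ?powR_gt0// ler_pdivrMl ?powR_gt0// -powRM ?(ltW p0)//.
  apply: ge0_ler_powR; rewrite ?nnegrE ?(ltW alpha0) ?mulr_ge0 ?(ltW p0) ?(ltW NR0)//.
  by rewrite -natrM -expnSr ler_nat ltnW.
set G := gamma `^ (-2) in hb *; have G0 : 0 < G by rewrite powR_gt0.
have Na0 : 0 < N%:R `^ (- alpha) :> R by rewrite powR_gt0.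
apply: (@le_lt_trans _ _ (c * K * (G * N%:R `^ (- alpha)))).
  by rewrite KE -!mulrA ler_pM2l// mulrCA ler_pM2l.
rewrite -mulrA ltr_pM2l// -[K * _ * _]mulrA ltr_pMl ?mulr_gt0//.
by have := @gt0_ltr_powR R b b0 1 2; rewrite powR1 !nnegrE => -> //; rewrite ltr1n.
Qed.
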